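(* For every integer $k\geq 3$ there exists $\eta_0=\eta_0(k)>0$ such that for every $\gamma\in(0,1)$ with $1-\gamma<\eta_0$ we have, for $X\ge 3$, $$\sum_{\substack{1\leq n,m\leq X\\ n+(k-1)m\leq X}}\ \prod_{i=0}^{k-1}\Lambda_\gamma(n+im)=\sum_{\substack{1\leq n,m\leq X\\ n+(k-1)m\leq X}}\ \prod_{i=0}^{k-1}\Lambda(n+im)+o(X^2)$$ as $X\to\infty$ (the sums are over integers $n,m$).
   Context: $\Lambda$ is the von Mangoldt function. For $c>1$, $\mathrm{PS}_c=\{\lfloor n^c\rfloor: n\in\mathbb{Z}_{>0}\}$. For $\gamma\in(0,1)$ and $n\geq 1$, $\Lambda_\gamma(n)=\frac{n^{1-\gamma}}{\gamma}\Lambda(n)\,1_{n\in\mathrm{PS}_{1/\gamma}}$. *)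

(* Defs.v *)
From HB Require Import structures.
From mathcomp Require Import all_boot all_order all_algebra.
From mathcomp Require Import all_classical all_reals all_analysis.

Set Implicit Arguments.
Unset Strict Implicit.
Unset Printing Implicit Defensive.

Import Order.TTheory GRing.Theory Num.Theory.
Import numFieldNormedType.Exports.

Local Open Scope classical_set_scope.
Local Open Scope ring_scope.

(* prime_decomp n is a singleton [:: (p, e)] exactly when n = p ^ e with
   p prime and e >= 1; it is empty for n = 0 and n = 1. *)
Definition mangoldt (R : realType) (n : nat) : R :=
  if prime_decomp n is [:: (p, _)] then ln p%:R else 0.

(* Since the powers n `^ c are nonnegative, Num.truncn is their integer part. *)
Definition piatetski_shapiro (R : realType) (c : R) : set nat :=
  [set Num.truncn (n%:R `^ c) | n in [set n : nat | (0 < n)%N]].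

Definition mangoldt_ps (R : realType) (gamma : R) (n : nat) : R :=
  n%:R `^ (1 - gamma) / gamma * mangoldt R n
  * \1_(piatetski_shapiro (1 / gamma)) n.

(* For X >= 0, the natural numbers 1 <= n <= X are those with
   1 <= n < (Num.truncn X).+1. *)
Definition ap_sum (R : realType) (k : nat) (f : nat -> R) (X : R) : R :=
  \sum_(1 <= n < (Num.truncn X).+1)
    \sum_(1 <= m < (Num.truncn X).+1 | (n + (k - 1) * m)%:R <= X)
      \prod_(0 <= i < k) f (n + i * m)%N.

(* The little-o notation only applies to filters with a canonical filter_on
   structure, which pinfty_nbhs lacks. *)
Canonical pinfty_filter_on (R : numFieldType) : filter_on R :=
  FilterType (pinfty_nbhs R) (@filter_filter _ _ proper_pinfty_nbhs).

(* Main.v *)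
Require Import Defs.
From HB Require Import structures.
From mathcomp Require Import all_boot all_order all_algebra.
From mathcomp Require Import all_classical all_reals all_analysis.
From mathcomp Require Import ring lra zify.
Set Implicit Arguments.
Unset Strict Implicit.
Unset Printing Implicit Defensive.
Import Order.TTheory GRing.Theory Num.Theory.
Import numFieldNormedType.Exports.
Local Open Scope classical_set_scope.
Local Open Scope ring_scope.

(** Changing the weights one slot at a time writes the difference of the two
sums as [k] sums in which exactly one factor is [Lambda_gamma - Lambda].  When
[gamma] is close to 1 the other factors are bounded by a small power of [X], so
it is enough to save a somewhat larger power of [X] from the one difference
factor, uniformly over all bounded choices of the others ([ap_sum_diff_le]).

With [N] the integer part of [X], the progressions are counted in the cyclic
group of order [k N + 1], where they cannot wrap around ([ap_sum_cyclic]).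
Translating along the progression puts the difference factor at [n]; each of
the other factors becomes a function [W c n m] which is unchanged when
[(n, m)] moves by some [(u c, w c)] with [1 <= u c <= k] ([cyc_sum_dual]).
What has to be bounded is therefore the correlation of [Lambda_gamma - Lambda]
with [n |-> \sum_m \prod_c W c n m] ([ps_prime_sum]).

An integer [n] lies in the Piatetski-Shapiro sequence exactly when
[[n ^ gamma, (n + 1) ^ gamma)] contains an integer, that is, when [n ^ gamma]
falls modulo 1 into an arc of length about [gamma n ^ (gamma - 1)].  On a short
block this length is nearly constant, and approximating a trapezoid over the
arc by its Fejer means reduces the correlation to sums of
[Lambda n * cos (y n ^ gamma + th) * \sum_m \prod_c W c n m], where [y] runs
between 1 and a small power of [X] ([block_sum]).

Vaughan's identity splits these into sums over progressions and bilinear sums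
([mangoldt_cos_sum], [type_one_sum], [type_two_sum]).  In both, the invariance
of the [W c] lets one application of the Cauchy-Schwarz inequality remove one
of them, at the price of differencing the phase ([generalized_von_neumann]).
Once all are removed, only an iterated difference of [y n ^ gamma] is left,
which the mean value theorem evaluates ([rcube_mvt]); the spacings of the
differencing are chosen so that its derivative is small, but still much larger
than the inverse of the length of summation, and the first derivative test
applies ([cos_sum_bound]).

Powers of [X] are counted by the integer [z] with [z ^ D <= N < (z + 1) ^ D].
Every estimate saves any prescribed power of [z] once [D] is large in terms of
[k], and [1 - gamma < 1 / D] gives [N ^ (1 - gamma) <= 2 z]; hence
[eta_0 = 1 / D].  All sums are kept real: a cosine with an arbitrary phase
plays the role of the exponential. *)

(** * First derivative test *)

(** Partial summation from the right end: the increments of the weights [v] are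
nonnegative and each of them multiplies a tail of the series of [x]. *)
Lemma abel_sum_le (R : realType) (v x : nat -> R) (l r : nat) (b M : R) :
  0 <= b -> 0 <= M ->
  (forall n, (l <= n < r)%N -> 0 <= v n <= b) ->
  (forall n, (l <= n)%N -> (n.+1 < r)%N -> v n <= v n.+1) ->
  (forall j, (l <= j < r)%N -> `|\sum_(j <= n < r) x n| <= M) ->
  `|\sum_(l <= n < r) v n * x n| <= b * M.
Proof.
move=> b0 M0 vb vmon xM.
have [rl|lr] := leqP r l; first by rewrite big_geq // normr0 mulr_ge0.
suff key d : (d < r - l)%N ->
    `|\sum_(r - d.+1 <= n < r) v n * x n
      - v (r - d.+1)%N * \sum_(r - d.+1 <= n < r) x n|
    <= (b - v (r - d.+1)%N) * M.
  have d1 : ((r - l).-1 < r - l)%N by lia.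
  have := key _ d1.
  rewrite (_ : r - (r - l).-1.+1 = l)%N; last by lia.
  move=> key1.
  have vl : 0 <= v l <= b by apply: vb; rewrite leqnn lr.
  have Xl : `|\sum_(l <= n < r) x n| <= M by apply: xM; rewrite leqnn lr.
  rewrite -[X in `|X|](subrK (v l * \sum_(l <= n < r) x n)).
  apply: (le_trans (ler_normD _ _)).
  have : `|v l * \sum_(l <= n < r) x n| <= v l * M.
    by rewrite normrM ger0_norm ?ler_wpM2l //; case/andP: vl.
  nra.
elim: d => [_|d IH dlt].
  rewrite subn1 (_ : r = r.-1.+1)%N; last by lia.
  rewrite /= !big_nat1 subrr normr0 mulr_ge0 // subr_ge0.
  by have /andP[] : 0 <= v r.-1 <= b by apply: vb; lia.
have {IH} := IH (ltnW dlt).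
set p := (r - d.+2)%N.
rewrite (_ : r - d.+1 = p.+1)%N; last by rewrite /p; lia.
move=> IH.
have pr : (p < r)%N by rewrite /p; lia.
rewrite big_ltn // (big_ltn pr).
set X := \sum_(p.+1 <= n < r) x n in IH *.
set W := \sum_(p.+1 <= n < r) v n * x n in IH *.
have -> : v p * x p + W - v p * (x p + X) = (W - v p.+1 * X) + (v p.+1 - v p) * X.
  by ring.
apply: (le_trans (ler_normD _ _)).
have vp : v p <= v p.+1 by apply: vmon; rewrite /p; lia.
have XM : `|X| <= M by apply: xM; rewrite /p; lia.
have : `|(v p.+1 - v p) * X| <= (v p.+1 - v p) * M.
  by rewrite normrM ger0_norm ?ler_wpM2l // subr_ge0.
move: IH; nra.
Qed.

Lemma cos_lipschitz (R : realType) (x y : R) : `|cos x - cos y| <= `|x - y|.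
Proof.
wlog xy : x y / x <= y.
  by move=> H; have [/H //|/ltW /H] := leP x y; rewrite distrC (distrC y).
have [c _ E] : exists2 c, c \in `[x, y]%R & cos y - cos x = - sin c * (y - x).
  apply: (@MVT_segment R cos (fun z => - sin z)) => //.
  by apply: continuous_subspaceT => z; exact: continuous_cos.
rewrite distrC (distrC x) E normrM normrN ler_piMl //.
exact: sin_max.
Qed.

(** The error is quadratic, so that dividing by [d] leaves an error of size [d] in
the approximation of [cos x] by a difference quotient. *)
Lemma sin_increment (R : realType) (x d : R) : 0 < d ->
  `|sin (x + d) - sin x - d * cos x| <= d ^+ 2.
Proof.
move=> d0.
have [c cI E] : exists2 c, c \in `[x, x + d]%R &
    sin (x + d) - sin x = cos c * (x + d - x).
  apply: (@MVT_segment R sin cos); first by rewrite lerDl ltW.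
  by apply: continuous_subspaceT => z; exact: continuous_sin.
rewrite E addrAC subrr add0r mulrC -mulrBr normrM gtr0_norm // expr2.
rewrite ler_wpM2l ?(ltW d0) //; apply: (le_trans (cos_lipschitz _ _)).
move: cI; rewrite in_itv /= => /andP[c1 c2].
by rewrite ger0_norm; lra.
Qed.

(** With [d n = g n.+1 - g n], the term [cos (g n)] is
[(sin (g n.+1) - sin (g n)) / d n] up to an error [d n].  The sines telescope
and the weights [(d n)^-1] increase, so partial summation applies.  The bound is
good when [d n] is small but much larger than the inverse of the length. *)
Lemma cos_sum_bound (R : realType) (g : nat -> R) (l r : nat) (dmin dmax : R) :
  0 < dmin -> 0 <= dmax ->
  (forall n, (l <= n < r)%N -> dmin <= g n.+1 - g n <= dmax) ->
  (forall n, (l <= n)%N -> (n.+1 < r)%N -> g n.+2 - g n.+1 <= g n.+1 - g n) ->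
  `|\sum_(l <= n < r) cos (g n)| <= 2 / dmin + (r - l)%:R * dmax.
Proof.
move=> d0 dm0 dd dmon.
pose v n := (g n.+1 - g n)^-1; pose x n := sin (g n.+1) - sin (g n).
have -> : \sum_(l <= n < r) cos (g n) =
    \sum_(l <= n < r) v n * x n + \sum_(l <= n < r) (cos (g n) - v n * x n).
  by rewrite -big_split /=; apply: eq_bigr => n _; rewrite addrC subrK.
apply: (le_trans (ler_normD _ _)); apply: lerD.
  rewrite mulrC; apply: abel_sum_le.
  - by rewrite invr_ge0 ltW.
  - by [].
  - move=> n /dd /andP[h1 h2]; have h3 := lt_le_trans d0 h1.
    by rewrite invr_ge0 (ltW h3) /= lef_pV2.
  - move=> n ln nr; have /dd /andP[h1 _] : (l <= n < r)%N by lia.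
    have /dd /andP[h2 _] : (l <= n.+1 < r)%N by lia.
    by rewrite lef_pV2 ?posrE ?(lt_le_trans d0) //; exact: dmon.
  - move=> j /andP[_ jr]; rewrite telescope_sumr 1?ltnW //.
    apply: (le_trans (ler_normB _ _)).
    by have := sin_max (g r); have := sin_max (g j); lra.
apply: (le_trans (ler_norm_sum _ _ _)).
rewrite mulr_natl -sumr_const_nat big_nat_cond [leRHS]big_nat_cond.
apply: ler_sum => n; rewrite andbT => /dd /andP[h1 h2].
have h3 := lt_le_trans d0 h1.
have := sin_increment (g n) h3; rewrite (addrC (g n)) subrK -/(x n) => h4.
have -> : cos (g n) - v n * x n =
    - (v n * (x n - (g n.+1 - g n) * cos (g n))).
  by rewrite /v; field; rewrite gt_eqF.
rewrite normrN normrM gtr0_norm ?invr_gt0 //; apply: le_trans h2.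
by rewrite ler_pdivrMl // -expr2.
Qed.

(** * Differences over cubes *)

(** Each pair [p] of [ps] splits a point [y] into [y + p.1] and [y + p.2].  Over the
[2 ^ size ps] points so obtained, [cubeM] multiplies the values of [F] and
[cubeD] adds those of [f] with alternating signs.  This is what successive
applications of Cauchy-Schwarz make of an amplitude and of a phase. *)
Fixpoint cubeM (R : realType) (ps : seq (nat * nat)) (F : nat -> R) : nat -> R :=
  if ps is p :: ps' then cubeM ps' (fun y => F (y + p.1)%N * F (y + p.2)%N)
  else F.

Fixpoint cubeD (R : realType) (ps : seq (nat * nat)) (f : nat -> R) : nat -> R :=
  if ps is p :: ps' then cubeD ps' (fun y => f (y + p.1)%N - f (y + p.2)%N)
  else f.

Lemma eq_cubeM (R : realType) ps (F G : nat -> R) :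
  F =1 G -> cubeM ps F =1 cubeM ps G.
Proof. by move=> /funext ->. Qed.

Lemma eq_cubeD (R : realType) ps (F G : nat -> R) :
  F =1 G -> cubeD ps F =1 cubeD ps G.
Proof. by move=> /funext ->. Qed.

Lemma cubeM_mul (R : realType) ps (F G : nat -> R) y :
  cubeM ps (fun y => F y * G y) y = cubeM ps F y * cubeM ps G y.
Proof.
elim: ps F G y => //= p ps IH F G y; rewrite -IH; apply: eq_cubeM => z /=.
by rewrite mulrACA.
Qed.

Lemma cubeD_scale (R : realType) ps c (f : nat -> R) y :
  cubeD ps (fun y => c * f y) y = c * cubeD ps f y.
Proof.
elim: ps f y => //= p ps IH f y; rewrite -IH; apply: eq_cubeD => z /=.
by rewrite mulrBr.
Qed.

Lemma cubeD_shift (R : realType) ps (f : nat -> R) h y :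
  cubeD ps (fun y => f (y + h)%N) y = cubeD ps f (y + h)%N.
Proof.
elim: ps f y => //= p ps IH f y; rewrite -IH; apply: eq_cubeD => z /=.
by rewrite 2!(addnAC z h).
Qed.

Lemma cubeM_shift (R : realType) ps (f : nat -> R) h y :
  cubeM ps (fun y => f (y + h)%N) y = cubeM ps f (y + h)%N.
Proof.
elim: ps f y => //= p ps IH f y; rewrite -IH; apply: eq_cubeM => z /=.
by rewrite 2!(addnAC z h).
Qed.

Lemma cubeD_sub (R : realType) ps (f g : nat -> R) y :
  cubeD ps (fun y => f y - g y) y = cubeD ps f y - cubeD ps g y.
Proof.
elim: ps f g y => //= p ps IH f g y; rewrite -IH; apply: eq_cubeD => z /=.
by ring.
Qed.

(** [cubeD] of the power function with a real base point, which can be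
differentiated. *)
Fixpoint rcube (R : realType) (ps : seq (nat * nat)) (r x : R) : R :=
  if ps is p :: ps' then rcube ps' r (x + p.1%:R) - rcube ps' r (x + p.2%:R)
  else x `^ r.

Lemma cubeD_rcube (R : realType) ps (r : R) y :
  cubeD ps (fun b => b%:R `^ r) y = rcube ps r y%:R.
Proof.
elim: ps y => //= p ps IH y; rewrite -!natrD -!IH -!cubeD_shift.
by rewrite cubeD_sub.
Qed.

Lemma is_derive_rcube (R : realType) ps (r x : R) : 0 < x ->
  is_derive x 1 (rcube ps r) (r * rcube ps (r - 1) x).
Proof.
elim: ps x => /= [|p ps IH] x x0; first exact: is_derive1_powR.
have D c : 0 <= c -> is_derive x 1 (fun x => rcube ps r (x + c))
    (r * rcube ps (r - 1) (x + c)).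
  move=> c0; rewrite -[r * _]mulr1.
  apply: (@is_derive1_comp R (rcube ps r) (fun x => x + c)).
    by apply: IH; rewrite ltr_wpDr.
  by rewrite -[X in is_derive _ _ _ X]addr0; apply: is_deriveD.
have := @is_deriveB _ _ _ _ _ _ _ _ _ (D p.1%:R (ler0n _ _)) (D p.2%:R (ler0n _ _)).
by rewrite mulrBr.
Qed.

(** The mean value theorem is used once for each pair: the derivative of a cube of
[x `^ r] is [r] times the cube of [x `^ (r - 1)], so an outer difference turns
into the factor [r * (p.1 - p.2)] in front of a cube with one pair less. *)
Lemma rcube_mvt (R : realType) ps (r x K : R) : 0 < x ->
  all (fun p => (p.1%:R <= K) && (p.2%:R <= K)) ps ->
  exists2 xi : R, x <= xi <= x + (size ps)%:R * K &
  rcube ps r x = \prod_(j < size ps) (r - j%:R) *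
    \prod_(p <- ps) (p.1%:R - p.2%:R) * xi `^ (r - (size ps)%:R).
Proof.
elim: ps r x => /= [|p ps IH] r x x0.
  move=> _; exists x; first by rewrite mul0r addr0 lexx.
  by rewrite big_ord0 big_nil !mul1r subr0.
move=> /andP[/andP[p1K p2K] /IH{}IH].
have M (a b : R) : 0 <= a -> a <= b -> b <= K -> exists2 y, x <= y <= x + K &
    rcube ps r (x + b) - rcube ps r (x + a) = r * rcube ps (r - 1) y * (b - a).
  move=> a0 ab bK; have [y] : exists2 y, y \in `[x + a, x + b]%R &
      rcube ps r (x + b) - rcube ps r (x + a) =
      r * rcube ps (r - 1) y * (x + b - (x + a)).
    apply: MVT_segment; first by rewrite lerD2l.
      move=> y; rewrite in_itv /= => /andP[ya _]; apply: is_derive_rcube.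
      by apply: le_lt_trans ya; apply: addr_ge0 => //; exact: ltW.
    apply: continuous_in_subspaceT => y; rewrite inE /= in_itv /= => /andP[ya _].
    have y0 : 0 < y by apply: lt_le_trans ya; rewrite ltr_wpDr.
    have [dy _] := is_derive_rcube ps r y0.
    exact/differentiable_continuous/derivable1_diffP.
  rewrite in_itv /= => /andP[y1 y2] ->; exists y; first by lra.
  by congr (_ * _); ring.
have [y /andP[y1 y2] ->] : exists2 y, x <= y <= x + K &
    rcube ps r (x + p.1%:R) - rcube ps r (x + p.2%:R) =
    r * rcube ps (r - 1) y * (p.1%:R - p.2%:R).
  have [h|/ltW h] := leP (p.2%:R : R) p.1%:R; first exact: M.
  have [//|y yI E] := M _ _ _ h p2K; exists y => //.
  by rewrite -opprB E -mulrN opprB.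
have [xi /andP[xi1 xi2] ->] := IH (r - 1) y (lt_le_trans x0 y1).
exists xi.
  by rewrite (le_trans y1) // (le_trans xi2) //= mulrSr mulrDl mul1r; lra.
rewrite big_ord_recl big_cons subr0.
have -> : \prod_(i < size ps) (r - (lift ord0 i)%:R) =
    \prod_(j < size ps) (r - 1 - j%:R).
  by apply: eq_bigr => j _; rewrite lift0 mulrSr; ring.
rewrite (_ : r - (size ps).+1%:R = r - 1 - (size ps)%:R); last first.
  by rewrite mulrSr; ring.
by ring.
Qed.

Lemma ler_powRn (R : realType) (e x y : R) : e <= 0 -> 0 < x -> x <= y ->
  y `^ e <= x `^ e.
Proof.
move=> e0 x0 xy; have y0 := lt_le_trans x0 xy.
rewrite -[e]opprK !(powRN _ (- e)) lef_pV2 ?posrE ?powR_gt0 //.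
by rewrite ge0_ler_powR ?oppr_ge0 // nnegrE ltW.
Qed.

Definition falling (R : realType) (r : R) (s : nat) : R :=
  \prod_(j < s) (r - j%:R).

Definition gaps (R : realType) (ps : seq (nat * nat)) : R :=
  \prod_(p <- ps) (p.1%:R - p.2%:R).

(** An increment of the phase is a cube difference with the additional pair
[(1, 0)], and a second increment one with two such pairs, so [rcube_mvt]
evaluates both.  The additional factor [g - s.+1%:R] of the second increment is
negative: the increments keep their sign and decrease in absolute value, as
the first derivative test requires. *)
Lemma cos_sum_cube (R : realType) (g C : R) ps (K l r : nat) (M : R) :
  let s := size ps in
  let A := `|C * falling g s.+1 * gaps R ps| in
  0 < g < 1 -> 0 < A -> (0 < l)%N -> (0 < K)%N ->
  all (fun p => (p.1 <= K) && (p.2 <= K))%N ps ->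
  r%:R + s.+2%:R * K%:R <= M ->
  `|\sum_(l <= n < r) cos (C * cubeD ps (fun b => b%:R `^ g) n)| <=
    2 / (A * M `^ (g - s.+1%:R)) + (r - l)%:R * (A * l%:R `^ (g - s.+1%:R)).
Proof.
move=> s A /andP[g0 g1] A0 l0 K0 psK rM.
pose B := C * falling g s.+1 * gaps R ps.
have K1 : (1 : R) <= K%:R by rewrite ler1n.
have psK' : all (fun p : nat * nat => (p.1%:R <= K%:R :> R) && (p.2%:R <= K%:R :> R)) ps.
  by apply: sub_all psK => p /=; rewrite !ler_nat.
pose f n := C * cubeD ps (fun b => b%:R `^ g) n.
have e0 : g - s.+1%:R <= 0.
  by rewrite subr_le0 (le_trans (ltW g1)) // ler1n.
have fE n : f n = C * rcube ps g n%:R by rewrite /f cubeD_rcube.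
have d1 n : (l <= n < r)%N -> exists2 xi : R, l%:R <= xi <= M &
    f n.+1 - f n = B * xi `^ (g - s.+1%:R).
  move=> /andP[ln nr]; have n0 : (0 : R) < n%:R by rewrite ltr0n (leq_trans l0).
  have [|xi /andP[x1 x2] /= E] := @rcube_mvt R ((1, 0)%N :: ps) g n%:R K%:R n0.
    by rewrite /= K1 ler0n psK'.
  exists xi.
    rewrite (le_trans _ x1) ?ler_nat //= (le_trans x2) // (le_trans _ rM) //=.
    by apply: lerD; rewrite ?ler_nat 1?ltnW // ler_wpM2r ?ler0n // ler_nat.
  rewrite !fE -natr1 -mulrBr; move: E; rewrite !addr0 => ->.
  rewrite big_cons /= subr0 /B /falling /gaps -/s.
  by ring.
have d2 n : (l <= n)%N -> (n.+1 < r)%N -> exists2 xi : R, 0 < xi &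
    f n.+2 - f n.+1 - (f n.+1 - f n) = B * (g - s.+1%:R) * xi `^ (g - s.+2%:R).
  move=> ln nr; have n0 : (0 : R) < n%:R by rewrite ltr0n (leq_trans l0).
  have [|xi /andP[x1 x2] /= E] := @rcube_mvt R ((1, 0)%N :: (1, 0)%N :: ps) g n%:R K%:R n0.
    by rewrite /= K1 ler0n psK'.
  exists xi; first by rewrite (lt_le_trans n0).
  rewrite !fE -(natr1 n.+1) -(natr1 n) -!mulrBr; move: E; rewrite !addr0 => ->.
  by rewrite !big_cons big_ord_recr /= !subr0 /B /falling /gaps -/s; ring.
have M0 : 0 < M.
  by apply: lt_le_trans rM; rewrite ltr_wpDl // mulr_gt0 ?ltr0n.
have key (f' : nat -> R) (D : R) : D = A ->
    (forall n, (l <= n < r)%N -> exists2 xi : R, l%:R <= xi <= M &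
      f' n.+1 - f' n = D * xi `^ (g - s.+1%:R)) ->
    (forall n, (l <= n)%N -> (n.+1 < r)%N ->
      f' n.+2 - f' n.+1 <= f' n.+1 - f' n) ->
  `|\sum_(l <= n < r) cos (f' n)| <=
    2 / (A * M `^ (g - s.+1%:R)) + (r - l)%:R * (A * l%:R `^ (g - s.+1%:R)).
  move=> -> h1 h2; apply: cos_sum_bound => //.
  - by rewrite mulr_gt0 ?powR_gt0.
  - by rewrite mulr_ge0 ?powR_ge0 ?ltW.
  - move=> n /h1 [xi /andP[x1 x2] ->].
    have x0 : 0 < xi by apply: lt_le_trans x1; rewrite ltr0n.
    by rewrite !ler_pM2l // !ler_powRn ?ltr0n.
have /orP[B0|B0] : (0 <= B) || (B <= 0) by exact: le_total.
  apply: (key f B) => //; first by rewrite /A ger0_norm.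
  move=> n ln nr; have [xi xi0 E] := d2 n ln nr.
  by rewrite -subr_le0 E mulr_le0_ge0 ?powR_ge0 // mulr_ge0_le0.
(* For B <= 0 the phase is replaced by its opposite. *)
rewrite (eq_bigr (fun n => cos (- f n))); last by move=> n _; rewrite cosN.
apply: (key (fun n => - f n) (- B)); first by rewrite /A ler0_norm.
  move=> n /d1 [xi xiI E]; exists xi => //.
  by rewrite mulNr -E; ring.
move=> n ln nr; have [xi xi0 E] := d2 n ln nr.
rewrite -subr_le0 (_ : _ - _ = - (f n.+2 - f n.+1 - (f n.+1 - f n))); last by ring.
by rewrite E oppr_le0 mulr_ge0 ?powR_ge0 // mulr_le0.
Qed.

(** * Generalized von Neumann inequality *)

Lemma sqr_sum_le (R : realFieldType) (I : Type) (r : seq I) (x : I -> R) :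
  (\sum_(i <- r) x i) ^+ 2 <= (size r)%:R * \sum_(i <- r) x i ^+ 2.
Proof.
elim: r => [|i r IH]; first by rewrite !big_nil expr0n mul0r.
rewrite !big_cons /= -natr1.
set S := \sum_(j <- r) x j in IH *; set Q := \sum_(j <- r) _ in IH *.
have Q0 : 0 <= Q by apply: sumr_ge0 => j _; exact: sqr_ge0.
case: (posnP (size r)) IH => [-> | n0 IH].
  rewrite mul0r => S0; have {S0} : S == 0 by rewrite -sqrf_eq0 eq_le S0 sqr_ge0.
  by move=> /eqP ->; nra.
have N0 : (0 : R) < (size r)%:R by rewrite ltr0n.
move: (size r)%:R N0 IH => N N0 IH.
suff : 0 <= N * (N * x i ^+ 2 + Q - 2 * x i * S).
  by rewrite pmulr_rge0 //; nra.
have := sqr_ge0 (N * x i - S); nra.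
Qed.

Lemma sqr_sum_fin_le (R : realFieldType) (I : finType) (x : I -> R) :
  (\sum_i x i) ^+ 2 <= #|I|%:R * \sum_i x i ^+ 2.
Proof. by have := sqr_sum_le (enum I) x; rewrite !big_enum -cardT. Qed.

Lemma sum_shift_nat (R : realType) (f : nat -> R) (h Y : nat) :
  (forall y, f y != 0 -> (h <= y < Y)%N) ->
  \sum_(0 <= y < Y) f y = \sum_(0 <= y < Y) f (y + h)%N.
Proof.
move=> fs; have f0 y : ~~ (h <= y < Y)%N -> f y = 0.
  by move=> hy; apply/eqP; apply: contraNT hy => /fs.
transitivity (\sum_(0 <= y < Y + h) f y).
  rewrite [RHS](@big_cat_nat _ _ _ Y) //= ?leq_addr // [X in _ + X]big1_seq ?addr0 //.
  by move=> y /=; rewrite mem_index_iota => hy; apply: f0; lia.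
rewrite (@big_cat_nat _ _ _ h) //= ?leq_addl // big1_seq ?add0r.
  by rewrite -{1}[h]add0n big_addn addnK.
by move=> y /=; rewrite mem_index_iota => hy; apply: f0; lia.
Qed.

Lemma sum_interval_le (R : realType) (a b H : nat) :
  \sum_(0 <= y < H) (a <= y < b)%N%:R <= (b - a)%:R :> R.
Proof.
rewrite -natr_sum ler_nat; apply: (@leq_trans (minn b H - a)); last by lia.
elim: H => [|H IH]; first by rewrite big_geq.
rewrite big_nat_recr //=; move: IH; set S := \sum_(0 <= i < H) _ => IH.
by case: (boolP (a <= H < b)%N) => hH /=; lia.
Qed.

(** The right-hand side is the square of the modulus of the sum of
[B t * e ^ (i f t)], of which the left-hand side is the square of the real
part. *)
Lemma sqr_sum_cos (R : realType) (I : Type) (r : seq I) (B f : I -> R) :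
  (\sum_(t <- r) B t * cos (f t)) ^+ 2 <=
  \sum_(t <- r) \sum_(t' <- r) B t * B t' * cos (f t - f t').
Proof.
have -> : \sum_(t <- r) \sum_(t' <- r) B t * B t' * cos (f t - f t') =
    (\sum_(t <- r) B t * cos (f t)) ^+ 2 + (\sum_(t <- r) B t * sin (f t)) ^+ 2.
  rewrite !expr2 !mulr_suml -big_split /=; apply: eq_bigr => t _.
  rewrite !mulr_sumr -big_split /=; apply: eq_bigr => t' _.
  by rewrite cosB; ring.
by rewrite lerDl sqr_ge0.
Qed.

Definition spread_pair (lam K : nat) (p : nat * nat) : bool :=
  [&& p.1 <= K, p.2 <= K & (lam + p.1 <= p.2) || (lam + p.2 <= p.1)]%N.

(** The relative bound left after [s] applications of Cauchy-Schwarz that start from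
[eps], when at each of them a proportion [kap] of the pairs of shifts is too
close together and is bounded trivially. *)
Fixpoint cauchy_loss (R : realType) (eps kap : R) (s : nat) : R :=
  if s is s'.+1 then Num.sqrt (cauchy_loss eps kap s' + kap) else eps.

Lemma cauchy_loss_ge0 (R : realType) (eps kap : R) s : 0 <= eps -> 0 <= cauchy_loss eps kap s.
Proof. by case: s => //= s _; exact: sqrtr_ge0. Qed.

Lemma sum_near_le (R : realType) (lam H t : nat) :
  \sum_(0 <= t' < H) (~~ ((lam + t <= t') || (lam + t' <= t)))%N%:R
    <= (2 * lam)%:R :> R.
Proof.
apply: (@le_trans _ _ (\sum_(0 <= t' < H) (t.+1 - lam <= t' < t + lam)%N%:R)).
  apply: ler_sum => t' _; rewrite ler_nat.
  case: (boolP ((lam + t <= t') || (lam + t' <= t))%N) => //= h2.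
  by case: (boolP (t.+1 - lam <= t' < t + lam)%N) => //= h1; lia.
by apply: (le_trans (sum_interval_le _ _ _ _)); rewrite ler_nat; lia.
Qed.

(** Translating [y] by [u s * t] and [m] by [w s *+ t] for [t < H] leaves the sum and
[W s] unchanged.  In the average over [t] the factor [W s] is thus common to all
terms, and Cauchy-Schwarz removes it.  A pair [(t, t')] is left with a sum of
the same shape: the products of two translates of the other functions are
invariant under the same shifts, the amplitude is multiplied by a translate of
itself, and the phase is differenced.  The pairs with [t] and [t'] closer than
[lam] are a proportion [2 * lam / H] and are estimated trivially; for the others
[u s * t] and [u s * t'] are still at least [lam] apart because [0 < u s], and
the induction applies.  After [s] steps the cube sums of the last hypothesis are
reached.  The support of [F] stays away from 0 to make room for the translates,
and [i] is a parameter over which everything is averaged. *)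
Lemma generalized_von_neumann (R : realType) (V : finZmodType) (I : finType)
    (u : nat -> nat) (w : nat -> I -> V) (k lam H Y : nat) (eps : R) (s : nat)
    (F f : I -> nat -> R) (W : nat -> I -> nat -> V -> R) :
  (0 < H)%N -> 0 <= eps ->
  (forall c, 0 < u c <= k)%N ->
  (forall i y, `|F i y| <= 1) ->
  (forall c i y m, `|W c i y m| <= 1) ->
  (forall c i y m, W c i (y + u c)%N (m + w c i) = W c i y m) ->
  (forall i y, F i y != 0 -> (s * (k * H) <= y < Y)%N) ->
  (forall ps, size ps = s -> all (spread_pair lam (k * H)) ps ->
     `|\sum_i \sum_(0 <= y < Y) cubeM ps (F i) y * cos (cubeD ps (f i) y)|
       <= eps * (#|I| * Y)%:R) ->
  `|\sum_i \sum_(0 <= y < Y) \sum_m F i y * cos (f i y) *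
      \prod_(c < s) W c i y m|
    <= cauchy_loss eps (2 * lam%:R / H%:R) s * (#|I| * Y * #|V|)%:R.
Proof.
move=> H0 eps0 uk F1 W1 Winv.
elim: s F f W F1 W1 Winv => [|s IH] F f W F1 W1 Winv Fs base.
  have /= := base [::] erefl isT.
  have -> : \sum_i \sum_(0 <= y < Y) \sum_m F i y * cos (f i y) *
      \prod_(c < 0) W c i y m =
      (\sum_i \sum_(0 <= y < Y) F i y * cos (f i y)) * #|V|%:R.
    rewrite mulr_suml; apply: eq_bigr => i _.
    rewrite mulr_suml; apply: eq_bigr => y _.
    rewrite mulr_natr -sumr_const; apply: eq_bigr => m _.
    by rewrite big_ord0 mulr1.
  rewrite normrM normr_nat /= => h; rewrite [in leRHS]natrM mulrA; apply: ler_wpM2r => //.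
set n : R := (#|I| * Y * #|V|)%:R.
have n0 : 0 <= n by exact: ler0n.
have H0' : (0 : R) < H%:R by rewrite ltr0n.
pose v := cauchy_loss eps (2 * lam%:R / H%:R) s.
have v0 : 0 <= v by exact: cauchy_loss_ge0.
pose B t i y m := F i (y + u s * t)%N *
  \prod_(c < s) W c i (y + u s * t)%N (m + w s i *+ t).
pose T := \sum_i \sum_(0 <= y < Y) \sum_m F i y * cos (f i y) *
      \prod_(c < s.+1) W c i y m.
have WinvS t c i y m : W c i (y + u c * t)%N (m + w c i *+ t) = W c i y m.
  elim: t => [|t IHt]; first by rewrite muln0 addn0 mulr0n addr0.
  by rewrite mulnS [(u c + _)%N]addnC addnA mulrSr addrA Winv.
have TE t : (t < H)%N -> T = \sum_i \sum_(0 <= y < Y) \sum_m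
    W s i y m * (B t i y m * cos (f i (y + u s * t)%N)).
  move=> tH; apply: eq_bigr => i _.
  rewrite (@sum_shift_nat _ _ (u s * t)); last first.
    move=> y hy; have : F i y != 0.
      apply: contraNneq hy => Fy; rewrite big1 // => m _.
      by rewrite Fy !mul0r.
    move=> /Fs /andP[y1 ->]; rewrite andbT.
    have /andP[_ usk] := uk s; move: y1; rewrite mulSn.
    have := leq_mul usk (ltnW tH); lia.
  apply: eq_bigr => y _.
  rewrite (reindex_inj (addIr (w s i *+ t))) /=.
  apply: eq_bigr => m _; rewrite big_ord_recr /= WinvS /B.
  by ring.
have HT : (H%:R * T) ^+ 2 <= n * \sum_i \sum_(0 <= y < Y) \sum_m
    (\sum_(0 <= t < H) B t i y m * cos (f i (y + u s * t)%N)) ^+ 2.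
  have -> : H%:R * T = \sum_i \sum_(0 <= y < Y) \sum_m
      W s i y m * \sum_(0 <= t < H) B t i y m * cos (f i (y + u s * t)%N).
    transitivity (\sum_(0 <= t < H) T).
      by rewrite sumr_const_nat subn0 mulr_natl.
    rewrite (eq_big_nat _ _ (F2 := fun t => \sum_i \sum_(0 <= y < Y) \sum_m
      W s i y m * (B t i y m * cos (f i (y + u s * t)%N)))); last first.
      by move=> t /= tH; exact: TE.
    rewrite exchange_big /=; apply: eq_bigr => i _.
    rewrite exchange_big /=; apply: eq_bigr => y _.
    by rewrite exchange_big /=; apply: eq_bigr => m _; rewrite -mulr_sumr.
  apply: (le_trans (sqr_sum_fin_le _)).
  rewrite /n !natrM -!mulrA ler_wpM2l //.
  rewrite !mulr_sumr; apply: ler_sum => i _.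
  apply: (le_trans (sqr_sum_le _ _)).
  rewrite size_iota subn0 ler_wpM2l // mulr_sumr; apply: ler_sum => y _.
  apply: (le_trans (sqr_sum_fin_le _)).
  rewrite ler_wpM2l //; apply: ler_sum => m _.
  rewrite exprMn ler_piMl ?sqr_ge0 // -real_normK ?num_real //.
  by rewrite expr_le1.
pose Wt t t' c i y m := W c i (y + u s * t)%N (m + w s i *+ t) *
  W c i (y + u s * t')%N (m + w s i *+ t').
pose Ft t t' i y := F i (y + u s * t)%N * F i (y + u s * t')%N.
pose ft t t' i y := f i (y + u s * t)%N - f i (y + u s * t')%N.
pose T' t t' := \sum_i \sum_(0 <= y < Y) \sum_m Ft t t' i y * cos (ft t t' i y) *
      \prod_(c < s) Wt t t' c i y m.
have HT' : (H%:R * T) ^+ 2 <=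
    n * \sum_(0 <= t < H) \sum_(0 <= t' < H) T' t t'.
  apply: (le_trans HT); rewrite ler_wpM2l //.
  have -> : \sum_(0 <= t < H) \sum_(0 <= t' < H) T' t t' =
    \sum_i \sum_(0 <= y < Y) \sum_m \sum_(0 <= t < H) \sum_(0 <= t' < H)
      Ft t t' i y * cos (ft t t' i y) * \prod_(c < s) Wt t t' c i y m.
    under eq_bigr do rewrite exchange_big /=.
    rewrite exchange_big /=; apply: eq_bigr => i _.
    under eq_bigr do rewrite exchange_big /=.
    rewrite exchange_big /=; apply: eq_bigr => y _.
    under eq_bigr do rewrite exchange_big /=.
    by rewrite exchange_big /=.
  apply: ler_sum => i _; apply: ler_sum => y _; apply: ler_sum => m _.
  apply: (le_trans (sqr_sum_cos _ _ _)).
  apply: ler_sum => t _; apply: ler_sum => t' _.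
  rewrite /B /Ft /ft /Wt big_split /= le_eqVlt; apply/orP; left; apply/eqP.
  by ring.
have P1 (P Q : R) : `|P| <= 1 -> `|Q| <= 1 -> `|P * Q| <= 1.
  by move=> hP hQ; rewrite normrM mulr_ile1.
have Wt1 t t' c i y m : `|Wt t t' c i y m| <= 1 by exact: P1.
have Ft1 t t' i y : `|Ft t t' i y| <= 1 by exact: P1.
have triv t t' : T' t t' <= n.
  rewrite /T' /n !natrM -mulrA mulr_natl -sumr_const; apply: ler_sum => i _.
  rewrite mulr_natl -[X in _ *+ X]subn0 -sumr_const_nat; apply: ler_sum => y _.
  rewrite -sumr_const; apply: ler_sum => m _.
  apply: (le_trans (ler_norm _)).
  apply: (P1); first by apply: P1 => //; exact: cos_max.
  by rewrite normr_prod; apply: prodr_ile1 => c _; rewrite normr_ge0 Wt1.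
have good t t' : (t < H)%N -> (t' < H)%N ->
    ((lam + t <= t') || (lam + t' <= t))%N -> T' t t' <= v * n.
  move=> tH t'H tt'; apply: (le_trans (ler_norm _)); apply: IH => //.
  - move=> c i y m; rewrite /Wt.
    by rewrite !(addnAC y (u c)) !(addrAC m (w c i)) !Winv.
  - move=> i y hy.
    have /Fs h1 : F i (y + u s * t)%N != 0 by apply: contraNneq hy => h; rewrite /Ft h mul0r.
    have h2 : (u s * t <= k * H)%N.
      by have /andP[_ usk] := uk s; rewrite leq_mul // ltnW.
    by move: h1; rewrite mulSn; lia.
  - move=> ps sps aps.
    have := base ((u s * t, u s * t')%N :: ps); apply; first by rewrite /= sps.
    rewrite /= aps andbT /spread_pair /=.
    have /andP[us0 usk] := uk s.
    apply/and3P; split; [by rewrite leq_mul // ltnW | by rewrite leq_mul // ltnW |].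
    by case/orP: tt' => tt'; apply/orP; [left|right]; nia.
have all t t' : (t < H)%N -> (t' < H)%N ->
    T' t t' <= v * n + (~~ ((lam + t <= t') || (lam + t' <= t)))%N%:R * n.
  move=> tH t'H; case: (boolP (_ || _)) => /= h; first by rewrite mul0r addr0 good.
  by rewrite mul1r (le_trans (triv _ _)) // lerDr mulr_ge0.
have sumT : \sum_(0 <= t < H) \sum_(0 <= t' < H) T' t t' <=
    H%:R ^+ 2 * (v + 2 * lam%:R / H%:R) * n.
  have -> : H%:R ^+ 2 * (v + 2 * lam%:R / H%:R) * n =
      \sum_(0 <= t < H) (H%:R * (v * n) + (2 * lam)%:R * n).
    rewrite sumr_const_nat subn0 -mulr_natl natrM.
    by field; rewrite gt_eqF.
  rewrite big_nat_cond [leRHS]big_nat_cond; apply: ler_sum => t; rewrite andbT => /= tH.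
  apply: (@le_trans _ _ (\sum_(0 <= t' < H)
    (v * n + (~~ ((lam + t <= t') || (lam + t' <= t)))%N%:R * n))).
    rewrite big_nat_cond [leRHS]big_nat_cond; apply: ler_sum => t'; rewrite andbT => /= t'H.
    exact: all.
  rewrite big_split /= sumr_const_nat subn0 -[X in X + _]mulr_natl lerD2l -mulr_suml.
  by rewrite ler_wpM2r // sum_near_le.
rewrite -/T -/n.
rewrite (_ : cauchy_loss _ _ s.+1 = Num.sqrt (v + 2 * lam%:R / H%:R)) //.
have kap0 : 0 <= v + 2 * lam%:R / H%:R.
  by rewrite addr_ge0 // !mulr_ge0 // invr_ge0.
rewrite -ler_sqr ?nnegrE ?normr_ge0 ?mulr_ge0 ?sqrtr_ge0 //.
rewrite exprMn sqr_sqrtr // real_normK ?num_real //.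
rewrite -(@ler_pM2l _ (H%:R ^+ 2)) ?exprn_gt0 // -exprMn.
apply: (le_trans HT'); apply: (le_trans (ler_wpM2l n0 sumT)).
by rewrite le_eqVlt; apply/orP; left; apply/eqP; ring.
Qed.

(** * Vaughan identity *)

Lemma mangoldt_pfactor (R : realType) p e : prime p -> (0 < e)%N ->
  mangoldt R (p ^ e) = ln p%:R.
Proof.
move=> pp e0; rewrite /mangoldt prime_decompE primesX // primes_prime //.
Qed.

Lemma mangoldt_eq0 (R : realType) n :
  (forall p e, prime p -> (0 < e)%N -> n != (p ^ e)%N) -> mangoldt R n = 0.
Proof.
move=> hn; rewrite /mangoldt; case E: (prime_decomp n) => [//|[p e] [|//]].
have [|pp e0 _] := @mem_prime_decomp n p e; first by rewrite E mem_head.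
have n0 : (0 < n)%N by case: n E {hn}.
have := prod_prime_decomp n0; rewrite E big_seq1 /= => En.
by have := hn p e pp e0; rewrite {1}En eqxx.
Qed.

Lemma mangoldt_ge0 (R : realType) n : 0 <= mangoldt R n.
Proof.
rewrite /mangoldt; case E: (prime_decomp n) => [//|[p e] [|//]].
have [|pp e0 _] := @mem_prime_decomp n p e; first by rewrite E mem_head.
by rewrite ln_ge0 // ler1n prime_gt0.
Qed.

Lemma mangoldt_le_ln (R : realType) n : (0 < n)%N -> mangoldt R n <= ln n%:R.
Proof.
move=> n0; rewrite /mangoldt; case E: (prime_decomp n) => [|[p e] [|//]].
- by rewrite ln_ge0 // ler1n.
- have [|pp e0 pn] := @mem_prime_decomp n p e; first by rewrite E mem_head.
  have pn' : (p <= n)%N.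
    by rewrite dvdn_leq //; apply: dvdn_trans pn; rewrite -{1}[p]expn1 dvdn_exp2l.
  have p0 := prime_gt0 pp.
  by rewrite ler_ln ?posrE ?ltr0n ?ler_nat.
- by move=> *; apply: ln_ge0; rewrite ler1n.
Qed.

Lemma sum_prime_powers (R : realType) p n : prime p -> (0 < n)%N ->
  \sum_(1 <= i < n.+1) (p ^ i %| n)%N%:R = (logn p n)%:R :> R.
Proof.
move=> pp n0; rewrite logn_count_dvd // natr_sum.
rewrite big_nat_recr //= (_ : (p ^ n %| n)%N = false) ?addr0 //.
apply/negbTE/negP => /dvdn_leq - /(_ n0).
by rewrite leqNgt ltn_expl // prime_gt1.
Qed.

(** Unfolding the value into a sum over pairs [(p, i)] lets the sum over divisors
below be exchanged with it. *)
Lemma mangoldt_expand (R : realType) n e : (0 < e <= n)%N ->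
  mangoldt R e = \sum_(1 <= p < n.+1 | prime p) \sum_(1 <= i < n.+1)
    (e == p ^ i)%N%:R * ln p%:R.
Proof.
move=> /andP[e0 en].
have [[p [i [pp i0 E]]]|H] := pselect (exists p i, [/\ prime p, (0 < i)%N & e = (p ^ i)%N]).
  have pn : (1 <= p < n.+1)%N.
    rewrite prime_gt0 //= ltnS (leq_trans _ en) // E -{1}[p]expn1.
    by rewrite leq_pexp2l // prime_gt0.
  have iN : (1 <= i < n.+1)%N.
    by rewrite i0 /= ltnS (leq_trans _ en) // E ltnW // ltn_expl // prime_gt1.
  rewrite -big_filter (bigD1_seq p) ?mem_filter ?filter_uniq ?mem_index_iota ?iota_uniq ?pp //=.
  rewrite (bigD1_seq i) ?mem_index_iota ?iota_uniq //=.
  rewrite E eqxx mul1r mangoldt_pfactor // -addrA -[LHS]addr0; congr (_ + _).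
  rewrite big1 ?add0r => [|j jp].
    rewrite big1_seq // => q /andP[qp]; rewrite mem_filter => /andP[pq _].
    rewrite big1_seq // => j /andP[_].
    rewrite mem_index_iota => /andP[j0 _].
    case: eqP => [Eq|]; last by rewrite mul0r.
    have : p \in primes (q ^ j) by rewrite -Eq primesX // primes_prime // mem_head.
    by rewrite primesX // primes_prime // inE eq_sym (negbTE qp).
  rewrite eqn_exp2l ?prime_gt1 // eq_sym (negbTE jp) mul0r //.
rewrite mangoldt_eq0; last first.
  by move=> p i pp i0; apply/eqP => E; apply: H; exists p, i.
rewrite big1 // => p pp; rewrite big1_seq // => i /andP[_].
rewrite mem_index_iota => /andP[i0 _]; case: eqP => [E|]; last by rewrite mul0r.
by exfalso; apply: H; exists p, i.
Qed.

Lemma ln_prod_primes (R : realType) n : (0 < n)%N ->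
  ln n%:R = \sum_(1 <= p < n.+1 | prime p) (logn p n)%:R * ln p%:R :> R.
Proof.
move=> n0.
have -> : ln n%:R = \sum_(p <- primes n) (logn p n)%:R * ln p%:R :> R.
  rewrite {1}[n]prod_prime_decomp // prime_decompE big_map /=.
  have : all (fun p => 0 < p)%N (primes n).
    by apply/allP => p; rewrite mem_primes => /andP[/prime_gt0].
  elim: (primes n) => [|p l IH] /=; first by rewrite !big_nil ln1.
  move=> /andP[p0 l0]; rewrite !big_cons -IH // natrM lnM.
  - by rewrite natrX lnXn ?ltr0n // mulr_natl.
  - by rewrite posrE ltr0n expn_gt0 p0.
  - rewrite posrE ltr0n; move: l0; elim: l {IH} => [|q l IHl] /=; first by rewrite big_nil.
    by move=> /andP[q0 l0]; rewrite big_cons muln_gt0 expn_gt0 q0 IHl.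
rewrite (_ : primes n = [seq p <- index_iota 1 n.+1 | p \in primes n]); last first.
  apply: (irr_sorted_eq ltn_trans ltnn) => [||p].
  - exact: sorted_primes.
  - by rewrite sorted_filter ?iota_ltn_sorted //; exact: ltn_trans.
  rewrite mem_filter mem_index_iota; case: (boolP (p \in primes n)) => //=.
  by rewrite mem_primes ltnS => /and3P[pp _ /dvdn_leq ->] //; rewrite prime_gt0.
rewrite big_filter big_mkcond [RHS]big_mkcond; apply: eq_bigr => p _ /=.
rewrite -logn_gt0; case: ifPn => [|].
  by rewrite logn_gt0 mem_primes => /andP[->].
by rewrite -leqNgt leqn0 => /eqP ->; rewrite mul0r if_same.
Qed.

Lemma sum_mangoldt (R : realType) n N : (0 < n <= N)%N ->
  \sum_(1 <= e < N.+1) (e %| n)%N%:R * mangoldt R e = ln n%:R.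
Proof.
move=> /andP[n0 nN].
rewrite (@big_cat_nat _ _ _ n.+1) //= [X in _ + X]big1_seq ?addr0; last first.
  move=> e /=; rewrite mem_index_iota => /andP[ne _].
  case: (boolP (e %| n)%N) => [/dvdn_leq|]; last by rewrite mul0r.
  by move=> /(_ n0); rewrite leqNgt ne.
rewrite ln_prod_primes //.
transitivity (\sum_(1 <= e < n.+1) \sum_(1 <= p < n.+1 | prime p)
   \sum_(1 <= i < n.+1) (e %| n)%N%:R * ((e == p ^ i)%N%:R * ln p%:R) : R).
  rewrite !big_nat; apply: eq_bigr => e en; rewrite (@mangoldt_expand _ n) //.
  by rewrite mulr_sumr; apply: eq_bigr => p _; rewrite mulr_sumr.
rewrite exchange_big /=; apply: eq_bigr => p pp.
rewrite exchange_big /= -sum_prime_powers // mulr_suml.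
rewrite !big_nat; apply: eq_bigr => i /andP[i0 _].
case: (boolP (p ^ i %| n)%N) => [pn|pn]; last first.
  rewrite mul0r big1 // => e _; case: eqP => [->|]; last by rewrite mul0r mulr0.
  by rewrite (negbTE pn) mul0r.
have pin : (p ^ i)%N \in index_iota 1 n.+1.
  by rewrite mem_index_iota expn_gt0 prime_gt0 //= ltnS dvdn_leq.
rewrite (bigD1_seq (p ^ i)%N) ?iota_uniq //= eqxx pn !mul1r big1 ?addr0 //.
by move=> e /negbTE ->; rewrite mul0r mulr0.
Qed.

Lemma sum_multiples (R : realType) (d N : nat) (g : nat -> R) : (0 < d)%N ->
  \sum_(1 <= n < N.+1) (d %| n)%N%:R * g n =
  \sum_(1 <= b < (N %/ d).+1) g (d * b)%N.
Proof.
move=> d0.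
transitivity (\sum_(1 <= n < N.+1) \sum_(1 <= b < (N %/ d).+1)
    (n == d * b)%N%:R * g n); last first.
  rewrite exchange_big /= !big_nat; apply: eq_bigr => b /andP[b0 bN].
  rewrite (bigD1_seq (d * b)%N) ?iota_uniq //=; last first.
    rewrite mem_index_iota muln_gt0 d0 b0 /= ltnS.
    by rewrite ltnS leq_divRL // mulnC in bN.
  rewrite eqxx mul1r big1 ?addr0 // => n /negbTE ->.
  by rewrite mul0r.
rewrite !big_nat; apply: eq_bigr => n /andP[n0 nN].
rewrite -mulr_suml; congr (_ * _).
case: (boolP (d %| n)%N) => [/dvdnP[b nE]|dn]; last first.
  rewrite big1 // => b _; case: eqP => // nE.
  by move: dn; rewrite nE dvdn_mulr.
rewrite (bigD1_seq b) ?iota_uniq //=; last first.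
  rewrite mem_index_iota ltnS leq_divRL // -nE; apply/andP; split; last first.
    by rewrite -ltnS.
  by rewrite lt0n; apply: contraTneq n0 => b0; rewrite nE b0.
rewrite nE mulnC eqxx big1 ?addr0 // => b' /negbTE.
by rewrite eqn_pmul2l // eq_sym => ->.
Qed.

Definition omega (n : nat) : nat := size (primes n).

(** The Moebius function for [sg = -1] and its absolute value for [sg = 1]. *)
Definition sqfree_pow (R : realType) (sg : R) (n : nat) : R :=
  \prod_(p <- primes n) (if logn p n == 1%N then sg else 0).

Lemma primes_coprimeM m n : (0 < m)%N -> (0 < n)%N -> coprime m n ->
  perm_eq (primes (m * n)) (primes m ++ primes n).
Proof.
move=> m0 n0 mn; apply: uniq_perm; first exact: primes_uniq.
  rewrite cat_uniq !primes_uniq andbT /=; apply/hasPn => p pn.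
  apply/negP => pm; move: mn; rewrite coprime_has_primes // => /hasP; apply.
  by exists p.
by move=> p; rewrite primesM // mem_cat.
Qed.

Lemma sqfree_powM (R : realType) (sg : R) p n : prime p -> (0 < n)%N ->
  sqfree_pow sg (p * n) = if (p %| n)%N then 0 else sg * sqfree_pow sg n.
Proof.
move=> pp n0; have p0 := prime_gt0 pp.
case: (boolP (p %| n)%N) => pn.
  rewrite /sqfree_pow (bigD1_seq p) ?primes_uniq //=; last first.
    by rewrite mem_primes pp muln_gt0 p0 n0 dvdn_mulr.
  rewrite lognM // logn_prime // eqxx.
  have : (0 < logn p n)%N by rewrite logn_gt0 mem_primes pp n0.
  by case: (logn p n) => // e _; rewrite mul0r.
have cpn : coprime p n by rewrite prime_coprime.
rewrite /sqfree_pow (perm_big _ (primes_coprimeM p0 n0 cpn)) /= big_cat /=.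
rewrite primes_prime // big_seq1 lognM // logn_prime // eqxx logn_coprime //=.
congr (_ * _); apply: eq_big_seq => q; rewrite mem_primes => /and3P[qp _ qn].
rewrite lognM // logn_prime //; case: (eqVneq q p) => // E.
by rewrite -E qn in pn.
Qed.

(** Induction on [n]: if [n = p ^ e * m] with [p] prime to [m], the divisors of [n]
of nonzero weight are those of [m], and [p] times those of [m], which multiplies
the sum by [1 + sg].  At [sg = -1] this is Moebius inversion; at [sg = 1] it
counts the squarefree divisors. *)
Lemma sum_sqfree_pow (R : realType) (sg : R) n N : (0 < n <= N)%N ->
  \sum_(1 <= t < N.+1) (t %| n)%N%:R * sqfree_pow sg t = (1 + sg) ^+ omega n.
Proof.
elim/ltn_ind: n N => n IH N /andP[n0 nN].
have [n1|n1] := leqP n 1.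
  have N0 : (0 < N)%N by exact: leq_trans nN.
  have -> : n = 1%N by lia.
  rewrite /omega /= expr0 big_nat_recl ?big1_seq ?addr0 //=; last first.
    move=> t; rewrite mem_index_iota => /andP[t0 _]; rewrite dvdn1.
    by rewrite eqSS gtn_eqF ?mul0r.
  by rewrite ?dvdnn mul1r /sqfree_pow (_ : primes 1 = [::]) // big_nil.
pose p := pdiv n; have pp : prime p by exact: pdiv_prime.
have p0 := prime_gt0 pp; have p1 := prime_gt1 pp.
have pn : (p %| n)%N by exact: pdiv_dvd.
have [m pm nE] := pfactor_coprime pp n0.
set e := logn p n in nE; have e0 : (0 < e)%N by rewrite logn_gt0 mem_primes pp n0.
have m0 : (0 < m)%N by move: n0; rewrite nE; case: (m).
have pndm : ~~ (p %| m)%N by rewrite -prime_coprime.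
have mn : (m < n)%N by rewrite nE ltn_Pmulr // -(exp1n e) ltn_exp2r.
have mNp : (m <= N %/ p)%N.
  rewrite leq_divRL // (leq_trans _ nN) // nE leq_mul //.
  by rewrite -{1}[p]expn1 leq_pexp2l.
have oE : omega n = (omega m).+1.
  rewrite /omega nE mulnC.
  rewrite (perm_size (primes_coprimeM _ m0 _)) ?expn_gt0 ?p0 ?coprimeXl //.
  by rewrite size_cat primesX // primes_prime.
have mM M : (m <= M)%N ->
    \sum_(1 <= t < M.+1) (t %| m)%N%:R * sqfree_pow sg t = (1 + sg) ^+ omega m.
  by move=> mM; apply: IH; rewrite ?m0.
rewrite oE exprSr mulrDr mulr1 -{1}(mM N); last by rewrite (leq_trans _ nN) // ltnW.
rewrite -(mM _ mNp).
pose g t := (t %| n)%N%:R * sqfree_pow sg t.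
have -> : (\sum_(1 <= t < (N %/ p).+1) (t %| m)%N%:R * sqfree_pow sg t) * sg =
    \sum_(1 <= t < (N %/ p).+1) g (p * t)%N.
  rewrite mulr_suml !big_nat; apply: eq_bigr => t /andP[t0 _].
  rewrite /g sqfree_powM //; case: (boolP (p %| t)%N) => pt.
    case: (boolP (t %| m)%N) => [tm|]; last by rewrite !mul0r mulr0.
    by move: pndm; rewrite (dvdn_trans pt tm).
  rewrite -mulrA [sqfree_pow sg t * sg]mulrC; congr (_%:R * _); congr (nat_of_bool _).
  rewrite nE -(prednK e0) expnS mulnCA dvdn_pmul2l //.
  by rewrite Gauss_dvdl // coprimeXr // coprime_sym prime_coprime.
rewrite -sum_multiples // -big_split /= !big_nat; apply: eq_bigr => t /andP[t0 _].
rewrite /g; case: (boolP (p %| t)%N) => pt.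
  case: (boolP (t %| m)%N) => [tm|]; last by rewrite !mul0r add0r mul1r.
  by move: pndm; rewrite (dvdn_trans pt tm).
rewrite mul0r addr0; congr (_%:R * _); congr (nat_of_bool _).
by rewrite nE Gauss_dvdl // coprimeXr // coprime_sym prime_coprime.
Qed.

(** Bound each of the [omega n] factors [Q = 2 ^ D] by the prime factor [p] of [n] it
belongs to if [Q <= p], and by [p * Q] otherwise: the product of the [p] is at
most [n], and fewer than [Q] of them are below [Q].  Hence [2 ^ omega n] is at
most a constant times [n.+1] to the power [1 / D]. *)
Lemma omega_expn_bound D n : ((2 ^ D) ^ omega n <= (2 ^ D) ^ (2 ^ D) * n.+1)%N.
Proof.
case: n => [|n]; first by rewrite /omega /= muln1 expn_gt0 expn_gt0.
set Q := (2 ^ D)%N.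
have Q0 : (0 < Q)%N by rewrite expn_gt0.
have h1 : (\prod_(p <- primes n.+1) p <= n.+1)%N.
  rewrite [X in (_ <= X)%N]prod_prime_decomp // prime_decompE big_map /=.
  rewrite big_seq [X in (_ <= X)%N]big_seq; apply: leq_prod => p pn.
  have : (0 < logn p n.+1)%N by rewrite logn_gt0.
  move: pn; rewrite mem_primes => /andP[/prime_gt0 p0 _] l0.
  by rewrite -{1}[p]expn1 leq_pexp2l.
have h2 : (\prod_(p <- primes n.+1) (if p < Q then Q else 1) <= Q ^ Q)%N.
  rewrite -big_mkcond /= big_const_seq iter_muln_1 leq_pexp2l //.
  rewrite -size_filter -[X in (_ <= X)%N](size_iota 0); apply: uniq_leq_size.
    by rewrite filter_uniq ?primes_uniq.
  by move=> p; rewrite mem_filter mem_iota /= => /andP[].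
have h3 : (Q ^ omega n.+1 <= \prod_(p <- primes n.+1) (p * (if p < Q then Q else 1)))%N.
  have -> : (Q ^ omega n.+1 = \prod_(p <- primes n.+1) Q)%N.
    by rewrite big_const_seq iter_muln_1 count_predT.
  rewrite big_seq [X in (_ <= X)%N]big_seq; apply: leq_prod => p.
  rewrite mem_primes => /andP[/prime_gt0 p0 _].
  by case: ltnP => h; rewrite ?muln1 // leq_pmull.
apply: (leq_trans h3); rewrite big_split /= mulnC leq_mul //.
exact: leq_trans h1 _.
Qed.

Lemma omega_bound_pow D z n : (n < z ^ D)%N -> (0 < D)%N ->
  (2 ^ omega n <= (2 ^ D) ^ (2 ^ D) * z)%N.
Proof.
move=> nz D0; have := omega_expn_bound D n; set C := ((2 ^ D) ^ (2 ^ D))%N => h.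
have C0 : (0 < C)%N by rewrite !expn_gt0.
rewrite -(@leq_exp2r _ _ D) // -expnM [(omega n * D)%N]mulnC expnM.
apply: (leq_trans h); rewrite expnMn leq_mul //.
by rewrite -{1}[C]expn1 leq_pexp2l.
Qed.

Lemma sqfree_pow_norm (R : realType) n :
  `|sqfree_pow (-1) n| = sqfree_pow 1 n :> R.
Proof.
rewrite /sqfree_pow normr_prod; apply: eq_bigr => p _.
by case: ifP => _; rewrite ?normrN1 ?normr0.
Qed.

Lemma sqfree_pow1_bounds (R : realType) n : 0 <= sqfree_pow (1 : R) n <= 1.
Proof.
rewrite /sqfree_pow; elim: (primes n) => [|p l IH]; first by rewrite big_nil ler01 lexx.
by rewrite big_cons; case: ifP => _; rewrite ?mul1r // mul0r lexx ler01.
Qed.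

(** The convolution of 1 with the Moebius function cut off at [U]. *)
Definition trunc_mobius (R : realType) (U d : nat) : R :=
  \sum_(1 <= t < U.+1) (t %| d)%N%:R * sqfree_pow (-1) t.

Lemma trunc_mobius1 (R : realType) U : (0 < U)%N -> trunc_mobius R U 1 = 1.
Proof.
by move=> U0; rewrite /trunc_mobius sum_sqfree_pow ?U0 // /omega /= expr0.
Qed.

Lemma trunc_mobius0 (R : realType) U d : (1 < d <= U)%N -> trunc_mobius R U d = 0.
Proof.
move=> /andP[d1 dU]; rewrite /trunc_mobius sum_sqfree_pow ?dU ?(ltnW d1) // subrr.
have : (0 < omega d)%N by rewrite lt0n size_eq0 primes_eq0 -leqNgt.
by case: (omega d) => // o _; rewrite exprS mul0r.
Qed.

Lemma trunc_mobius_le (R : realType) U d : (0 < d)%N ->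
  `|trunc_mobius R U d| <= (2 ^ omega d)%:R.
Proof.
move=> d0; apply: (le_trans (ler_norm_sum _ _ _)).
have := @sum_sqfree_pow R 1 d (maxn d U); rewrite d0 leq_maxl => /(_ isT) E.
rewrite natrX (_ : 2%:R = 1 + 1 :> R) // -E.
rewrite [leRHS](@big_cat_nat _ _ _ U.+1) //=; last by rewrite ltnS leq_maxr.
rewrite -[leLHS]addr0; apply: lerD; last first.
  apply: sumr_ge0 => t _; rewrite mulr_ge0 //.
  by case/andP: (sqfree_pow1_bounds R t).
by apply: ler_sum => t _; rewrite normrM sqfree_pow_norm normr_nat.
Qed.

Lemma dvdn_div_swap e t n : (0 < n)%N ->
  (e %| n)%N && (t %| n %/ e)%N = (e * t %| n)%N.
Proof.
move=> n0; apply/andP/idP => [[/dvdnP[m ->] ]|et].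
  have [->|e0] := posnP e; first by rewrite muln0 mul0n.
  by rewrite mulnK // mulnC => ?; rewrite dvdn_pmul2r.
have en : (e %| n)%N by apply: dvdn_trans et; exact: dvdn_mulr.
split=> //; have e0 : (0 < e)%N by exact: dvdn_gt0 en.
by rewrite dvdn_divRL // mulnC.
Qed.

(** Convolve [Lambda] with [trunc_mobius].  Since the convolution of [Lambda] with 1
is the logarithm, this is the first sum.  The second sum is the part [e <= U] of
the convolution.  In the part [U < e], [trunc_mobius (n %/ e)] is 1 for [e = n]
and vanishes for [1 < n %/ e <= U], which leaves [Lambda n] and the third sum. *)
Lemma vaughan_identity (R : realType) (U n N : nat) : (U < n <= N)%N -> (0 < U)%N ->
  mangoldt R n =
    \sum_(1 <= t < U.+1) (t %| n)%N%:R * (sqfree_pow (-1) t * ln (n %/ t)%N%:R)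
  - \sum_(1 <= e < U.+1) \sum_(1 <= t < U.+1)
      (e * t %| n)%N%:R * (mangoldt R e * sqfree_pow (-1) t)
  - \sum_(U.+1 <= e < N.+1) (e %| n)%N%:R *
      (mangoldt R e * ((U < n %/ e)%N%:R * trunc_mobius R U (n %/ e))).
Proof.
move=> /andP[Un' nN] U0.
have n0 : (0 < n)%N by exact: leq_ltn_trans Un'.
pose S := \sum_(1 <= e < N.+1) (e %| n)%N%:R *
  (mangoldt R e * trunc_mobius R U (n %/ e)) : R.
have E1 : S = \sum_(1 <= t < U.+1) (t %| n)%N%:R *
    (sqfree_pow (-1) t * ln (n %/ t)%N%:R).
  rewrite /S.
  transitivity (\sum_(1 <= e < N.+1) \sum_(1 <= t < U.+1)
      (e * t %| n)%N%:R * (mangoldt R e * sqfree_pow (-1) t)).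
    apply: eq_bigr => e _; rewrite /trunc_mobius !mulr_sumr.
    apply: eq_bigr => t _; rewrite -dvdn_div_swap // -mulnb natrM.
    by ring.
  rewrite exchange_big /= !big_nat; apply: eq_bigr => t /andP[t0 _].
  case: (boolP (t %| n)%N) => [tn|tn]; last first.
    rewrite mul0r big1 // => e _; case: (boolP (e * t %| n)%N); last by rewrite mul0r.
    by move=> /(dvdn_trans (dvdn_mull e (dvdnn t))); rewrite (negbTE tn).
  rewrite mul1r -(@sum_mangoldt _ _ N); last first.
    by rewrite divn_gt0 // dvdn_leq //= (leq_trans (leq_div _ _)).
  rewrite mulr_sumr; apply: eq_bigr => e _.
  by rewrite dvdn_divRL //; ring.
rewrite -E1 /S (@big_cat_nat _ _ _ U.+1) //=; last first.
  by rewrite ltnS (leq_trans _ nN) // ltnW.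
rewrite [X in _ = X + _ - _ - _](_ : _ = \sum_(1 <= e < U.+1) \sum_(1 <= t < U.+1)
      (e * t %| n)%N%:R * (mangoldt R e * sqfree_pow (-1) t)); last first.
  apply: eq_bigr => e _; rewrite /trunc_mobius !mulr_sumr.
  apply: eq_bigr => t _; rewrite -dvdn_div_swap // -mulnb natrM.
  by ring.
have cancel (a b c : R) : a + b - a - c = b - c by ring.
rewrite cancel -sumrB.
rewrite (bigD1_seq n) ?mem_index_iota ?iota_uniq ?Un' //=.
rewrite dvdnn divnn n0 trunc_mobius1 // ltnNge U0 mul0r !mulr0 !mulr1 mul1r subr0.
rewrite big1_seq ?addr0 // => e /andP[en]; rewrite mem_index_iota => /andP[Ue _].
have e0 : (0 < e)%N by exact: leq_ltn_trans Ue.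
case: (boolP (e %| n)%N) => [edn|]; last by rewrite !mul0r subr0.
case: (ltnP U (n %/ e)) => h; first by rewrite !mul1r subrr.
rewrite !mul0r mulr0 trunc_mobius0 ?mulr0 ?mulr0 ?subrr // h andbT.
have := dvdn_leq n0 edn; rewrite leq_eqVlt (negbTE en) /= => en'.
by rewrite ltn_divRL // mul1n.
Qed.

(** * Cubes of spread pairs *)

(** Intersections of intervals are intervals: a sharp cut-off in the amplitude
only shortens the range of summation. *)
Lemma cubeM_interval (R : realType) (F : nat -> nat -> R) ps y :
  (forall b, exists l r, forall a, F a b = (l <= a < r)%N%:R) ->
  exists l r, forall a, cubeM ps (F a) y = (l <= a < r)%N%:R.
Proof.
elim: ps F y => [|p ps IH] F y FI; first exact: FI.
apply: (IH (fun a y => F a (y + p.1)%N * F a (y + p.2)%N)) => b.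
have [l1 [r1 E1]] := FI (b + p.1)%N; have [l2 [r2 E2]] := FI (b + p.2)%N.
exists (maxn l1 l2), (minn r1 r2) => a; rewrite E1 E2 -natrM mulnb.
by congr (nat_of_bool _)%:R; rewrite geq_max leq_min andbACA.
Qed.

Lemma cubeM_neq0 (R : realType) (F : nat -> R) (K : nat) ps y :
  all (fun p => (p.1 <= K) && (p.2 <= K))%N ps -> cubeM ps F y != 0 ->
  exists2 h, (h <= size ps * K)%N & F (y + h)%N != 0.
Proof.
elim: ps F y => [|p ps IH] F y /=; first by exists 0%N; rewrite ?addn0.
move=> /andP[/andP[p1 p2] psK] /(IH _ _ psK) [h hK]; rewrite mulf_eq0 negb_or.
move=> /andP[h1 _]; exists (h + p.1)%N; last by rewrite addnA.
by rewrite mulSn addnC leq_add.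
Qed.

Lemma cubeM_le1 (R : realType) (F : nat -> R) ps y :
  (forall y, `|F y| <= 1) -> `|cubeM ps F y| <= 1.
Proof.
elim: ps F y => [|p ps IH] F y F1 /=; first exact: F1.
by apply: IH => z; rewrite normrM mulr_ile1.
Qed.

Lemma sum_indicator (R : realType) (x : nat -> R) (l r Y : nat) :
  \sum_(0 <= y < Y) (l <= y < r)%N%:R * x y = \sum_(l <= y < minn r Y) x y.
Proof.
have [h|h] := leqP (minn r Y) l.
  rewrite [RHS]big_geq // big1_seq // => y; rewrite mem_index_iota => /= hy.
  by rewrite (_ : (l <= y < r)%N = false) ?mul0r //; lia.
rewrite (@big_cat_nat _ _ _ l) //=; last by lia.
rewrite big1_seq ?add0r; last first.
  move=> y; rewrite mem_index_iota => /= hy.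
  by rewrite (_ : (l <= y < r)%N = false) ?mul0r //; lia.
rewrite (@big_cat_nat _ _ _ (minn r Y)) //=; [|by lia|by lia].
rewrite [X in _ + X]big1_seq ?addr0; last first.
  move=> y; rewrite mem_index_iota => /= hy.
  by rewrite (_ : (l <= y < r)%N = false) ?mul0r //; lia.
rewrite !big_nat; apply: eq_bigr => y hy.
by rewrite (_ : (l <= y < r)%N = true) ?mul1r //; lia.
Qed.

(** Each step is a square root, so [s] of them turn [rho ^+ (2 ^ s)] into [rho]; the
factor 2 reproduces itself because
[2 * x ^+ 2 + x ^+ 2 <= (2 * x) ^+ 2]. *)
Lemma cauchy_loss_le (R : realType) (rho eps kap : R) (s : nat) :
  0 <= rho <= 1 -> 0 <= eps <= rho ^+ (2 ^ s) -> 0 <= kap <= rho ^+ (2 ^ s) ->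
  cauchy_loss eps kap s <= 2 * rho.
Proof.
move=> /andP[r0 r1] /andP[e0 e1] /andP[k0 k1].
suff key j : (j <= s)%N -> cauchy_loss eps kap j <= 2 * rho ^+ (2 ^ (s - j)).
  by have := key s (leqnn s); rewrite subnn expr1.
elim: j => [_|j IH js] /=.
  by rewrite subn0; have := exprn_ge0 (2 ^ s) r0; lra.
have {}IH := IH (ltnW js).
set x := rho ^+ (2 ^ (s - j.+1)).
have x0 : 0 <= x by exact: exprn_ge0.
have E : rho ^+ (2 ^ (s - j)) = x ^+ 2.
  by rewrite /x -exprM -expnSr; congr (_ ^+ (2 ^ _)); lia.
have kx : kap <= x ^+ 2.
  apply: (le_trans k1); rewrite -E; apply: ler_wiXn2l => //.
  by rewrite leq_exp2l // leq_subr.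
have v0 := cauchy_loss_ge0 kap j e0.
rewrite -ler_sqr ?nnegrE ?sqrtr_ge0 ?mulr_ge0 // sqr_sqrtr ?addr_ge0 //.
by move: IH; rewrite E; nra.
Qed.

Lemma gaps_bounds (R : realType) (lam K : nat) ps : all (spread_pair lam K) ps ->
  lam%:R ^+ size ps <= `|gaps R ps| <= K%:R ^+ size ps.
Proof.
elim: ps => [|p ps IH] /=; first by rewrite /gaps big_nil normr1 expr0 lexx.
move=> /andP[/and3P[p1 p2 p12] /IH /andP[i1 i2]].
rewrite /gaps big_cons normrM -/(gaps R ps) !exprS.
have h : lam%:R <= `|p.1%:R - p.2%:R : R| <= K%:R.
  have [h|h] := leqP p.1 p.2.
    by rewrite distrC -natrB // normr_nat !ler_nat; lia.
  by rewrite -natrB 1?ltnW // normr_nat !ler_nat; lia.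
case/andP: h => h1 h2.
by rewrite !ler_pM // ?exprn_ge0 ?mulr_ge0.
Qed.

Lemma spread_pair_le (lam K : nat) ps : all (spread_pair lam K) ps ->
  all (fun p => (p.1 <= K) && (p.2 <= K))%N ps.
Proof. by apply: sub_all => p /and3P[-> ->]. Qed.

Lemma cubeD_affine (R : realType) ps (c t : R) (f : nat -> R) y :
  (0 < size ps)%N -> cubeD ps (fun y => c * f y + t) y = c * cubeD ps f y.
Proof.
case: ps => // p ps _ /=; rewrite -cubeD_scale; apply: eq_cubeD => z /=.
by ring.
Qed.

Lemma falling_neq0 (R : realType) (g : R) s : 0 < g < 1 -> falling g s != 0.
Proof.
move=> /andP[g0 g1]; rewrite /falling prodf_seq_neq0; apply/allP => j _ /=.
rewrite subr_eq0; case: (val j) => [|n]; first by rewrite gt_eqF.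
by rewrite lt_eqF // (lt_le_trans g1) // ler1n.
Qed.

Lemma powR_falling (R : realType) (x g : R) s : 0 < x ->
  x `^ (g - s.+1%:R) = x `^ (g - 1) / x ^+ s.
Proof.
move=> x0; rewrite -powR_mulrn ?ltW // -powRB; last by rewrite (gt_eqF x0) implybT.
by congr (_ `^ _); rewrite -natr1; ring.
Qed.

(** * Sums over progressions *)

(** The functions that remain in a count of progressions when one of the terms is
singled out: [n] is the position of that term and [m] the common difference. *)
Definition shift_system (R : realType) (V : finZmodType) (k : nat)
    (u : nat -> nat) (w : nat -> V) (W : nat -> nat -> V -> R) : Prop :=
  [/\ forall c, (0 < u c <= k)%N, forall c n m, `|W c n m| <= 1 &
      forall c n m, W c (n + u c)%N (m + w c) = W c n m].

Definition dual_function (R : realType) (V : finZmodType) (s : nat)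
    (W : nat -> nat -> V -> R) (n : nat) : R :=
  \sum_m \prod_(c < s) W c n m.

Lemma shift_system_iter (R : realType) (V : finZmodType) k u w
    (W : nat -> nat -> V -> R) c n m t : shift_system k u w W ->
  W c (n + u c * t)%N (m + w c *+ t) = W c n m.
Proof.
move=> [_ _ Winv]; elim: t => [|t IH]; first by rewrite muln0 addn0 mulr0n addr0.
by rewrite mulnS [(u c + _)%N]addnC addnA mulrSr addrA Winv.
Qed.

Lemma dual_function_le (R : realType) (V : finZmodType) k u w s
    (W : nat -> nat -> V -> R) n : shift_system k u w W -> `|dual_function s W n| <= #|V|%:R.
Proof.
move=> [_ W1 _]; apply: (le_trans (ler_norm_sum _ _ _)).
rewrite -sumr_const; apply: ler_sum => m _.
by rewrite normr_prod; apply: prodr_ile1 => c _; rewrite normr_ge0 W1.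
Qed.

(** The largest increment, over [b >= l], of the phase [y0 * (d * b) `^ g] differenced
[s] times with product of gaps [P].  It is tiny when the gaps are shorter than
[N / d] by a large power [z ^ e2]. *)
Lemma type_one_upper (R : realType) (g d N y0 f P k z l : R) (s e2 h : nat) :
  0 < g < 1 -> 1 <= d -> 1 <= N -> 0 <= y0 -> 0 <= f -> 1 <= z -> 0 <= k ->
  0 <= P -> P <= (k * (N / d) / z ^+ e2) ^+ s ->
  N / d / (2 * z ^+ h) <= l ->
  y0 * d `^ g * f * P * l `^ (g - s.+1%:R) <=
  y0 * f * k ^+ s * 2 ^+ s.+1 * z ^+ (h * s.+1) * d / z ^+ (e2 * s).
Proof.
move=> /andP[g0 g1] d1 N1 y00 f0 z1 k0 P0 Ple lX.
have d0 : 0 < d by lra. have N0 : 0 < N by lra. have z0 : 0 < z by lra.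
set X := N / d in Ple lX *; have X0 : 0 < X by rewrite divr_gt0.
have dX : d * X = N by rewrite /X; field; rewrite gt_eqF.
clearbody X; have X0' := ltW X0; have d0' := ltW d0; have z0' := ltW z0.
set b := 2 * z ^+ h in lX; have b1 : 1 <= b.
  by have := exprn_ege1 h z1; rewrite /b; lra.
have b0 : 0 < b by lra.
have b0' := ltW b0; have bE : b = 2 * z ^+ h by []; clearbody b.
have l0 : 0 < l by apply: lt_le_trans lX; rewrite divr_gt0.
have h1 : l `^ (g - s.+1%:R) <= b ^+ s.+1 * X `^ (g - 1) / X ^+ s.
  apply: (@le_trans _ _ ((X / b) `^ (g - s.+1%:R))).
    by rewrite ler_powRn ?divr_gt0 // subr_le0 (le_trans (ltW g1)) // ler1n.
  rewrite powR_falling ?divr_gt0 // powRM ?invr_ge0 //.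
  have -> : b^-1 `^ (g - 1) = b `^ (1 - g).
    by rewrite -powR_inv1 // -powRrM; congr (_ `^ _); ring.
  have : b `^ (1 - g) <= b by rewrite ler1_powR //; lra.
  move=> hb; rewrite expr_div_n invf_div exprS.
  have -> : b * b ^+ s * X `^ (g - 1) / X ^+ s = X `^ (g - 1) * b * (b ^+ s / X ^+ s).
    by ring.
  rewrite ler_wpM2r //; first by rewrite divr_ge0 ?exprn_ge0 .
  by rewrite ler_wpM2l ?powR_ge0.
have h2 : d `^ g * X `^ (g - 1) <= d.
  rewrite -(mulr_powRB1 (ltW d0) g0) -mulrA -powRM //.
  rewrite dX.
  rewrite ler_piMr //; have := @ler_powRn R (g - 1) 1 N.
  by rewrite powR1; apply; lra.
apply: (@le_trans _ _ (y0 * d `^ g * f * (k * X / z ^+ e2) ^+ s *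
    (b ^+ s.+1 * X `^ (g - 1) / X ^+ s))).
  rewrite ler_pM ?powR_ge0 ?mulr_ge0 ?powR_ge0 //.
  by rewrite ler_wpM2l ?mulr_ge0 ?powR_ge0.
have -> : y0 * d `^ g * f * (k * X / z ^+ e2) ^+ s *
    (b ^+ s.+1 * X `^ (g - 1) / X ^+ s) =
   (y0 * f * k ^+ s * b ^+ s.+1 / z ^+ (e2 * s)) * (d `^ g * X `^ (g - 1)).
  rewrite !exprMn exprVn -exprM; field.
  by rewrite !expf_neq0 ?gt_eqF.
have -> : y0 * f * k ^+ s * 2 ^+ s.+1 * z ^+ (h * s.+1) * d / z ^+ (e2 * s) =
   (y0 * f * k ^+ s * b ^+ s.+1 / z ^+ (e2 * s)) * d.
  by rewrite bE exprMn -exprM; ring.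
rewrite ler_wpM2l // !mulr_ge0 ?invr_ge0 ?exprn_ge0 //; lra.
Qed.

(** The inverse of the smallest increment of the same phase.  It is at most a power
of [z], as [N `^ (1 - g) <= 2 * z] makes [y `^ g] nearly linear. *)
Lemma type_one_lower (R : realType) (g d N y0 f P z : R) (s a : nat) :
  0 < g < 1 -> 1 <= d -> 1 <= N -> 1 <= y0 -> 0 < f -> 1 <= z ->
  N `^ (1 - g) <= 2 * z -> (N / d / (2 * z ^+ a)) ^+ s <= P ->
  2 / (y0 * d `^ g * f * P * (4 * (N / d)) `^ (g - s.+1%:R)) <=
  f^-1 * 8 ^+ s * 16 * z ^+ (a * s).+1.
Proof.
move=> /andP[g0 g1] d1 N1 y1 f0 z1 Nz Ple.
have d0 : 0 < d by lra. have N0 : 0 < N by lra. have z0 : 0 < z by lra.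
set X := N / d in Ple *; have X0 : 0 < X by rewrite divr_gt0.
have dX : d * X = N by rewrite /X; field; rewrite gt_eqF.
clearbody X; have X0' := ltW X0; have d0' := ltW d0; have z0' := ltW z0; have f0' := ltW f0.
set b := 2 * z ^+ a in Ple; have b0 : 0 < b by rewrite mulr_gt0 ?exprn_gt0.
have b0' := ltW b0; have bE : b = 2 * z ^+ a by []; clearbody b; have Xb0 : 0 <= X / b by rewrite divr_ge0.
have h1 : X `^ (g - 1) / 4 / (4 * X) ^+ s <= (4 * X) `^ (g - s.+1%:R).
  rewrite powR_falling ?mulr_gt0 // powRM // ler_wpM2r ?invr_ge0 ?exprn_ge0 ?mulr_ge0 //.
  rewrite mulrC ler_wpM2r ?powR_ge0 //.
  by rewrite -(powR_inv1 (ler0n R 4)); apply: ler_powR; [rewrite ler1n | lra].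
have h2 : (2 * z)^-1 <= d `^ g * X `^ (g - 1).
  rewrite -(mulr_powRB1 (ltW d0) g0) -mulrA -powRM //.
  rewrite dX.
  have h : (2 * z)^-1 <= N `^ (g - 1).
    rewrite -[g - 1]opprB powRN lef_pV2 ?posrE ?powR_gt0 //; lra.
  apply: (le_trans h); rewrite ler_peMl ?powR_ge0 //.
have P0 : 0 < P by apply: lt_le_trans Ple; rewrite exprn_gt0 ?divr_gt0.
rewrite ler_pdivrMr; last by rewrite !mulr_gt0 ?powR_gt0 //; lra.
apply: (@le_trans _ _ (f^-1 * 8 ^+ s * 16 * z ^+ (a * s).+1 *
  (1 * f * (X / b) ^+ s * ((2 * z)^-1 / 4 / (4 * X) ^+ s)))); last first.
  apply: ler_wpM2l; first by rewrite !mulr_ge0 ?exprn_ge0 ?invr_ge0 //.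
  have -> : y0 * d `^ g * f * P * (4 * X) `^ (g - s.+1%:R) =
    y0 * f * P * (d `^ g * (4 * X) `^ (g - s.+1%:R)) by ring.
  apply: ler_pM.
  - by rewrite mul1r mulr_ge0 ?exprn_ge0.
  - by rewrite !divr_ge0 ?invr_ge0 ?exprn_ge0 ?mulr_ge0.
  - by apply: ler_pM => //; rewrite ?mul1r ?exprn_ge0 // ler_peMl.
  - apply: (@le_trans _ _ (d `^ g * (X `^ (g - 1) / 4 / (4 * X) ^+ s))).
      rewrite !mulrA ler_wpM2r ?invr_ge0 ?exprn_ge0 ?mulr_ge0 //.
      by rewrite ler_wpM2r.
    by rewrite ler_wpM2l ?powR_ge0.
rewrite bE !expr_div_n !exprMn -exprM exprSr (_ : 8 = 2 * 4); last by ring.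
rewrite exprMn le_eqVlt; apply/orP; left; apply/eqP; field.
by rewrite !expf_neq0 ?gt_eqF.
Qed.

Lemma exists_nat_ge (R : realType) (x : R) : exists n : nat, x <= n%:R.
Proof. by exists (Num.truncn x).+1; rewrite ltW // truncnS_gt. Qed.

Lemma divn_real_bounds (R : realType) (N m : nat) : (0 < m <= N)%N ->
  N%:R / m%:R / 2 <= ((N %/ m)%:R : R) <= N%:R / m%:R.
Proof.
move=> /andP[m0 mN]; have m0' : (0 : R) < m%:R by rewrite ltr0n.
rewrite ler_pdivlMr // -natrM ler_nat leq_divM andbT.
rewrite ler_pdivrMr // ler_pdivrMr // -!natrM ler_nat.
have := ltn_ceil N m0; have : (0 < N %/ m)%N by rewrite divn_gt0.
nia.
Qed.

(** [W c (d * b) m] is invariant under [b -> b + u c], [m -> m + w c *+ d], so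
[generalized_von_neumann] applies to the sum over [b].  Since [d] is at most a
power of [z], the range of [b] is so long that the differenced phase has
increments far larger than its inverse, while they are still small. *)
Lemma type_one_sum (R : realType) (s k q h u e : nat) : (0 < s)%N -> (0 < k)%N ->
  exists D : nat, forall g : R, 0 < g < 1 -> exists z0 : nat,
  forall (z N d l r : nat) (y0 th : R) (V : finZmodType) uu ww
    (W : nat -> nat -> V -> R),
  (z0 <= z)%N -> (z ^ D <= N)%N -> N%:R `^ (1 - g) <= 2 * z%:R ->
  (0 < d <= z ^ u)%N -> (N <= d * l * z ^ h)%N -> (d * r <= 2 * N)%N ->
  1 <= y0 <= z%:R ^+ q -> shift_system k uu ww W ->
  `|\sum_(l <= b < r) cos (y0 * (d * b)%:R `^ g + th) * dual_function s W (d * b)|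
     * z%:R ^+ e <= N%:R * #|V|%:R.
Proof.
move=> s0 k0; pose B := ((e + 2) * 2 ^ s)%N.
(* The exponent 2 ^ s in B makes up for the s square roots of Cauchy-Schwarz.
   H exceeds lam by the factor z ^ e1, which makes close pairs rare, and the
   full range N / d exceeds H by z ^ e2, which makes the increments of the
   differenced phase smaller than z ^ - B. *)
pose e1 := B.+1; pose e2 := (q + h * s.+1 + u + B).+1; pose a := (e1 + e2)%N.
exists (u + h + (B + a * s + 3))%N => g g01.
pose f := `|falling g s.+1|.
have f0 : 0 < f by rewrite normr_gt0 falling_neq0.
have [n1 n1P] := exists_nat_ge (2 * f * k%:R ^+ s * 2 ^+ s.+1).
have [n2 n2P] := exists_nat_ge (f^-1 * 8 ^+ s * 32).
exists (2 + n1 + n2 + 2 * s.+2 * k)%N.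
move=> z N d l r y0 th V uu ww W zz0 zN Nz /andP[d0 du] Nl rN /andP[y1 yq] sysW.
have z2 : (2 <= z)%N by apply: leq_trans zz0; rewrite -!addnA leq_addr.
have zk : (2 * s.+2 * k <= z)%N by apply: leq_trans zz0; rewrite leq_addl.
have zn1 : (n1 <= z)%N by move: zz0; clear; lia.
have zn2 : (n2 <= z)%N by move: zz0; clear; lia.
have z0 : (0 < z)%N by exact: leq_trans z2.
have [rl|lr] := leqP r l; first by rewrite big_geq // normr0 mul0r mulr_ge0.
have zr1 : (1 : R) <= z%:R by rewrite ler1n.
have zr0 : (0 : R) < z%:R by rewrite ltr0n.
have dza : (d * z ^ a <= N)%N.
  apply: leq_trans zN; apply: (@leq_trans (z ^ u * z ^ a)).
    by rewrite leq_mul2r du orbT.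
  rewrite -expnD leq_pexp2l // -addnA leq_add2l.
  by move: (leq_pmulr a s0); clear; lia.
have N0 : (0 < N)%N by apply: leq_trans dza; rewrite muln_gt0 d0 expn_gt0 z0.
pose lam := (N %/ (d * z ^ a))%N.
pose H := (lam * z ^ e1)%N.
have lam0 : (0 < lam)%N by rewrite divn_gt0 // muln_gt0 d0 expn_gt0 z0.
have H0 : (0 < H)%N by rewrite muln_gt0 lam0 expn_gt0 z0.
have HN : (H * (d * z ^ e2) <= N)%N.
  apply: (@leq_trans (lam * (d * z ^ a))); last exact: leq_divM.
  by rewrite /H /a expnD; apply/eq_leq; ring.
have zh2 : (2 * s.+2 * k * z ^ h <= z ^ e2)%N.
  apply: (@leq_trans (z ^ h.+1)).
    by rewrite expnS leq_mul2r zk orbT.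
  by rewrite leq_pexp2l // /e2; move: (leq_pmulr h (ltn0Sn s)); clear; lia.
have skl : (2 * (s * (k * H)) <= l)%N.
  rewrite -(@leq_pmul2r (d * z ^ h)) ?muln_gt0 ?d0 ?expn_gt0 ?z0 //.
  apply: leq_trans (_ : _ <= N)%N _; last by rewrite (leq_trans Nl) //; apply/eq_leq; ring.
  apply: leq_trans HN.
  have -> : (2 * (s * (k * H)) * (d * z ^ h) = (2 * s * k * z ^ h) * (H * d))%N by ring.
  have -> : (H * (d * z ^ e2) = z ^ e2 * (H * d))%N by ring.
  rewrite leq_mul2r; apply/orP; right.
  apply: leq_trans zh2; rewrite leq_mul2r; apply/orP; right.
  by rewrite leq_mul2r leq_mul2l leqW ?leqW ?orbT.
have l0 : (0 < l)%N.
  by apply: leq_trans skl; rewrite muln_gt0 /= muln_gt0 s0 muln_gt0 k0 H0.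
pose F (_ : unit) (y : nat) : R := (l <= y < r)%N%:R.
pose phi (_ : unit) (y : nat) : R := y0 * (d * y)%:R `^ g + th.
pose W' c (_ : unit) (y : nat) m := W c (d * y)%N m.
pose eps : R := (z%:R ^+ B)^-1.
have eps0 : 0 <= eps by rewrite invr_ge0 exprn_ge0.
have zB : z%:R ^+ B = (z%:R ^+ (e + 2)) ^+ (2 ^ s) :> R by rewrite -exprM.
have base ps : size ps = s -> all (spread_pair lam (k * H)) ps ->
   `|\sum_i \sum_(0 <= y < r) cubeM ps (F i) y * cos (cubeD ps (phi i) y)|
       <= eps * (#|{: unit}| * r)%:R.
  move=> sps aps.
  rewrite (bigD1 tt) //= [X in _ + X]big1 ?addr0; last by case.
  have [l' [r' E]] : exists l' r', forall y, cubeM ps (F tt) y = (l' <= y < r')%N%:R.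
    have [b|l' [r' E]] := @cubeM_interval R (fun a b => F tt (b + a)%N) ps 0.
      exists (l - b)%N, (r - b)%N => y; rewrite /F; congr (nat_of_bool _)%:R.
      by rewrite leq_subLR ltn_subRL.
    by exists l', r' => y; rewrite -E cubeM_shift.
  have phiE y : cubeD ps (phi tt) y =
      (y0 * d%:R `^ g) * cubeD ps (fun b => b%:R `^ g) y.
    rewrite -(@cubeD_affine _ _ _ th) ?sps //; apply: eq_cubeD => b.
    by rewrite /phi natrM powRM // mulrA.
  under eq_bigr do rewrite E phiE.
  rewrite sum_indicator card_unit mul1n; set r'' := minn r' r.
  have [rl'|lr'] := leqP r'' l'.
    by rewrite big_geq // normr0 mulr_ge0.
  have ll' : (l <= 2 * l')%N.
    have [|h' h'K] := cubeM_neq0 (spread_pair_le aps) (_ : cubeM ps (F tt) l' != 0).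
      by rewrite E leqnn /= (leq_trans lr') ?geq_minl ?oner_neq0.
    rewrite /F; case: (boolP (l <= l' + h' < r)%N) => [/andP[h1 _] _|]; last by rewrite eqxx.
    by move: h'K h1 skl; rewrite sps; clear; lia.
  have l'0 : (0 < l')%N by move: ll' l0; clear; lia.
  have d1 : (1 : R) <= d%:R by rewrite ler1n.
  have N1 : (1 : R) <= N%:R by rewrite ler1n.
  have dr0 : (0 : R) < d%:R by rewrite ltr0n.
  have y00 : 0 < y0 by exact: lt_le_trans y1.
  set P := `|gaps R ps|.
  have /andP[Plo Phi] := gaps_bounds R aps; rewrite sps -/P in Plo Phi.
  have lam1 : N%:R / d%:R / (2 * z%:R ^+ a) <= lam%:R :> R.
    have := @divn_real_bounds R N (d * z ^ a); rewrite dza muln_gt0 d0 expn_gt0 z0.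
    move=> /(_ isT) /andP[+ _]; rewrite natrM natrX; congr (_ <= _); field.
    by rewrite expf_neq0 ?gt_eqF.
  have Plo' : (N%:R / d%:R / (2 * z%:R ^+ a)) ^+ s <= P.
    have L0 : 0 <= N%:R / d%:R / (2 * z%:R ^+ a) :> R.
      by rewrite !divr_ge0 ?mulr_ge0 ?exprn_ge0.
    by apply: le_trans Plo; apply: lerXn2r; rewrite ?nnegrE.
  have HX : H%:R <= N%:R / d%:R / z%:R ^+ e2 :> R.
    rewrite ler_pdivlMr ?exprn_gt0 // ler_pdivlMr // -natrX -!natrM ler_nat.
    by rewrite -mulnA [(z ^ e2 * d)%N]mulnC.
  have Phi' : P <= (k%:R * (N%:R / d%:R) / z%:R ^+ e2) ^+ s.
    have R0 : 0 <= k%:R * (N%:R / d%:R) / z%:R ^+ e2 :> R.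
      by rewrite !mulr_ge0 ?invr_ge0 ?exprn_ge0.
    apply: (le_trans Phi); apply: lerXn2r; rewrite ?nnegrE //.
    by rewrite natrM -mulrA ler_wpM2l.
  have lX : N%:R / d%:R / (2 * z%:R ^+ h) <= l'%:R :> R.
    rewrite ler_pdivrMr ?mulr_gt0 ?exprn_gt0 // ler_pdivrMr //.
    rewrite -[2]/(2%:R) -natrX -!natrM ler_nat (leq_trans Nl) //.
    have -> : (l' * (2 * z ^ h) * d = d * (2 * l') * z ^ h)%N by ring.
    by rewrite leq_mul2r leq_mul2l ll' !orbT.
  have AE : `|y0 * d%:R `^ g * falling g s.+1 * gaps R ps| = y0 * d%:R `^ g * f * P.
    by rewrite !normrM (ger0_norm (ltW y00)) (ger0_norm (powR_ge0 _ _)).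
  have P0 : 0 < P.
    by apply: lt_le_trans Plo; rewrite exprn_gt0 ?ltr0n.
  have := @cos_sum_cube R g (y0 * d%:R `^ g) ps (k * H) l' r'' (4 * (N%:R / d%:R)).
  rewrite /= sps AE => test; apply: (le_trans (test _ _ _ _ _ _)) => //.
  - by rewrite !mulr_gt0 ?powR_gt0.
  - by rewrite muln_gt0 k0.
  - exact: (spread_pair_le aps).
  - have : r''%:R <= 2 * (N%:R / d%:R) :> R.
      rewrite mulrA ler_pdivlMr // -[2]/(2%:R) -!natrM ler_nat.
      by apply: leq_trans rN; rewrite mulnC leq_mul2l geq_minr orbT.
    have : s.+2%:R * (k * H)%:R <= 2 * (N%:R / d%:R) :> R.
      rewrite mulrA ler_pdivlMr // -[2]/(2%:R) -!natrM ler_nat.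
      apply: (@leq_trans N); last by rewrite leq_pmull.
      apply: leq_trans HN.
      have -> : (s.+2 * (k * H) * d = s.+2 * k * (H * d))%N by ring.
      have -> : (H * (d * z ^ e2) = z ^ e2 * (H * d))%N by ring.
      rewrite leq_mul2r; apply/orP; right; apply: leq_trans zh2.
      apply: (@leq_trans (2 * s.+2 * k)); first by rewrite -mulnA leq_pmull.
      by rewrite leq_pmulr // expn_gt0 z0.
    by move=> h1 h2; lra.
  have up := @type_one_upper R g d%:R N%:R y0 f P k%:R z%:R l'%:R s e2 h g01 d1 N1
    (ltW y00) (ltW f0) zr1 (ler0n _ _) (ltW P0) Phi' lX.
  have lo := @type_one_lower R g d%:R N%:R y0 f P z%:R s a g01 d1 N1 y1 f0 zr1 Nz Plo'.
  apply: (le_trans (lerD lo (ler_wpM2l (ler0n _ _) up))).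
  have zB0 : 0 < z%:R ^+ B :> R by rewrite exprn_gt0.
  have rbig : z%:R ^+ (B + a * s + 2) <= r%:R :> R.
    rewrite -natrX ler_nat (leq_trans _ (ltnW lr)) //.
    rewrite -(@leq_pmul2l (z ^ (u + h))) ?expn_gt0 ?z0 //.
    apply: (@leq_trans (z ^ (u + h + (B + a * s + 3)))).
      by rewrite -expnD leq_pexp2l // leq_add2l leq_add2l.
    apply: (leq_trans zN); apply: (leq_trans Nl).
    have -> : (z ^ (u + h) * l = z ^ u * l * z ^ h)%N by rewrite expnD; ring.
    by rewrite leq_mul2r leq_mul2r du !orbT.
  have t1 : f^-1 * 8 ^+ s * 16 * z%:R ^+ (a * s).+1 <= eps * r%:R / 2.
    apply: (@le_trans _ _ (z%:R ^+ (a * s + 2) / 2)).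
      have -> : f^-1 * 8 ^+ s * 16 * z%:R ^+ (a * s).+1 =
        (f^-1 * 8 ^+ s * 32) * (z%:R ^+ (a * s).+1 / 2) by field; rewrite gt_eqF.
      have -> : z%:R ^+ (a * s + 2) / 2 = z%:R * (z%:R ^+ (a * s).+1 / 2) :> R.
        by rewrite addn2 exprS mulrA.
      rewrite ler_wpM2r ?divr_ge0 ?exprn_ge0 // (le_trans n2P) // ler_nat //.
    rewrite ler_wpM2r // /eps mulrC ler_pdivlMr // -exprD.
    by rewrite (_ : a * s + 2 + B = B + a * s + 2)%N //; ring.
  have t2 : (r'' - l')%:R * (y0 * f * k%:R ^+ s * 2 ^+ s.+1 * z%:R ^+ (h * s.+1) * d%:R /
      z%:R ^+ (e2 * s)) <= eps * r%:R / 2.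
    have rr : (r'' - l')%:R <= r%:R :> R.
      by rewrite ler_nat (leq_trans (leq_subr _ _)) // geq_minr.
    set G := _ / z%:R ^+ (e2 * s).
    have G0 : 0 <= G.
      have f0' := ltW f0; have y00' := ltW y00.
      by rewrite !mulr_ge0 ?invr_ge0 ?exprn_ge0.
    have G1 : G <= eps / 2.
      rewrite /G.
      apply: (@le_trans _ _ (z%:R ^+ q * (f * k%:R ^+ s * 2 ^+ s.+1) * z%:R ^+ (h * s.+1) *
        z%:R ^+ u / z%:R ^+ e2)).
        have -> : y0 * f * k%:R ^+ s * 2 ^+ s.+1 * z%:R ^+ (h * s.+1) * d%:R /
            z%:R ^+ (e2 * s) = (f * k%:R ^+ s * 2 ^+ s.+1) * z%:R ^+ (h * s.+1) *
            (y0 * (d%:R / z%:R ^+ (e2 * s))) by ring.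
        have -> : z%:R ^+ q * (f * k%:R ^+ s * 2 ^+ s.+1) * z%:R ^+ (h * s.+1) *
            z%:R ^+ u / z%:R ^+ e2 = (f * k%:R ^+ s * 2 ^+ s.+1) * z%:R ^+ (h * s.+1) *
            (z%:R ^+ q * (z%:R ^+ u / z%:R ^+ e2)) by ring.
        have f0' := ltW f0; have y00' := ltW y00.
        rewrite ler_wpM2l ?mulr_ge0 ?exprn_ge0 // ler_pM ?divr_ge0 ?exprn_ge0 //.
        rewrite ler_pM ?invr_ge0 ?exprn_ge0 //; first by rewrite -natrX ler_nat.
        by rewrite lef_pV2 ?posrE ?exprn_gt0 // ler_weXn2l // leq_pmulr.
      have -> : z%:R ^+ q * (f * k%:R ^+ s * 2 ^+ s.+1) * z%:R ^+ (h * s.+1) *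
        z%:R ^+ u / z%:R ^+ e2 = eps / 2 * (2 * f * k%:R ^+ s * 2 ^+ s.+1 / z%:R).
        rewrite /eps /e2 (exprS _ (q + _ + _ + _)) !exprD; field.
        by rewrite !expf_neq0 ?gt_eqF.
      rewrite ler_piMr ?divr_ge0 // ler_pdivrMr // mul1r (le_trans n1P) //.
      by rewrite ler_nat.
    apply: (le_trans (ler_pM (ler0n _ _) G0 rr G1)).
    by have -> : eps * r%:R / 2 = r%:R * (eps / 2) by ring.
  by move: t1 t2; clear; lra.
have [uk W1 _] := sysW.
have F1 i y : `|F i y| <= 1 by rewrite /F normr_nat -[1]/(1%:R) ler_nat leq_b1.
have W'1 c i y m : `|W' c i y m| <= 1 by exact: W1.
have W'inv c i y m : W' c i (y + uu c)%N (m + ww c *+ d) = W' c i y m.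
  by rewrite /W' mulnDr [(d * uu c)%N]mulnC (shift_system_iter _ _ _ _ sysW).
have Fs i y : F i y != 0 -> (s * (k * H) <= y < r)%N.
  rewrite /F; case: (boolP (l <= y < r)%N) => [/andP[ly -> _]|]; last by rewrite eqxx.
  by rewrite andbT (leq_trans _ ly) // (leq_trans _ skl) // leq_pmull.
have := @generalized_von_neumann R V _ uu (fun c _ => ww c *+ d) k lam H r eps s F phi W'
  H0 eps0 uk F1 W'1 W'inv Fs base.
have -> : \sum_i \sum_(0 <= y < r) \sum_m F i y * cos (phi i y) *
    \prod_(c < s) W' c i y m =
  \sum_(l <= b < r) cos (y0 * (d * b)%:R `^ g + th) * dual_function s W (d * b).
  rewrite (bigD1 tt) //= [X in _ + X]big1 ?addr0; last by case.
  rewrite -[X in _ = \sum_(_ <= b < X) _](minnn r) -sum_indicator.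
  by apply: eq_bigr => y _; rewrite -mulr_sumr mulrA.
move=> main.
have kap : 2 * lam%:R / H%:R <= (z%:R ^+ (e + 2))^-1 ^+ (2 ^ s) :> R.
  rewrite exprVn -zB /H natrM natrX /e1 exprS.
  have -> : 2 * lam%:R / (lam%:R * (z%:R * z%:R ^+ B)) = 2 / z%:R / z%:R ^+ B :> R.
    by field; rewrite !pnatr_eq0 expf_neq0 ?gt_eqF // lt0r_neq0 // ltr0n.
  rewrite ler_piMl ?invr_ge0 ?exprn_ge0 // ler_pdivrMr // mul1r.
  by rewrite -[2]/(2%:R) ler_nat.
have vd : cauchy_loss eps (2 * lam%:R / H%:R) s <= 2 * (z%:R ^+ (e + 2))^-1.
  apply: cauchy_loss_le.
  - by rewrite invr_ge0 exprn_ge0 // invf_le1 ?exprn_gt0 // exprn_ege1.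
  - by rewrite eps0 /eps zB exprVn /=.
  - by rewrite kap !mulr_ge0 ?invr_ge0.
have r2 : (r <= 2 * N)%N by apply: leq_trans rN; rewrite leq_pmull.
rewrite -ler_pdivlMr ?exprn_gt0 //; apply: (le_trans main).
rewrite card_unit mul1n natrM mulrA.
rewrite [leRHS]mulrAC ler_wpM2r //.
apply: (le_trans (ler_pM (cauchy_loss_ge0 _ _ eps0) (ler0n _ _) vd (_ : r%:R <= (2 * N)%:R))).
  by rewrite ler_nat.
rewrite natrM exprD invfM.
have -> : 2 * ((z%:R ^+ e)^-1 / z%:R ^+ 2) * (2 * N%:R) =
  N%:R / z%:R ^+ e * (4 / z%:R ^+ 2) :> R by ring.
rewrite ler_piMr ?divr_ge0 ?exprn_ge0 // ler_pdivrMr ?exprn_gt0 // mul1r.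
by rewrite -natrX -[4]/(4%:R) ler_nat (@leq_exp2r 2 z 2).
Qed.

(** * Bilinear sums *)

(** The size of the [s.+1]-fold difference of [y0 * b `^ g] at [xi], of order [B], for
a product of gaps [P].  As [Bp ^+ s.+1 = B ^+ s], [B] contributes at most
[B `^ (g - 1)], up to constants, and the bound is a negative power of [z]. *)
Lemma type_two_upper (R : realType) (g B Bp y0 f P k z xi : R) (s e3 : nat) :
  0 < g < 1 -> 1 <= B -> 0 < Bp -> Bp ^+ s.+1 = B ^+ s -> 0 <= y0 -> 0 <= f ->
  1 <= z -> 0 <= k -> 0 <= P -> P <= (k * Bp / z ^+ e3) ^+ s.+1 -> B / 2 <= xi ->
  y0 * f * P * xi `^ (g - s.+1%:R) <=
  y0 * f * k ^+ s.+1 * 2 ^+ s.+1 / z ^+ (e3 * s.+1).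
Proof.
move=> /andP[g0 g1] B1 Bp0 BpE y00 f0 z1 k0 P0 Ple xiB.
have B0 : 0 < B by lra. have z0 : 0 < z by lra.
have B0' := ltW B0; have z0' := ltW z0; have Bp0' := ltW Bp0.
have h1 : xi `^ (g - s.+1%:R) <= 2 ^+ s.+1 / B ^+ s.
  apply: (@le_trans _ _ ((B / 2) `^ (g - s.+1%:R))).
    by rewrite ler_powRn ?divr_gt0 // subr_le0 (le_trans (ltW g1)) // ler1n.
  rewrite powR_falling ?divr_gt0 // expr_div_n invf_div exprS -mulrA.
  rewrite ler_wpM2r ?divr_ge0 ?exprn_ge0 //.
  rewrite powRM ?invr_ge0 //.
  have -> : 2^-1 `^ (g - 1) = 2 `^ (1 - g) :> R.
    by rewrite -powR_inv1 // -powRrM; congr (_ `^ _); ring.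
  have h2 : 2 `^ (1 - g) <= (2 : R) by rewrite ler1_powR //; lra.
  have h3 : B `^ (g - 1) <= 1.
    by have := @ler_powRn R (g - 1) 1 B; rewrite powR1; apply; lra.
  by rewrite -[leRHS]mul1r ler_pM ?powR_ge0.
apply: (@le_trans _ _ (y0 * f * (k * Bp / z ^+ e3) ^+ s.+1 * (2 ^+ s.+1 / B ^+ s))).
  rewrite ler_pM ?powR_ge0 ?mulr_ge0 //.
  by rewrite ler_wpM2l ?mulr_ge0.
rewrite !exprMn exprVn -exprM BpE le_eqVlt; apply/orP; left; apply/eqP; field.
by rewrite !expf_neq0 ?gt_eqF.
Qed.

(** The inverse of the smallest increment in [a] of [a `^ g] times the difference of
[y0 * b `^ g]; this increment is about [(a * b) `^ (g - 1)], hence no smaller than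
a negative power of [z]. *)
Lemma type_two_lower (R : realType) (g N B Bp y0 f P z xi : R) (s a : nat) :
  0 < g < 1 -> 1 <= B -> 1 <= N -> 0 < Bp -> Bp ^+ s.+1 = B ^+ s -> 1 <= y0 -> 0 < f ->
  1 <= z -> N `^ (1 - g) <= 2 * z -> (Bp / (2 * z ^+ a)) ^+ s.+1 <= P ->
  0 < xi <= 3 * B ->
  2 / (y0 * f * P * xi `^ (g - s.+1%:R) * g * (4 * (N / B)) `^ (g - 1)) <=
  (f * g)^-1 * 6 ^+ s * 96 * z ^+ (a * s.+1).+1.
Proof.
move=> /andP[g0 g1] B1 N1 Bp0 BpE y1 f0 z1 Nz Ple /andP[xi0 xiB].
have B0 : 0 < B by lra. have N0 : 0 < N by lra. have z0 : 0 < z by lra.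
have B0' := ltW B0; have z0' := ltW z0; have Bp0' := ltW Bp0; have f0' := ltW f0.
have g0' := ltW g0; have N0' := ltW N0.
have h1 : (3 * B) `^ (g - 1) / (3 * B) ^+ s <= xi `^ (g - s.+1%:R).
  rewrite -powR_falling ?mulr_gt0 // ler_powRn //.
  by rewrite subr_le0 (le_trans (ltW g1)) // ler1n.
have h2 : (24 * z)^-1 <= (3 * B) `^ (g - 1) * (4 * (N / B)) `^ (g - 1).
  rewrite -powRM ?mulr_ge0 ?invr_ge0 //.
  have -> : 3 * B * (4 * (N / B)) = 12 * N by field; rewrite gt_eqF.
  rewrite powRM // (_ : 24 * z = 12 * (2 * z)); last by ring.
  rewrite invfM ler_pM ?invr_ge0 ?mulr_ge0 //.
    by rewrite -(powR_inv1 (ler0n R 12)); apply: ler_powR; [rewrite ler1n | lra].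
  rewrite -[g - 1]opprB powRN lef_pV2 ?posrE ?powR_gt0 //; lra.
have Q0 : 0 < Bp / (2 * z ^+ a) by rewrite divr_gt0 // mulr_gt0 // exprn_gt0.
have P0 : 0 < P by apply: lt_le_trans Ple; rewrite exprn_gt0.
have NB0 : 0 < 4 * (N / B) by rewrite mulr_gt0 // divr_gt0.
rewrite ler_pdivrMr; last by rewrite !mulr_gt0 ?powR_gt0 //; lra.
apply: (@le_trans _ _ ((f * g)^-1 * 6 ^+ s * 96 * z ^+ (a * s.+1).+1 *
  (1 * f * (Bp / (2 * z ^+ a)) ^+ s.+1 * g * ((24 * z)^-1 / (3 * B) ^+ s)))).
  rewrite expr_div_n BpE !exprMn -exprM exprSr (_ : 6 = 2 * 3); last by ring.
  rewrite exprMn exprS le_eqVlt; apply/orP; left; apply/eqP; field.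
  by rewrite !expf_neq0 ?gt_eqF.
apply: ler_wpM2l.
  by rewrite !mulr_ge0 ?invr_ge0 ?exprn_ge0 ?mulr_ge0.
have -> : y0 * f * P * xi `^ (g - s.+1%:R) * g * (4 * (N / B)) `^ (g - 1) =
  y0 * f * P * g * (xi `^ (g - s.+1%:R) * (4 * (N / B)) `^ (g - 1)) by ring.
apply: ler_pM.
- by rewrite mul1r !mulr_ge0 ?exprn_ge0 // ltW.
- by rewrite !divr_ge0 ?invr_ge0 ?exprn_ge0 ?mulr_ge0.
- rewrite ler_wpM2r //; apply: ler_pM => //; rewrite ?mul1r ?exprn_ge0 ?(ltW Q0) //.
  by rewrite ler_peMl.
- apply: (@le_trans _ _ ((3 * B) `^ (g - 1) / (3 * B) ^+ s * (4 * (N / B)) `^ (g - 1))).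
    rewrite mulrAC ler_wpM2r ?invr_ge0 ?exprn_ge0 ?mulr_ge0 //.
  by rewrite ler_wpM2r ?powR_ge0.
Qed.

Lemma ler_norm_sum_nat (R : realType) (f : nat -> R) (Y : nat) (c : R) :
  (forall y, (y < Y)%N -> `|f y| <= c) -> `|\sum_(0 <= y < Y) f y| <= Y%:R * c.
Proof.
move=> fc; apply: (le_trans (ler_norm_sum _ _ _)).
rewrite mulr_natl -[X in _ *+ X]subn0 -sumr_const_nat.
rewrite big_nat_cond [leRHS]big_nat_cond; apply: ler_sum => y.
by rewrite andbT => /andP[_ yY]; exact: fc.
Qed.

Lemma mul_interval (J1 J2 b : nat) : (0 < J1)%N -> exists l r, forall a,
  (J1 <= a * b < J2)%N = (l <= a < r)%N.
Proof.
move=> J10; case: (posnP b) => [->|b0].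
  by exists 0%N, 0%N => a; rewrite muln0 leqNgt J10 ltn0 andbF.
have H J a : (a * b < J)%N = (a < (J + b.-1) %/ b)%N.
  by rewrite leq_divRL // mulSn; lia.
exists ((J1 + b.-1) %/ b)%N, ((J2 + b.-1) %/ b)%N => a.
by rewrite leqNgt !H -leqNgt.
Qed.

(** For fixed [a], [W c (a * b) m] is invariant under [b -> b + u c],
[m -> m + w c *+ a], so [generalized_von_neumann] applies to the sum over [b] with
[a] as parameter; [al a] does not involve [b] and is absorbed into [W 0], and
[be b] belongs to the amplitude.  The differenced phase is [a `^ g] times a
quantity independent of [a], and the cancellation comes from the sum over [a].
For this the gaps must be about [B `^ (1 - s^-1)] up to powers of [z]: the [s]-fold
difference of [b `^ g] is then about [B `^ (g - 1)], and the derivative in [a]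
is small without being too small. *)
Lemma type_two_sum (R : realType) (s k q e : nat) : (1 < s)%N -> (0 < k)%N ->
  exists u : nat, forall g : R, 0 < g < 1 -> exists z0 : nat,
  forall (z N B J1 J2 : nat) (y0 th : R) (al be : nat -> R)
    (V : finZmodType) uu ww (W : nat -> nat -> V -> R),
  (z0 <= z)%N -> N%:R `^ (1 - g) <= 2 * z%:R ->
  (z ^ u <= 2 * B)%N -> (B * z ^ u <= N)%N -> (0 < J1)%N -> (J2 <= N.+1)%N ->
  1 <= y0 <= z%:R ^+ q -> (forall a, `|al a| <= 1) -> (forall b, `|be b| <= 1) ->
  shift_system k uu ww W ->
  `|\sum_(0 <= a < (N %/ B).+1) \sum_(B <= b < 2 * B)
      al a * be b * (J1 <= a * b < J2)%N%:R *
      cos (y0 * (a * b)%:R `^ g + th) * dual_function s W (a * b)|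
     * z%:R ^+ e <= N%:R * #|V|%:R.
Proof.
case: s => // s s1 k0; pose Bx := ((e + 3) * 2 ^ s.+1)%N.
(* There are now s.+1 functions; Bx, e1 and e3 are to the gaps below what B, e1
   and e2 are to those in sums over progressions. *)
pose e1 := Bx.+1; pose e3 := (q + Bx).+1; pose a0 := (e1 + e3)%N.
pose u := (a0 * s.+1 + Bx + 3)%N.
exists u => g g01.
pose f := `|falling g s.+1|.
have f0 : 0 < f by rewrite normr_gt0 falling_neq0.
have [n1 n1P] := exists_nat_ge (2 * f * k%:R ^+ s.+1 * 2 ^+ s.+1).
have [n2 n2P] := exists_nat_ge ((f * g)^-1 * 6 ^+ s * 192).
exists (3 + n1 + n2 + 2 * s.+1 * k)%N.
move=> z N B J1 J2 y0 th al be V uu ww W zz0 Nz zB BN J10 J2N /andP[y1 yq] al1 be1 sysW.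
have z3 : (3 <= z)%N by apply: leq_trans zz0; rewrite -!addnA leq_addr.
have zk : (2 * s.+1 * k <= z)%N by apply: leq_trans zz0; rewrite leq_addl.
have zn1 : (n1 <= z)%N by move: zz0; clear; lia.
have zn2 : (n2 <= z)%N by move: zz0; clear; lia.
have z0 : (0 < z)%N by exact: leq_trans z3.
have zr1 : (1 : R) <= z%:R by rewrite ler1n.
have zr0 : (0 : R) < z%:R by rewrite ltr0n.
have zu3 : (3 * z ^ (u - 1) <= z ^ u)%N.
  by rewrite -{2}(subnK (_ : 1 <= u)%N) ?addn1 ?expnS ?leq_mul2r ?z3 ?orbT // /u; clear; lia.
have zuB : (z ^ (u - 1) <= B)%N.
  rewrite -(@leq_pmul2l 2) // (leq_trans _ zB) // (leq_trans _ zu3) //.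
  by rewrite leq_mul2r orbT.
have B0 : (0 < B)%N by apply: leq_trans zuB; rewrite expn_gt0 z0.
have Br0 : (0 : R) < B%:R by rewrite ltr0n.
have N0 : (0 < N)%N by apply: leq_trans BN; rewrite muln_gt0 B0 expn_gt0 z0.
have [g0 g1] := andP g01.
pose Bp : R := B%:R `^ (s%:R / s.+1%:R).
have Bp0 : 0 < Bp by rewrite powR_gt0.
have BpE : Bp ^+ s.+1 = B%:R ^+ s.
  rewrite -powR_mulrn ?powR_ge0 // /Bp -powRrM -mulrA mulVf ?pnatr_eq0 // mulr1.
  by rewrite powR_mulrn.
have BpB : Bp <= B%:R.
  rewrite /Bp ler1_powR ?ler1n // ler_pdivrMr ?ltr0n // mul1r ler_nat //.
have zBp : z%:R ^+ a0 <= Bp.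
  rewrite -(@ler_pXn2r _ s.+1) ?nnegrE ?exprn_ge0 ?powR_ge0 // BpE -exprM -!natrX ler_nat.
  apply: (@leq_trans (z ^ (u - 1))); first by rewrite leq_pexp2l // /u; clear; lia.
  apply: (leq_trans zuB); rewrite -{1}[B]expn1 leq_pexp2l //.
pose lam := Num.truncn (Bp / z%:R ^+ a0).
have q0 : 0 <= Bp / z%:R ^+ a0 by rewrite divr_ge0 ?exprn_ge0 // ltW.
have q1 : 1 <= Bp / z%:R ^+ a0 by rewrite ler_pdivlMr ?exprn_gt0 // mul1r.
have lam0 : (0 < lam)%N by rewrite truncn_gt0.
have lamU : lam%:R <= Bp / z%:R ^+ a0 by rewrite truncn_le.
have lamL : Bp / (2 * z%:R ^+ a0) <= lam%:R.
  have : Bp / z%:R ^+ a0 < lam.+1%:R by exact: truncnS_gt.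
  have : (1 : R) <= lam%:R by rewrite ler1n.
  rewrite -natr1 invfM [2^-1 * _]mulrC mulrA; lra.
pose H := (lam * z ^ e1)%N.
have H0 : (0 < H)%N by rewrite muln_gt0 lam0 expn_gt0 z0.
have HU : H%:R <= Bp / z%:R ^+ e3.
  rewrite /H natrM natrX -ler_pdivlMr ?exprn_gt0 // (le_trans lamU) //.
  by rewrite /a0 exprD invfM [X in Bp * X]mulrC mulrA.
have skB : (2 * (s.+1 * (k * H)) <= B)%N.
  rewrite -(ler_nat R).
  have -> : (2 * (s.+1 * (k * H)))%:R = (2 * s.+1 * k)%:R * H%:R :> R.
    by rewrite -natrM; congr (_%:R); ring.
  apply: (@le_trans _ _ (z%:R * (Bp / z%:R ^+ e3))).
    by apply: ler_pM; rewrite ?ler_nat.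
  have -> : z%:R * (Bp / z%:R ^+ e3) = Bp / z%:R ^+ (q + Bx).
    by rewrite /e3 exprS; field; rewrite expf_neq0 ?gt_eqF.
  apply: le_trans BpB; rewrite ler_piMr ?(ltW Bp0) // invf_le1 ?exprn_gt0 //.
  by rewrite exprn_ege1.
pose be' b := be b * (B <= b < 2 * B)%N%:R.
pose A := (N %/ B).+1.
pose F (i : 'I_A) (y : nat) : R := be' y * (J1 <= i * y < J2)%N%:R.
pose phi (i : 'I_A) (y : nat) : R := y0 * (i * y)%:R `^ g + th.
pose W' c (i : 'I_A) (y : nat) m := (if c == 0%N then al i else 1) * W c (i * y)%N m.
pose eps : R := (z%:R ^+ Bx)^-1.
have eps0 : 0 <= eps by rewrite invr_ge0 exprn_ge0.
have zBx : z%:R ^+ Bx = (z%:R ^+ (e + 3)) ^+ (2 ^ s.+1) :> R by rewrite -exprM.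
have AN : A%:R <= 2 * (N%:R / B%:R) :> R.
  rewrite mulrA ler_pdivlMr // -[2]/(2%:R) -!natrM ler_nat /A mulSn.
  have : (B <= N)%N by apply: leq_trans BN; rewrite leq_pmulr // expn_gt0 z0.
  by have := leq_divM N B; clear; lia.
have be'1 b : `|be' b| <= 1.
  by rewrite /be' normrM mulr_ile1 // normr_nat -[1]/(1%:R) ler_nat leq_b1.
have base ps : size ps = s.+1 -> all (spread_pair lam (k * H)) ps ->
   `|\sum_i \sum_(0 <= y < 2 * B) cubeM ps (F i) y * cos (cubeD ps (phi i) y)|
       <= eps * (#|{: 'I_A}| * (2 * B))%:R.
  move=> sps aps.
  rewrite exchange_big /=.
  have -> : eps * (#|'I_A| * (2 * B))%:R = (2 * B)%:R * (eps * A%:R).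
    by rewrite card_ord natrM; ring.
  apply: ler_norm_sum_nat => y yB.
  have [l' [r' E]] : exists l' r', forall a, cubeM ps (fun b => (J1 <= a * b < J2)%N%:R) y
      = (l' <= a < r')%N%:R :> R.
    apply: (@cubeM_interval R (fun a b => (J1 <= a * b < J2)%N%:R)) => b.
    have [l [r lr]] := mul_interval J2 b J10.
    by exists l, r => a; rewrite lr.
  pose C := y0 * cubeD ps (fun b => b%:R `^ g) y.
  have -> : \sum_i cubeM ps (F i) y * cos (cubeD ps (phi i) y) =
     cubeM ps be' y * \sum_(l' <= a < minn r' A)
        cos (C * cubeD [::] (fun b => b%:R `^ g) a).
    rewrite -sum_indicator big_mkord mulr_sumr; apply: eq_bigr => i _.
    rewrite /F cubeM_mul E -mulrA; congr (_ * (_ * cos _)).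
    rewrite /phi /= /C mulrAC -(@cubeD_affine _ _ _ th) ?sps //; apply: eq_cubeD => b.
    by rewrite natrM powRM // [_ * b%:R `^ _]mulrC mulrA mulrAC.
  have [->|nz] := eqVneq (cubeM ps be' y) 0.
    by rewrite mul0r normr0 mulr_ge0.
  rewrite normrM; apply: (le_trans (ler_wpM2r (normr_ge0 _) (cubeM_le1 _ _ be'1))).
  rewrite mul1r; set r'' := minn r' A.
  have [rl'|lr'] := leqP r'' l'; first by rewrite big_geq // normr0 mulr_ge0.
  have [h hK] := cubeM_neq0 (spread_pair_le aps) nz.
  rewrite /be'; case: (boolP (B <= y + h < 2 * B)%N) => [/andP[By _] _|]; last by rewrite mulr0 eqxx.
  rewrite sps in hK.
  have By2 : (B <= 2 * y)%N by move: hK By skB; clear; lia.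
  have yN0 : (0 < y)%N by move: By2 B0; clear; lia.
  have l'0 : (0 < l')%N.
    have [|h' _] := cubeM_neq0 (spread_pair_le aps)
      (_ : cubeM ps (fun b => (J1 <= l' * b < J2)%N%:R : R) y != 0).
      by rewrite E leqnn /= (leq_trans lr') ?geq_minl ?oner_neq0.
    case: (posnP l') => // ->.
    by rewrite mul0n leqNgt J10 eqxx.
  have B1 : (1 : R) <= B%:R by rewrite ler1n.
  have N1 : (1 : R) <= N%:R by rewrite ler1n.
  have y00 : 0 < y0 by exact: lt_le_trans y1.
  have y00' := ltW y00; have f0' := ltW f0; have g0' := ltW g0; have Bp0' := ltW Bp0.
  set P := `|gaps R ps|.
  have /andP[Plo Phi] := gaps_bounds R aps; rewrite sps -/P in Plo Phi.
  have Plo' : (Bp / (2 * z%:R ^+ a0)) ^+ s.+1 <= P.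
    have L0 : 0 <= Bp / (2 * z%:R ^+ a0).
      by rewrite !divr_ge0 ?mulr_ge0 ?exprn_ge0.
    by apply: le_trans Plo; apply: lerXn2r; rewrite ?nnegrE.
  have P0 : 0 < P.
    by apply: lt_le_trans Plo'; rewrite exprn_gt0 // divr_gt0 // mulr_gt0 // exprn_gt0.
  have Phi' : P <= (k%:R * Bp / z%:R ^+ e3) ^+ s.+1.
    have R0 : 0 <= k%:R * Bp / z%:R ^+ e3 :> R.
      by rewrite !mulr_ge0 ?invr_ge0 ?exprn_ge0.
    apply: (le_trans Phi); apply: lerXn2r; rewrite ?nnegrE //.
    by rewrite natrM -mulrA ler_wpM2l.
  have aK : all (fun p : nat * nat => (p.1%:R <= (k * H)%:R :> R) && (p.2%:R <= (k * H)%:R :> R)) ps.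
    by apply: sub_all (spread_pair_le aps) => p /=; rewrite !ler_nat.
  have yR : (0 : R) < y%:R by rewrite ltr0n.
  have [xi /andP[xi1 xi2] Exi] := rcube_mvt g yR aK.
  rewrite sps -/(falling g s.+1) -/(gaps R ps) in xi2 Exi.
  have CE : `|C| = y0 * f * P * xi `^ (g - s.+1%:R).
    rewrite /C cubeD_rcube Exi !normrM (ger0_norm y00') (ger0_norm (powR_ge0 _ _)).
    by rewrite !mulrA.
  have xiB : B%:R / 2 <= xi.
    rewrite ler_pdivrMr // mulrC (le_trans _ (ler_wpM2l _ xi1)) //.
    by rewrite -[2]/(2%:R) -natrM ler_nat.
  have xi0 : 0 < xi by apply: lt_le_trans xiB; rewrite divr_gt0.
  have xiB3 : 0 < xi <= 3 * B%:R.
    rewrite xi0 (le_trans xi2) // -natrM -natrD -[3]/(3%:R) -natrM ler_nat.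
    by move: yB skB; clear; lia.
  have up := @type_two_upper R g B%:R Bp y0 f P k%:R z%:R xi s e3 g01 B1 Bp0 BpE y00' f0'
    zr1 (ler0n _ _) (ltW P0) Phi' xiB.
  have lo := @type_two_lower R g N%:R B%:R Bp y0 f P z%:R xi s a0 g01 B1 N1 Bp0 BpE y1 f0
    zr1 Nz Plo' xiB3.
  rewrite -CE in up lo.
  have C0 : 0 < `|C| by rewrite CE !mulr_gt0 // powR_gt0.
  have AE : `|C * falling g 1 * gaps R [::]| = `|C| * g.
    by rewrite /falling /gaps big_nil big_ord1 subr0 mulr1 normrM (gtr0_norm g0).
  (* The empty cube: the phase in a is C * a `^ g itself. *)
  have := @cos_sum_cube R g C [::] 1 l' r'' (4 * (N%:R / B%:R)).
  rewrite /= AE => test; apply: (le_trans (test _ _ _ _ _ _)) => //.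
  - by rewrite mulr_gt0.
  - have h1 : r''%:R <= A%:R :> R by rewrite ler_nat geq_minr.
    have h2 : 1 <= N%:R / B%:R :> R.
      rewrite ler_pdivlMr // mul1r ler_nat (leq_trans _ BN) // leq_pmulr //.
      by rewrite expn_gt0 z0.
    by move: AN h1 h2; clear; lra.
  have zBx0 : 0 < z%:R ^+ Bx :> R by rewrite exprn_gt0.
  have t1 : 2 / (`|C| * g * (4 * (N%:R / B%:R)) `^ (g - 1)) <= eps * A%:R / 2.
    apply: (le_trans lo); apply: (@le_trans _ _ (z%:R ^+ (a0 * s.+1 + 2) / 2)).
      have -> : (f * g)^-1 * 6 ^+ s * 96 * z%:R ^+ (a0 * s.+1).+1 =
        ((f * g)^-1 * 6 ^+ s * 192) * (z%:R ^+ (a0 * s.+1).+1 / 2).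
        by field; rewrite !gt_eqF.
      have -> : z%:R ^+ (a0 * s.+1 + 2) / 2 = z%:R * (z%:R ^+ (a0 * s.+1).+1 / 2) :> R.
        by rewrite addn2 exprS mulrA.
      by rewrite ler_wpM2r ?divr_ge0 ?exprn_ge0 // (le_trans n2P) // ler_nat.
    rewrite ler_wpM2r // /eps mulrC ler_pdivlMr // -exprD -natrX ler_nat /A.
    apply: (@leq_trans (z ^ u)); first by rewrite leq_pexp2l // /u; clear; lia.
    by rewrite ltnW // ltnS leq_divRL // mulnC.
  have t2 : (r'' - l')%:R * (`|C| * g * l'%:R `^ (g - 1)) <= eps * A%:R / 2.
    have rr : (r'' - l')%:R <= A%:R :> R.
      by rewrite ler_nat (leq_trans (leq_subr _ _)) // geq_minr.
    have C1 : `|C| <= eps / 2.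
      apply: (le_trans up).
      apply: (@le_trans _ _ (z%:R ^+ q * (f * k%:R ^+ s.+1 * 2 ^+ s.+1) / z%:R ^+ e3)).
        rewrite -!mulrA ler_pM ?mulr_ge0 ?invr_ge0 ?exprn_ge0 //.
        rewrite !mulrA ler_wpM2l ?mulr_ge0 ?exprn_ge0 //.
        by rewrite lef_pV2 ?posrE ?exprn_gt0 // ler_weXn2l // leq_pmulr.
      have -> : z%:R ^+ q * (f * k%:R ^+ s.+1 * 2 ^+ s.+1) / z%:R ^+ e3 =
         eps / 2 * (2 * f * k%:R ^+ s.+1 * 2 ^+ s.+1 / z%:R).
        rewrite /eps /e3 (exprS _ (q + Bx)) !exprD; field.
        by rewrite !expf_neq0 ?gt_eqF.
      rewrite ler_piMr ?divr_ge0 // ler_pdivrMr // mul1r (le_trans n1P) //.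
      by rewrite ler_nat.
    have lg : g * l'%:R `^ (g - 1) <= 1.
      have := @ler_powRn R (g - 1) 1 l'%:R; rewrite powR1 => h'.
      by apply: mulr_ile1 => //; [exact: ltW | apply: h'; [move: g1; clear; lra | exact: ltr01 | by rewrite ler1n]].
    have -> : eps * A%:R / 2 = A%:R * (eps / 2) by ring.
    apply: ler_pM => //; first by rewrite !mulr_ge0 // powR_ge0.
    rewrite -mulrA; apply: le_trans C1.
    by rewrite ler_piMr.
  by move: t1 t2; clear; lra.
have [uk W1 _] := sysW.
have F1 i y : `|F i y| <= 1.
  by rewrite /F normrM mulr_ile1 // normr_nat -[1]/(1%:R) ler_nat leq_b1.
have W'1 c i y m : `|W' c i y m| <= 1.
  by rewrite /W' normrM mulr_ile1 //; case: ifP => _; rewrite ?normr1.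
have W'inv c i y m : W' c i (y + uu c)%N (m + ww c *+ i) = W' c i y m.
  by rewrite /W' mulnDr [(i * uu c)%N]mulnC (shift_system_iter _ _ _ _ sysW).
have Fs i y : F i y != 0 -> (s.+1 * (k * H) <= y < 2 * B)%N.
  rewrite /F /be'; case: (boolP (B <= y < 2 * B)%N) => [/andP[By -> _]|]; last first.
    by rewrite mulr0 mul0r eqxx.
  by rewrite andbT (leq_trans _ By) // (leq_trans _ skB) // leq_pmull.
have := @generalized_von_neumann R V _ uu (fun c (i : 'I_A) => ww c *+ i) k lam H (2 * B) eps s.+1 F phi W'
  H0 eps0 uk F1 W'1 W'inv Fs base.
have -> : \sum_i \sum_(0 <= y < 2 * B) \sum_m F i y * cos (phi i y) *
    \prod_(c < s.+1) W' c i y m =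
  \sum_(0 <= a < A) \sum_(B <= b < 2 * B)
      al a * be b * (J1 <= a * b < J2)%N%:R *
      cos (y0 * (a * b)%:R `^ g + th) * dual_function s.+1 W (a * b).
  rewrite big_mkord; apply: eq_bigr => i _.
  rewrite -[X in _ = \sum_(_ <= b < X) _](minnn (2 * B)) -sum_indicator.
  apply: eq_bigr => y _; rewrite -mulr_sumr.
  have -> : \sum_m \prod_(c < s.+1) W' c i y m = al i * dual_function s.+1 W (i * y).
    rewrite /dual_function mulr_sumr; apply: eq_bigr => m _.
    rewrite /W' big_split /= big_ord_recl /= big1 ?mulr1 //.
  by rewrite /F /be' /phi; ring.
move=> main.
have kap : 2 * lam%:R / H%:R <= (z%:R ^+ (e + 3))^-1 ^+ (2 ^ s.+1) :> R.
  rewrite exprVn -zBx /H natrM natrX /e1 exprS.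
  have -> : 2 * lam%:R / (lam%:R * (z%:R * z%:R ^+ Bx)) = 2 / z%:R / z%:R ^+ Bx :> R.
    by field; rewrite !pnatr_eq0 expf_neq0 ?gt_eqF // lt0r_neq0 // ltr0n.
  rewrite ler_piMl ?invr_ge0 ?exprn_ge0 // ler_pdivrMr // mul1r.
  by rewrite -[2]/(2%:R) ler_nat ltnW.
have vd : cauchy_loss eps (2 * lam%:R / H%:R) s.+1 <= 2 * (z%:R ^+ (e + 3))^-1.
  apply: cauchy_loss_le.
  - by rewrite invr_ge0 exprn_ge0 // invf_le1 ?exprn_gt0 // exprn_ege1.
  - by rewrite eps0 /eps zBx exprVn /=.
  - by rewrite kap !mulr_ge0 ?invr_ge0.
rewrite -ler_pdivlMr ?exprn_gt0 //; apply: (le_trans main).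
rewrite card_ord -/A (natrM _ _ #|V|) mulrA [leRHS]mulrAC ler_wpM2r //.
have AB : (A * (2 * B))%:R <= 4 * N%:R :> R.
  rewrite !natrM; apply: (le_trans (ler_wpM2r _ AN)); first by rewrite mulr_ge0.
  have -> : 2 * (N%:R / B%:R) * (2 * B%:R) = 4 * N%:R :> R by field; rewrite gt_eqF.
  by [].
apply: (le_trans (ler_pM (cauchy_loss_ge0 _ _ eps0) (ler0n _ _) vd AB)).
rewrite exprD invfM.
have -> : 2 * ((z%:R ^+ e)^-1 / z%:R ^+ 3) * (4 * N%:R) =
  N%:R / z%:R ^+ e * (8 / z%:R ^+ 3) :> R by ring.
rewrite ler_piMr ?divr_ge0 ?exprn_ge0 // ler_pdivrMr ?exprn_gt0 // mul1r.
by rewrite -natrX -[8]/(8%:R) ler_nat (@leq_exp2r 2 z 3) // ltnW.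
Qed.

(** * Primes twisted by a phase and a dual function *)

Lemma sum_range_dvd (R : realType) (t J1 J2 N Y : nat) (F : nat -> R) :
  (0 < t)%N -> (0 < J1)%N -> (J2 <= N.+1)%N -> (N %/ t < Y)%N ->
  \sum_(J1 <= n < J2) (t %| n)%N%:R * F n =
  \sum_(0 <= b < Y) (J1 <= b * t < J2)%N%:R * F (b * t)%N.
Proof.
move=> t0 J10 J2N NY.
have E1 : \sum_(J1 <= n < J2) (t %| n)%N%:R * F n =
    \sum_(1 <= n < N.+1) (t %| n)%N%:R * ((J1 <= n < J2)%N%:R * F n).
  have := sum_indicator (fun n => (t %| n)%N%:R * F n) J1 J2 N.+1.
  rewrite (minn_idPl J2N) => <-; rewrite big_ltn // leqn0 -leqn0 leqNgt J10 mul0r add0r.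
  by apply: eq_bigr => n _; rewrite mulrCA.
rewrite E1 sum_multiples //.
rewrite [RHS](@big_cat_nat _ _ _ (N %/ t).+1) //= [X in _ = _ + X]big1_seq ?addr0.
  rewrite [RHS]big_ltn // mul0n leqNgt J10 mul0r add0r.
  by apply: eq_bigr => b _; rewrite mulnC.
move=> b /andP[_]; rewrite mem_index_iota => /andP[Nb _].
rewrite ltn_divLR // in Nb.
by rewrite [(b * t < J2)%N]ltnNge (leq_trans J2N) // andbF mul0r.
Qed.

Lemma sum_dyadic (R : realType) (f : nat -> R) L :
  \sum_(1 <= b < 2 ^ L) f b = \sum_(0 <= j < L) \sum_(2 ^ j <= b < 2 * 2 ^ j) f b.
Proof.
elim: L => [|L IH]; first by rewrite !big_geq.
rewrite big_nat_recr //= -IH -(@big_cat_nat _ _ _ (2 ^ L)) //= ?expn_gt0 //.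
  by rewrite expnS.
by rewrite leq_pmull.
Qed.

Lemma ler_norm_sum_range (R : realType) (f : nat -> R) (l r : nat) (c : R) :
  (forall y, (l <= y < r)%N -> `|f y| <= c) ->
  `|\sum_(l <= y < r) f y| <= (r - l)%:R * c.
Proof.
move=> fc; apply: (le_trans (ler_norm_sum _ _ _)).
rewrite mulr_natl -sumr_const_nat.
rewrite big_nat_cond [leRHS]big_nat_cond; apply: ler_sum => y.
by rewrite andbT; exact: fc.
Qed.

(** In the first two sums of Vaughan's identity with [U = z ^ u], [n] runs over
progressions of modulus at most [U * U], and partial summation removes the
logarithm.  In the third both divisors exceed [U]; cut into dyadic ranges of the
divisor [b], it is bilinear with both variables long. *)
Lemma mangoldt_cos_sum (R : realType) (s k q h e : nat) : (1 < s)%N -> (0 < k)%N ->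
  exists D : nat, forall D' : nat, (D <= D')%N -> forall g : R, 0 < g < 1 -> exists z0 : nat,
  forall (z N J1 J2 : nat) (y0 th : R) (V : finZmodType) uu ww
    (W : nat -> nat -> V -> R),
  (z0 <= z)%N -> (z ^ D' <= N)%N -> (N < z.+1 ^ D')%N ->
  N%:R `^ (1 - g) <= 2 * z%:R -> ln N%:R <= z%:R :> R ->
  (N <= J1 * z ^ h)%N -> (J2 <= N.+1)%N -> 1 <= y0 <= z%:R ^+ q ->
  shift_system k uu ww W ->
  `|\sum_(J1 <= n < J2) mangoldt R n * (cos (y0 * n%:R `^ g + th) * dual_function s W n)|
     * z%:R ^+ e <= N%:R * #|V|%:R.
Proof.
move=> s1 k0; have s0 : (0 < s)%N by exact: ltnW.
have [u twoP] := @type_two_sum R s k q (e + 7) s1 k0.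
have [D1 oneP] := @type_one_sum R s k q h (2 * u) (e + 2 * u + 3) s0 k0.
exists (D1 + (2 * u + h + 1))%N => D DD g g01.
have [za {}twoP] := twoP g g01; have [zb {}oneP] := oneP g g01.
pose CD := ((2 ^ D) ^ (2 ^ D))%N.
exists (za + zb + 2 * CD + D + 3)%N.
move=> z N J1 J2 y0 th V uu ww W zz0 zN Npow Nz lnN NJ J2N y01 sysW.
have z3 : (3 <= z)%N by apply: leq_trans zz0; rewrite leq_addl.
have zza : (za <= z)%N by move: zz0; clear; lia.
have zzb : (zb <= z)%N by move: zz0; clear; lia.
have zCD : (2 * CD <= z)%N by move: zz0; clear; lia.
have zD : (D <= z)%N by move: zz0; clear; lia.
have z0 : (0 < z)%N by exact: leq_trans z3.
have D0 : (0 < D)%N by apply: leq_trans DD; rewrite addnA addn1.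
have zD1N : (z ^ D1 <= N)%N.
  by apply: leq_trans zN; rewrite leq_pexp2l // (leq_trans _ DD) // leq_addr.
have zr1 : (1 : R) <= z%:R by rewrite ler1n.
have zr0 : (0 : R) < z%:R by rewrite ltr0n.
have zr0' := ltW zr0.
have N0 : (0 < N)%N by apply: leq_trans zN; rewrite expn_gt0 z0.
have J10 : (0 < J1)%N by case: J1 NJ => //; rewrite mul0n leqNgt N0.
pose U := (z ^ u)%N.
have U0 : (0 < U)%N by rewrite expn_gt0 z0.
have UUE : (U * U = z ^ (2 * u))%N by rewrite /U -expnD addnn -mul2n.
have UJ : (U * U < J1)%N.
  rewrite -(@ltn_pmul2r (z ^ h)) ?expn_gt0 ?z0 //.
  apply: leq_trans NJ; apply: leq_trans zN.
  apply: (@leq_trans (z ^ (2 * u + h + 1))).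
    by rewrite UUE -expnD addn1 ltn_exp2l // (leq_trans _ z3).
  by rewrite leq_pexp2l // (leq_trans _ DD) // leq_addl.
have UJ' : (U < J1)%N by apply: leq_ltn_trans UJ; rewrite leq_pmulr.
pose x n := cos (y0 * n%:R `^ g + th) * dual_function s W n.
pose M : R := N%:R * #|V|%:R / z%:R ^+ (e + 2 * u + 3).
have M0 : 0 <= M by rewrite divr_ge0 ?mulr_ge0 ?exprn_ge0.
have lamz n : (0 < n <= N)%N -> 0 <= mangoldt R n <= z%:R.
  move=> /andP[n0 nN]; rewrite mangoldt_ge0 (le_trans (mangoldt_le_ln R n0)) //.
  by rewrite (le_trans _ lnN) // ler_ln ?posrE ?ltr0n // ler_nat.
have prog d l r : (0 < d <= z ^ (2 * u))%N ->
    (forall b, (J1 <= b * d < J2)%N = (l <= b < r)%N) ->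
    forall j, (l <= j)%N -> `|\sum_(j <= b < r) x (b * d)%N| <= M.
  move=> dU lr j lj.
  have [rj|jr] := leqP r j; first by rewrite big_geq // normr0.
  rewrite /M ler_pdivlMr ?exprn_gt0 //.
  have -> : \sum_(j <= b < r) x (b * d)%N =
      \sum_(j <= b < r) cos (y0 * (d * b)%:R `^ g + th) * dual_function s W (d * b).
    by apply: eq_bigr => b _; rewrite mulnC.
  have [d0 _] := andP dU.
  apply: (oneP z N d j r y0 th V uu ww W) => //.
  - have : (l <= j < r)%N by rewrite lj jr.
    rewrite -lr => /andP[h1 _]; apply: (leq_trans NJ).
    by rewrite leq_mul2r mulnC h1 orbT.
  - have : (l <= r.-1 < r)%N by move: lj jr; clear; lia.
    rewrite -lr => /andP[_ h1].
    have dN : (d <= N)%N.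
      apply: leq_trans (_ : J1 <= N)%N; last first.
        have : (l <= j < r)%N by rewrite lj jr.
        rewrite -lr => /andP[h2 h3]; by move: h2 h3 J2N; clear; lia.
      by apply: leq_trans (ltnW UJ); rewrite UUE; case/andP: dU.
    have : (r = r.-1.+1)%N by move: jr; clear; lia.
    move: h1 dN J2N; move: (r.-1) => r1 h1 dN J2N' ->.
    by rewrite mulnS [(d * r1)%N]mulnC; move: h1 dN J2N'; clear; lia.
have prog0 d : (0 < d <= z ^ (2 * u))%N ->
    `|\sum_(J1 <= n < J2) (d %| n)%N%:R * x n| <= M.
  move=> dU; have [d0 _] := andP dU.
  have [l [r lr]] := mul_interval J2 d J10.
  rewrite (@sum_range_dvd _ _ _ _ N (maxn r (N %/ d).+1)) ?leq_maxr //.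
  have -> : \sum_(0 <= b < maxn r (N %/ d).+1) (J1 <= b * d < J2)%N%:R * x (b * d)%N
     = \sum_(l <= b < r) x (b * d)%N.
    rewrite -[in RHS](minn_idPl (leq_maxl r (N %/ d).+1)) -sum_indicator.
    by apply: eq_bigr => b _; rewrite lr.
  exact: prog dU lr _ (leqnn _).
pose S1 := \sum_(J1 <= n < J2) (\sum_(1 <= t < U.+1) (t %| n)%N%:R *
   (sqfree_pow (-1) t * ln (n %/ t)%N%:R)) * x n.
pose S2 := \sum_(J1 <= n < J2) (\sum_(1 <= b < U.+1) \sum_(1 <= t < U.+1)
      (b * t %| n)%N%:R * (mangoldt R b * sqfree_pow (-1) t)) * x n.
pose S3 := \sum_(J1 <= n < J2) (\sum_(U.+1 <= b < N.+1) (b %| n)%N%:R *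
      (mangoldt R b * ((U < n %/ b)%N%:R * trunc_mobius R U (n %/ b)))) * x n.
have SE : \sum_(J1 <= n < J2) mangoldt R n * x n = S1 - S2 - S3.
  rewrite /S1 /S2 /S3 -!sumrB !big_nat; apply: eq_bigr => n /andP[n1 n2].
  rewrite (@vaughan_identity R U n N) ?(leq_trans UJ' n1) //; first by rewrite -!mulrBl.
  by move: n2 J2N; clear; lia.
have UU : (U <= z ^ (2 * u))%N by rewrite /U leq_pexp2l // leq_pmull.
have UN : (U <= N)%N.
  apply: leq_trans UU _; apply: leq_trans zN; rewrite leq_pexp2l //.
  by move: DD; clear; lia.
have sq1 t : `|sqfree_pow (-1) t : R| <= 1.
  by rewrite sqfree_pow_norm; case/andP: (sqfree_pow1_bounds R t).
have B1 : `|S1| <= U%:R * (z%:R * M).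
  have -> : S1 = \sum_(1 <= t < U.+1) sqfree_pow (-1) t *
     \sum_(J1 <= n < J2) (t %| n)%N%:R * (ln (n %/ t)%N%:R * x n).
    rewrite /S1; under eq_bigr do rewrite mulr_suml.
    rewrite exchange_big /=; apply: eq_bigr => t _.
    by rewrite mulr_sumr; apply: eq_bigr => n _; ring.
  rewrite -[U in U%:R]subn0 -subSS; apply: ler_norm_sum_range => t /andP[t0 tU].
  rewrite normrM -[leRHS]mul1r; apply: ler_pM => //.
  have tU' : (0 < t <= z ^ (2 * u))%N by rewrite t0 /= (leq_trans _ UU).
  have [l [r lr]] := mul_interval J2 t J10.
  rewrite (@sum_range_dvd _ _ _ _ N (maxn r (N %/ t).+1)) ?leq_maxr //.
  have -> : \sum_(0 <= b < maxn r (N %/ t).+1) (J1 <= b * t < J2)%N%:R *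
       (ln (b * t %/ t)%N%:R * x (b * t)%N) = \sum_(l <= b < r) ln b%:R * x (b * t)%N.
    rewrite -[in RHS](minn_idPl (leq_maxl r (N %/ t).+1)) -sum_indicator.
    by apply: eq_bigr => b _; rewrite lr mulnK.
  apply: abel_sum_le => //.
  - move=> b lbr; have : (J1 <= b * t < J2)%N by rewrite lr.
    move=> /andP[b1 b2]; have b0 : (0 < b)%N.
      by case: (b) b1 => //; rewrite mul0n leqNgt J10.
    have bN : (b <= N)%N.
      by rewrite -ltnS; apply: leq_trans J2N; apply: leq_ltn_trans b2; rewrite leq_pmulr.
    rewrite ln_ge0 ?ler1n //= (le_trans _ lnN) //.
    by rewrite ler_ln ?posrE ?ltr0n // ler_nat.
  - move=> b lb br; have b0 : (0 < b)%N.
      have : (J1 <= b * t < J2)%N by rewrite lr lb (ltn_trans _ br).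
      by case: (b) => //; rewrite mul0n leqNgt J10.
    by rewrite ler_ln ?posrE ?ltr0n // ler_nat.
  - by move=> j /andP[lj _]; exact: prog tU' lr _ lj.
have B2 : `|S2| <= U%:R * (U%:R * (z%:R * M)).
  have -> : S2 = \sum_(1 <= b < U.+1) \sum_(1 <= t < U.+1)
     (mangoldt R b * sqfree_pow (-1) t) *
     \sum_(J1 <= n < J2) (b * t %| n)%N%:R * x n.
    rewrite /S2; under eq_bigr do rewrite mulr_suml.
    rewrite exchange_big /=; apply: eq_bigr => b _.
    under eq_bigr do rewrite mulr_suml.
    rewrite exchange_big /=; apply: eq_bigr => t _.
    by rewrite mulr_sumr; apply: eq_bigr => n _; ring.
  rewrite -[U in U%:R]subn0 -subSS; apply: ler_norm_sum_range => b /andP[b0 bU].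
  apply: ler_norm_sum_range => t /andP[t0 tU].
  have bt : (0 < b * t <= z ^ (2 * u))%N.
    by rewrite muln_gt0 b0 t0 -UUE leq_mul.
  have /andP[l0 l1] : 0 <= mangoldt R b <= z%:R.
    apply: lamz; rewrite b0 /=.
    by rewrite (leq_trans _ UN) // -ltnS.
  rewrite normrM; apply: ler_pM => //; last exact: prog0.
  by rewrite normrM (ger0_norm l0) -[leRHS]mulr1 ler_pM.
(* Both coefficients are normalized to absolute value at most 1: Lambda is at
   most z, and trunc_mobius at most z ^ 2 by the divisor bound. *)
pose be b : R := (U.+1 <= b < N.+1)%N%:R * (mangoldt R b / z%:R).
pose al a : R := (U < a <= N)%N%:R * (trunc_mobius R U a / z%:R ^+ 2).
have be1 b : `|be b| <= 1.
  rewrite /be; case: (boolP (U.+1 <= b < N.+1)%N) => [/andP[Ub bN]|]; last first.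
    by rewrite mul0r normr0.
  have /lamz/andP[l0 l1] : (0 < b <= N)%N by rewrite (leq_ltn_trans _ Ub).
  by rewrite mul1r ger0_norm ?divr_ge0 // ler_pdivrMr // mul1r.
have al1 a : `|al a| <= 1.
  rewrite /al; case: (boolP (U < a <= N)%N) => [/andP[Ua aN]|]; last first.
    by rewrite mul0r normr0.
  have a0 : (0 < a)%N by exact: leq_ltn_trans Ua.
  rewrite mul1r normrM [`|_^-1|]ger0_norm ?invr_ge0 ?exprn_ge0 //.
  rewrite ler_pdivrMr ?exprn_gt0 // mul1r (le_trans (trunc_mobius_le R U a0)) //.
  rewrite -natrX ler_nat.
  have hh := omega_bound_pow (leq_ltn_trans aN Npow) D0; rewrite -/CD in hh.
  apply: (leq_trans hh).
  rewrite -/CD; apply: (@leq_trans (CD * (2 * z))).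
    by rewrite leq_mul2l; apply/orP; right; move: z0; clear; lia.
  by rewrite mulnA [(CD * 2)%N]mulnC (expnS z 1) expn1 leq_mul2r zCD orbT.
(* L dyadic ranges suffice, as N < z.+1 ^ D <= 2 ^ (z * D). *)
pose L := (z * D)%N.
have NL : (N.+1 <= 2 ^ L)%N.
  by apply: (leq_trans Npow); rewrite /L expnM leq_exp2r // ltn_expl.
pose I b := \sum_(J1 <= n < J2) (b %| n)%N%:R *
  ((U < n %/ b)%N%:R * trunc_mobius R U (n %/ b) * x n).
have E3 : S3 = \sum_(0 <= j < L) \sum_(2 ^ j <= b < 2 * 2 ^ j) be b * (z%:R * I b).
  rewrite -sum_dyadic /S3.
  transitivity (\sum_(U.+1 <= b < N.+1) mangoldt R b * I b).
    under eq_bigr do rewrite mulr_suml.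
    rewrite exchange_big /=; apply: eq_bigr => b _; rewrite /I mulr_sumr.
    by apply: eq_bigr => n _; ring.
  have := sum_indicator (fun b => mangoldt R b * I b) U.+1 N.+1 (2 ^ L).
  rewrite (minn_idPl NL) => <-; rewrite big_ltn ?expn_gt0 // mul0r add0r.
  apply: eq_bigr => b _; rewrite /be; field; by rewrite gt_eqF.
pose M3 : R := N%:R * #|V|%:R / z%:R ^+ (e + 7).
have M30 : 0 <= M3 by rewrite divr_ge0 ?mulr_ge0 ?exprn_ge0.
have B3 : `|S3| <= L%:R * (z%:R ^+ 3 * M3).
  rewrite E3; apply: ler_norm_sum_nat => j jL.
  set B := (2 ^ j)%N; have B0 : (0 < B)%N by rewrite expn_gt0.
  have -> : \sum_(B <= b < 2 * B) be b * (z%:R * I b) = z%:R ^+ 3 *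
     \sum_(0 <= a < (N %/ B).+1) \sum_(B <= b < 2 * B)
      al a * be b * (J1 <= a * b < J2)%N%:R *
      cos (y0 * (a * b)%:R `^ g + th) * dual_function s W (a * b).
    rewrite exchange_big /= mulr_sumr !big_nat; apply: eq_bigr => b /andP[Bb _].
    have b0 : (0 < b)%N by exact: leq_trans Bb.
    rewrite /I (@sum_range_dvd _ _ _ _ N (N %/ B).+1) //; last first.
      by rewrite ltnS leq_div2l.
    rewrite !mulr_sumr; apply: eq_bigr => a _; rewrite mulnK //.
    case: (boolP (J1 <= a * b < J2)%N) => [/andP[h1 h2]|]; last by rewrite !(mul0r, mulr0).
    have aN : (a <= N)%N.
      by rewrite -ltnS; apply: leq_trans J2N; apply: leq_ltn_trans h2; rewrite leq_pmulr.
    by rewrite /al aN andbT /x; field; rewrite gt_eqF.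
  rewrite normrM ger0_norm ?exprn_ge0 // ler_wpM2l ?exprn_ge0 //.
  have [h1|h1] := leqP (z ^ u) (2 * B); last first.
    rewrite big1 ?normr0 // => a _; rewrite big1_seq // => b /andP[_].
    rewrite mem_index_iota => /andP[_ b2].
    rewrite /be (_ : (U.+1 <= b < N.+1)%N = false) ?(mul0r, mulr0) //.
    by apply/negbTE; rewrite negb_and -leqNgt (leq_trans (ltnW b2)) // ltnW.
  have [h2|h2] := leqP (B * z ^ u) N; last first.
    rewrite big1_seq ?normr0 // => a /andP[_]; rewrite mem_index_iota ltnS => /andP[_ aN].
    rewrite big1 // => b _.
    rewrite /al (_ : (U < a <= N)%N = false) ?(mul0r, mulr0) //.
    apply/negbTE; rewrite negb_and -leqNgt (leq_trans aN) //.
    by rewrite -ltnS ltn_divLR // mulSn [(z ^ u * B)%N]mulnC (leq_trans h2) // leq_addl.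
  rewrite /M3 ler_pdivlMr ?exprn_gt0 //.
  exact: (twoP z N B J1 J2 y0 th al be V uu ww W).
rewrite -/x SE.
have LL : L%:R <= z%:R ^+ 2 :> R.
  by rewrite -natrX ler_nat /L (expnS z 1) expn1 leq_mul2l zD orbT.
have Ur : U%:R = z%:R ^+ u :> R by rewrite natrX.
have fin : `|S1 - S2 - S3| <= 3 * (N%:R * #|V|%:R / z%:R ^+ (e + 2)).
  have K1 : U%:R * (U%:R * (z%:R * M)) = N%:R * #|V|%:R / z%:R ^+ (e + 2).
    rewrite /M Ur (_ : e + 2 * u + 3 = u + u + 1 + (e + 2))%N; last by ring.
    by rewrite !exprD !expr1; field; rewrite !expf_neq0 ?gt_eqF.
  have K3 : z%:R ^+ 2 * (z%:R ^+ 3 * M3) = N%:R * #|V|%:R / z%:R ^+ (e + 2).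
    rewrite /M3 !exprD; field.
    by rewrite !expf_neq0 ?gt_eqF.
  have K0 : U%:R * (z%:R * M) <= U%:R * (U%:R * (z%:R * M)).
    rewrite ler_wpM2l // ler_peMl ?mulr_ge0 // ler1n //.
  have K3' : L%:R * (z%:R ^+ 3 * M3) <= z%:R ^+ 2 * (z%:R ^+ 3 * M3).
    by rewrite ler_wpM2r // mulr_ge0 ?exprn_ge0.
  apply: (le_trans (ler_normB _ _)); apply: (le_trans (lerD (ler_normB _ _) (lexx _))).
  rewrite -K1 in K3 *.
  move: B1 B2 B3 K0 K3' K3; clear; lra.
have ze0 : 0 < z%:R ^+ e :> R by rewrite exprn_gt0.
rewrite -ler_pdivlMr //; apply: (le_trans fin).
rewrite exprD invfM.
have -> : 3 * (N%:R * #|V|%:R * ((z%:R ^+ e)^-1 / z%:R ^+ 2)) =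
   N%:R * #|V|%:R / z%:R ^+ e * (3 / z%:R ^+ 2) :> R by ring.
rewrite ler_piMr ?divr_ge0 ?mulr_ge0 ?exprn_ge0 // ler_pdivrMr ?exprn_gt0 // mul1r.
by rewrite -natrX -[3]/(3%:R) ler_nat (leq_trans z3) // (expnS z 1) expn1 leq_pmulr.
Qed.

(** * Fejer means on a finite grid *)

Lemma sin_periodn (R : realType) (x : R) n : sin (x + 2 * pi * n%:R) = sin x.
Proof.
elim: n => [|n IH]; first by rewrite mulr0 addr0.
have := sinD2pi (x + 2 * pi * n%:R); rewrite IH => <-.
by congr sin; rewrite -(natr1 n) -mulr_natl; ring.
Qed.

Lemma sin_pi_natl_neq0 (R : realType) (h K : nat) : (0 < h < K)%N ->
  sin (pi * (h%:R / K%:R)) != 0 :> R.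
Proof.
move=> /andP[h0 hK]; have K0 : (0 < K)%N by exact: leq_trans hK.
rewrite gt_eqF // sin_gt0_pi //; apply/andP; split.
  by rewrite mulr_gt0 ?pi_gt0 // divr_gt0 ?ltr0n.
by rewrite gtr_pMr ?pi_gt0 // ltr_pdivrMr ?ltr0n // mul1r ltr_nat.
Qed.

Lemma sum_cos_grid (R : realType) (h K : nat) (t : R) : (0 < h < K)%N ->
  \sum_(0 <= r < K) cos (2 * pi * h%:R * (t - r%:R / K%:R)) = 0.
Proof.
move=> hK; have s0 := @sin_pi_natl_neq0 R h K hK.
have K0 : (K%:R : R) != 0 by rewrite pnatr_eq0; case/andP: hK => _; case: (K).
apply: (mulfI (mulf_neq0 (_ : 2 != 0 :> R) s0)); first by rewrite pnatr_eq0.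
rewrite mulr0 mulr_sumr.
pose a (r : nat) : R := 2 * pi * h%:R * t + pi * (h%:R / K%:R) - 2 * pi * h%:R * (r%:R / K%:R).
rewrite (eq_bigr (fun r => - (sin (a r.+1) - sin (a r)))).
  rewrite sumrN telescope_sumr // /a mulfV // mulr1 mul0r mulr0 subr0.
  by rewrite -(sin_periodn (_ - _) h) subrK subrr oppr0.
move=> r _; rewrite /a -(natr1 r).
set x := 2 * pi * h%:R * (t - r%:R / K%:R).
set d := pi * (h%:R / K%:R).
have -> : 2 * pi * h%:R * t + d - 2 * pi * h%:R * ((r%:R + 1) / K%:R) = x - d.
  by rewrite /x /d; ring.
have -> : 2 * pi * h%:R * t + d - 2 * pi * h%:R * (r%:R / K%:R) = x + d.
  by rewrite /x /d; ring.
by rewrite sinB sinD; ring.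
Qed.

(** The double sum is the square of the modulus of a geometric progression, which
telescopes when multiplied by [2 * sin (pi * t)]. *)
Lemma sin_sq_dirichlet (R : realType) (K : nat) (t : R) :
  sin (pi * t) ^+ 2 * \sum_(0 <= j < K) \sum_(0 <= j' < K)
     cos (2 * pi * (j%:R - j'%:R) * t) <= 1.
Proof.
pose C := \sum_(0 <= j < K) cos (2 * pi * j%:R * t).
pose S := \sum_(0 <= j < K) sin (2 * pi * j%:R * t).
have -> : \sum_(0 <= j < K) \sum_(0 <= j' < K)
     cos (2 * pi * (j%:R - j'%:R) * t) = C ^+ 2 + S ^+ 2.
  rewrite !expr2 /C /S !mulr_suml -big_split /=; apply: eq_bigr => j _.
  rewrite !mulr_sumr -big_split /=; apply: eq_bigr => j' _.
  by rewrite -cosB; congr cos; ring.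
pose b (j : nat) : R := 2 * pi * j%:R * t - pi * t.
have bS j : b j.+1 = 2 * pi * j%:R * t + pi * t by rewrite /b -(natr1 j); ring.
have bE j : b j = 2 * pi * j%:R * t - pi * t by [].
have EC : 2 * sin (pi * t) * C = sin (b K) - sin (b 0%N).
  rewrite -(telescope_sumr (fun j => sin (b j)) (leq0n K)) /C mulr_sumr; apply: eq_bigr => j _.
  by rewrite bS bE sinB sinD; ring.
have ES : 2 * sin (pi * t) * S = - (cos (b K) - cos (b 0%N)).
  rewrite -(telescope_sumr (fun j => cos (b j)) (leq0n K)) /S mulr_sumr -sumrN; apply: eq_bigr => j _.
  by rewrite bS bE cosB cosD; ring.
have h1 : 4 * (sin (pi * t) ^+ 2 * (C ^+ 2 + S ^+ 2)) =
    (sin (b K) - sin (b 0%N)) ^+ 2 + (cos (b K) - cos (b 0%N)) ^+ 2.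
  by rewrite -EC -(sqrrN (cos _ - _)) -ES; ring.
have h2 := cos2Dsin2 (b K); have h3 := cos2Dsin2 (b 0%N).
have h4 := sqr_ge0 (sin (b K) + sin (b 0%N)).
have h5 := sqr_ge0 (cos (b K) + cos (b 0%N)).
by nra.
Qed.

(** The Fejer kernel of order [K] at [x - r / K], normalized so that its sum over the
grid is 1. *)
Definition fejer_weight (R : realType) (K : nat) (x : R) (r : nat) : R :=
  (K%:R ^+ 2)^-1 * \sum_(0 <= j < K) \sum_(0 <= j' < K)
     cos (2 * pi * (j%:R - j'%:R) * (x - r%:R / K%:R)).

(** A trigonometric polynomial in [x] of degree below [K]. *)
Definition fejer_mean (R : realType) (K : nat) (f : R -> R) (x : R) : R :=
  \sum_(0 <= r < K) fejer_weight K x r * f (r%:R / K%:R).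

Definition grid_mean (R : realType) (K : nat) (f : R -> R) : R :=
  K%:R^-1 * \sum_(0 <= r < K) f (r%:R / K%:R).

Lemma fejer_weight_ge0 (R : realType) (K : nat) (x : R) r : 0 <= fejer_weight K x r.
Proof.
rewrite /fejer_weight mulr_ge0 ?invr_ge0 ?exprn_ge0 //.
set u := x - _.
have := sqr_sum_cos (index_iota 0 K) (fun=> 1) (fun j => 2 * pi * j%:R * u).
move=> /(le_trans (sqr_ge0 _)); congr (0 <= _).
apply: eq_bigr => j _; apply: eq_bigr => j' _.
by rewrite !mul1r; congr cos; ring.
Qed.

Lemma sum_cos_grid_diff (R : realType) (j j' K : nat) (t : R) : (j < K)%N -> (j' < K)%N ->
  \sum_(0 <= r < K) cos (2 * pi * (j%:R - j'%:R) * (t - r%:R / K%:R)) =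
  (j == j')%:R * K%:R.
Proof.
move=> jK j'K; case: (ltngtP j j') => h.
- have hK : (0 < j' - j < K)%N by rewrite subn_gt0 h /=; move: h j'K; clear; lia.
  rewrite mul0r; apply: etrans (sum_cos_grid t hK).
  apply: eq_bigr => r _; rewrite -cosN natrB 1?ltnW //; congr cos; ring.
- have hK : (0 < j - j' < K)%N by rewrite subn_gt0 h /=; move: h jK; clear; lia.
  rewrite mul0r; apply: etrans (sum_cos_grid t hK).
  by apply: eq_bigr => r _; rewrite natrB 1?ltnW.
- rewrite h mul1r (eq_bigr (fun=> 1)) ?sumr_const_nat ?subn0 // => r _.
  by rewrite subrr mulr0 mul0r cos0.
Qed.

Lemma sum_fejer_weight (R : realType) (K : nat) (x : R) : (0 < K)%N ->
  \sum_(0 <= r < K) fejer_weight K x r = 1.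
Proof.
move=> K0; have K0' : (K%:R : R) != 0 by rewrite pnatr_eq0 -lt0n.
rewrite /fejer_weight -mulr_sumr exchange_big /=.
have -> : \sum_(0 <= j < K) \sum_(0 <= r < K) \sum_(0 <= j' < K)
     cos (2 * pi * (j%:R - j'%:R) * (x - r%:R / K%:R)) = \sum_(0 <= j < K) K%:R :> R.
  rewrite big_nat [RHS]big_nat; apply: eq_bigr => j /= jK.
  rewrite exchange_big /= (bigD1_seq j) ?mem_index_iota ?iota_uniq //=.
  rewrite sum_cos_grid_diff // eqxx mul1r -[RHS]addr0; congr (_ + _).
  rewrite big_seq_cond big1 // => j' /andP[]; rewrite mem_index_iota => /= j'K.
  by move=> jj'; rewrite sum_cos_grid_diff // eq_sym (negbTE jj') mul0r.
by rewrite sumr_const_nat subn0 -mulr_natl; field.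
Qed.

(** The weights are nonnegative of sum 1 and, by [sin_sq_dirichlet], the mean of
[sin (pi * (x - r / K)) ^+ 2] for them is at most [K^-1]; by convexity the mean of
its square root is at most [(Num.sqrt K)^-1]. *)
Lemma fejer_approx (R : realType) (K : nat) (f : R -> R) (L x : R) : (0 < K)%N -> 0 <= L ->
  (forall x y, `|f x - f y| <= L * `|sin (pi * (x - y))|) ->
  `|f x - fejer_mean K f x| <= L / Num.sqrt K%:R.
Proof.
move=> K0 L0 fL; have K0' : (0 : R) < K%:R by rewrite ltr0n.
have -> : f x - fejer_mean K f x =
    \sum_(0 <= r < K) fejer_weight K x r * (f x - f (r%:R / K%:R)).
  have E : f x = \sum_(0 <= r < K) fejer_weight K x r * f x.
    by rewrite -mulr_suml sum_fejer_weight // mul1r.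
  by rewrite {1}E /fejer_mean -sumrB; apply: eq_bigr => r _; rewrite mulrBr.
pose sn r := `|sin (pi * (x - r%:R / K%:R))|.
apply: (@le_trans _ _ (L * \sum_(0 <= r < K) fejer_weight K x r * sn r)).
  rewrite mulr_sumr; apply: (le_trans (ler_norm_sum _ _ _)); apply: ler_sum => r _.
  by rewrite normrM ger0_norm ?fejer_weight_ge0 // mulrCA ler_wpM2l ?fejer_weight_ge0.
rewrite ler_wpM2l //.
set m := \sum_(0 <= r < K) _.
have m0 : 0 <= m by apply: sumr_ge0 => r _; rewrite mulr_ge0 ?fejer_weight_ge0 ?normr_ge0.
have h1 : m ^+ 2 <= \sum_(0 <= r < K) fejer_weight K x r * sn r ^+ 2.
  rewrite -subr_ge0.
  have -> : \sum_(0 <= r < K) fejer_weight K x r * sn r ^+ 2 - m ^+ 2 =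
      \sum_(0 <= r < K) fejer_weight K x r * (sn r - m) ^+ 2.
    transitivity (\sum_(0 <= r < K) fejer_weight K x r * sn r ^+ 2 -
        m * \sum_(0 <= r < K) fejer_weight K x r * sn r - m *
        \sum_(0 <= r < K) fejer_weight K x r * sn r + m ^+ 2 *
        \sum_(0 <= r < K) fejer_weight K x r).
      by rewrite sum_fejer_weight // -/m; ring.
    rewrite !mulr_sumr -!sumrB -big_split /=; apply: eq_bigr => r _; ring.
  by apply: sumr_ge0 => r _; rewrite mulr_ge0 ?fejer_weight_ge0 ?sqr_ge0.
have h2 : \sum_(0 <= r < K) fejer_weight K x r * sn r ^+ 2 <= K%:R^-1.
  have -> : K%:R^-1 = \sum_(0 <= r < K) (K%:R ^+ 2)^-1 :> R.
    by rewrite sumr_const_nat subn0 -mulr_natl; field; rewrite gt_eqF.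
  apply: ler_sum => r _; rewrite /fejer_weight /sn real_normK ?num_real //.
  rewrite -mulrA ler_piMr ?invr_ge0 ?exprn_ge0 ?(ltW K0') // mulrC.
  exact: sin_sq_dirichlet.
have sK0 : 0 < Num.sqrt (K%:R : R) by rewrite sqrtr_gt0.
rewrite -[_^-1]mul1r ler_pdivlMr //.
rewrite -(@ler_pXn2r _ 2) ?nnegrE ?mulr_ge0 ?(ltW sK0) //.
rewrite exprMn sqr_sqrtr ?(ltW K0') // expr1n -ler_pdivlMr // div1r.
exact: le_trans h1 h2.
Qed.

(** The diagonal terms [j = j'] of the kernel reproduce [grid_mean], so only the
frequencies [2 * pi * (j - j')] with [j != j'] are left; the absolute values of
their coefficients add up to at most [K]. *)
Lemma fejer_sum (R : realType) (K : nat) (f : R -> R) (c x : nat -> R) (J1 J2 : nat) (b : R) :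
  (0 < K)%N -> (forall x, `|f x| <= 1) -> 0 <= b ->
  (forall y th : R, 1 <= y <= 2 * pi * K%:R ->
    `|\sum_(J1 <= n < J2) c n * cos (y * x n + th)| <= b) ->
  `|\sum_(J1 <= n < J2) c n * (fejer_mean K f (x n) - grid_mean K f)| <= K%:R * b.
Proof.
move=> K0 f1 b0 cb; have K0' : (0 : R) < K%:R by rewrite ltr0n.
have pi1 : 1 <= 2 * pi :> R by have := pi_ge2 R; lra.
pose G (r j j' : nat) n : R := cos (2 * pi * (j%:R - j'%:R) * (x n - r%:R / K%:R)).
have E n : fejer_mean K f (x n) - grid_mean K f =
    (K%:R ^+ 2)^-1 * \sum_(0 <= r < K) \sum_(0 <= j < K) \sum_(0 <= j' < K)
      f (r%:R / K%:R) * ((j != j')%:R * G r j j' n).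
  rewrite /fejer_mean /grid_mean /fejer_weight !mulr_sumr -sumrB.
  rewrite !big_nat; apply: eq_bigr => r _.
  have -> : K%:R^-1 * f (r%:R / K%:R) = (K%:R ^+ 2)^-1 *
      (\sum_(0 <= j < K) \sum_(0 <= j' < K) (j == j')%:R) * f (r%:R / K%:R).
    have -> : \sum_(0 <= j < K) \sum_(0 <= j' < K) (j == j')%:R = K%:R :> R.
      transitivity (\sum_(0 <= j < K) 1 : R).
        rewrite big_nat [RHS]big_nat; apply: eq_bigr => j jK.
        rewrite (bigD1_seq j) ?mem_index_iota ?iota_uniq //= eqxx big1 ?addr0 //.
        by move=> j' /negbTE; rewrite eq_sym => ->.
      by rewrite sumr_const_nat subn0.
    by field; rewrite gt_eqF.
  rewrite -mulrBl -mulrBr -mulrA; congr (_ * _).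
  rewrite -sumrB mulr_suml; apply: eq_bigr => j _.
  rewrite -sumrB mulr_suml; apply: eq_bigr => j' _.
  rewrite /G mulrC; congr (_ * _).
  case: (eqVneq j j') => [->|_]; last by rewrite mul1r subr0.
  by rewrite subrr mulr0 mul0r cos0 subrr mul0r.
under eq_bigr do rewrite E.
have -> : \sum_(J1 <= n < J2) c n * ((K%:R ^+ 2)^-1 *
      \sum_(0 <= r < K) \sum_(0 <= j < K) \sum_(0 <= j' < K)
      f (r%:R / K%:R) * ((j != j')%:R * G r j j' n)) =
   (K%:R ^+ 2)^-1 * \sum_(0 <= r < K) \sum_(0 <= j < K) \sum_(0 <= j' < K)
      f (r%:R / K%:R) * ((j != j')%:R * \sum_(J1 <= n < J2) c n * G r j j' n).
  under eq_bigr do rewrite mulrCA.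
  rewrite -mulr_sumr; congr (_ * _).
  under eq_bigr do rewrite mulr_sumr.
  rewrite exchange_big /=; apply: eq_bigr => r _.
  under eq_bigr do rewrite mulr_sumr.
  rewrite exchange_big /=; apply: eq_bigr => j _.
  under eq_bigr do rewrite mulr_sumr.
  rewrite exchange_big /=; apply: eq_bigr => j' _.
  by rewrite !mulr_sumr; apply: eq_bigr => n _; ring.
rewrite normrM ger0_norm ?invr_ge0 ?exprn_ge0 ?(ltW K0') //.
have -> : K%:R * b = (K%:R ^+ 2)^-1 * (K%:R * (K%:R * (K%:R * b))).
  by field; rewrite gt_eqF.
rewrite ler_wpM2l ?invr_ge0 ?exprn_ge0 ?(ltW K0') //.
have bnd (F : nat -> R) (d : R) : (forall j, (j < K)%N -> `|F j| <= d) ->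
    `|\sum_(0 <= j < K) F j| <= K%:R * d.
  move=> Fd; apply: (le_trans (ler_norm_sum _ _ _)).
  rewrite mulr_natl -[X in _ *+ X]subn0 -sumr_const_nat.
  rewrite big_nat_cond [leRHS]big_nat_cond; apply: ler_sum => y.
  by rewrite andbT => /andP[_ yY]; exact: Fd.
apply: (bnd) => r rK; apply: (bnd) => j jK; apply: (bnd) => j' j'K.
rewrite normrM -[leRHS]mul1r; apply: ler_pM => //.
case: (eqVneq j j') => [_|jj']; first by rewrite mul0r normr0.
rewrite mul1r.
have bound (h h' : nat) (d : R) : d = h'%:R - h%:R -> (h < h')%N -> (h' < K)%N ->
    1 <= 2 * pi * d <= 2 * pi * K%:R.
  move=> dE hh' h'K; have pi0 : 0 <= 2 * pi :> R by exact: le_trans pi1.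
  have d1 : 1 <= d by rewrite dE -natrB ?ler1n ?subn_gt0 // ltnW.
  have dK : d <= K%:R.
    by rewrite dE -natrB ?ler_nat ?(leq_trans (leq_subr _ _)) // ltnW.
  by rewrite (le_trans pi1) ?ler_peMr //= ler_wpM2l.
case: (ltngtP j j') jj' => // h _.
  have := cb (2 * pi * (j'%:R - j%:R)) (- (2 * pi * (j'%:R - j%:R) * (r%:R / K%:R)))
    (bound _ _ _ erefl h j'K).
  congr (`|_| <= _); apply: eq_bigr => n _; congr (_ * _).
  by rewrite /G -cosN; congr cos; ring.
have := cb (2 * pi * (j%:R - j'%:R)) (- (2 * pi * (j%:R - j'%:R) * (r%:R / K%:R)))
  (bound _ _ _ erefl h jK).
congr (`|_| <= _); apply: eq_bigr => n _; congr (_ * _).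
by rewrite /G; congr cos; ring.
Qed.

(** * A periodic trapezoid *)

Definition clamp (R : realType) (x : R) : R := Num.max 0 (Num.min 1 x).

Lemma clamp_bounds (R : realType) (x : R) : 0 <= clamp x <= 1.
Proof. by rewrite le_max lexx /= ge_max ler01 /= ge_min lexx. Qed.

Lemma clamp1 (R : realType) (x : R) : 1 <= x -> clamp x = 1.
Proof. by move=> x1; rewrite /clamp min_l // max_r. Qed.

Lemma clamp0 (R : realType) (x : R) : x <= 0 -> clamp x = 0.
Proof.
move=> x0; have x1 : x <= 1 by exact: le_trans ler01.
by rewrite /clamp min_r // max_l.
Qed.

Lemma clamp_id (R : realType) (x : R) : 0 <= x <= 1 -> clamp x = x.
Proof. by move=> /andP[x0 x1]; rewrite /clamp min_r // max_r. Qed.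

Lemma clamp_lipschitz (R : realType) (x y : R) : `|clamp x - clamp y| <= `|x - y|.
Proof.
wlog xy : x y / x <= y.
  by move=> H; have [/H //|/ltW /H] := leP x y; rewrite distrC (distrC y).
rewrite distrC (distrC x) [leRHS]ger0_norm ?subr_ge0 //.
have cases (z : R) : [\/ z <= 0 /\ clamp z = 0, 0 <= z <= 1 /\ clamp z = z |
    1 <= z /\ clamp z = 1].
  have [z0|z0] := leP z 0; first by constructor 1; rewrite clamp0.
  have [z1|z1] := leP z 1; first by constructor 2; rewrite clamp_id (ltW z0).
  by constructor 3; rewrite clamp1 ltW.
rewrite ger0_norm.
  by case: (cases x) => [[h1 ->]|[/andP[h1 h2] ->]|[h1 ->]];
     case: (cases y) => [[h3 ->]|[/andP[h3 h4] ->]|[h3 ->]]; lra.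
by rewrite subr_ge0 /clamp ge_max !le_max lexx /= le_min !ge_min lexx xy !orbT.
Qed.

(** A trapezoid of period 1, equal to 1 where an integer lies in [[x, x + d]]
([arc_bump1]) and to 0 at distance at least [t] from these points ([arc_bump0]).  It is
built from [`|sin|] to be periodic and Lipschitz in the sense of
[fejer_approx]. *)
Definition arc_bump (R : realType) (d t x : R) : R :=
  clamp ((sin (pi * (d / 2 + t)) - `|sin (pi * (x + d / 2))|) /
         (sin (pi * (d / 2 + t)) - sin (pi * (d / 2)))).

Lemma norm_sin_dist (R : realType) (x y : R) :
  `| `|sin x| - `|sin y| | <= `|sin (x - y)|.
Proof.
suff H (a b : R) : `|sin a| - `|sin b| <= `|sin (a - b)|.
  have [h|h] := leP `|sin y| `|sin x|.
    by rewrite ger0_norm ?subr_ge0 //; exact: H.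
  by rewrite ltr0_norm ?subr_lt0 // opprB; have := H y x; rewrite -(opprB x y) sinN normrN.
have E : sin a = sin (a - b) * cos b + cos (a - b) * sin b by rewrite -sinD subrK.
rewrite lerBlDr {1}E; apply: (le_trans (ler_normD _ _)); rewrite !normrM; apply: lerD.
  by rewrite ler_piMr // cos_max.
by rewrite ler_piMl // cos_max.
Qed.

Lemma norm_sin_period (R : realType) (x : R) (m : nat) :
  `|sin (x + pi * m%:R)| = `|sin x|.
Proof.
elim: m => [|m IH]; first by rewrite mulr0 addr0.
rewrite -(natr1 m) mulrDr mulr1 addrA -IH.
by have := @sinDpi R (x + pi * m%:R); rewrite /alternating => ->; rewrite normrN.
Qed.

Lemma ler_sin (R : realType) (x y : R) : - (pi / 2) <= x -> x <= y -> y <= pi / 2 ->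
  sin x <= sin y.
Proof.
move=> x1 xy y1; rewrite leNgt ltr_sin ?in_itv /= -?leNgt //.
  by rewrite y1 (le_trans x1).
by rewrite x1 (le_trans xy).
Qed.

Lemma arc_gap (R : realType) (d t : R) :
  0 <= d -> 0 < t -> d / 2 + t <= 1 / 8 -> t <= sin (pi * (d / 2 + t)) - sin (pi * (d / 2)).
Proof.
move=> d0 t0 dt; have p0 := pi_gt0 R; have p2 := pi_ge2 R; have p4 := pihalf_lt2 R.
have [c cI ->] : exists2 c, c \in `[pi * (d / 2), pi * (d / 2 + t)]%R &
    sin (pi * (d / 2 + t)) - sin (pi * (d / 2)) =
    cos c * (pi * (d / 2 + t) - pi * (d / 2)).
  apply: (@MVT_segment R sin cos); first by rewrite ler_pM2l //; lra.
  by apply: continuous_subspaceT => z; exact: continuous_sin.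
move: cI; rewrite in_itv /= => /andP[c1 c2].
have c3 : c <= 1 / 2.
  apply: (le_trans c2); apply: (@le_trans _ _ (4 * (1 / 8))); last by lra.
  by apply: ler_pM => //; lra.
have c0 : 0 <= c by apply: le_trans c1; rewrite mulr_ge0 //; lra.
have := cos_lipschitz 0 c; rewrite cos0 sub0r normrN (ger0_norm c0) => h.
have h2 : 1 / 2 <= cos c by move: (ler_norm (1 - cos c)) h c3; clear; lra.
have -> : pi * (d / 2 + t) - pi * (d / 2) = pi * t by ring.
rewrite -[leLHS]mul1r mulrA ler_wpM2r ?(ltW t0) //.
by nra.
Qed.

Lemma arc_bump_bounds (R : realType) (d t x : R) : 0 <= arc_bump d t x <= 1.
Proof. exact: clamp_bounds. Qed.

Lemma arc_bump_lipschitz (R : realType) (d t x y : R) :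
  0 <= d -> 0 < t -> d / 2 + t <= 1 / 8 ->
  `|arc_bump d t x - arc_bump d t y| <= t^-1 * `|sin (pi * (x - y))|.
Proof.
move=> d0 t0 dt; have gap := arc_gap d0 t0 dt.
apply: (le_trans (clamp_lipschitz _ _)).
set s2 := sin (pi * (d / 2 + t)) in gap *; set s1 := sin (pi * (d / 2)) in gap *.
rewrite -mulrBl normrM mulrC; apply: ler_pM => //.
  rewrite normrV ?unitfE ?gt_eqF ?(lt_le_trans t0) // ger0_norm ?(le_trans (ltW t0)) //.
  by rewrite lef_pV2 ?posrE // (lt_le_trans t0).
rewrite (_ : s2 - _ - _ = `|sin (pi * (y + d / 2))| - `|sin (pi * (x + d / 2))|); last by ring.
rewrite distrC; apply: (le_trans (norm_sin_dist _ _)).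
by rewrite le_eqVlt; apply/orP; left; apply/eqP; congr (`|sin _|); ring.
Qed.

Lemma arc_bump1 (R : realType) (d t x : R) (m : nat) :
  0 <= d -> 0 < t -> d / 2 + t <= 1 / 8 -> x <= m%:R <= x + d -> arc_bump d t x = 1.
Proof.
move=> d0 t0 dt /andP[xm mx]; have gap := arc_gap d0 t0 dt.
have p0 := pi_gt0 R; have p0' := ltW p0.
apply: clamp1; rewrite ler_pdivlMr ?(lt_le_trans t0) // mul1r lerD2l lerN2.
have -> : pi * (x + d / 2) = pi * (d / 2 - (m%:R - x)) + pi * m%:R by ring.
rewrite norm_sin_period.
set v := m%:R - x; have v0 : 0 <= v by rewrite subr_ge0.
have vd : v <= d by rewrite lerBlDl.
have d8 : d / 2 <= 1 / 2 by move: dt t0; clear; lra.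
have key a : 0 <= a -> a <= d / 2 -> sin (pi * a) <= sin (pi * (d / 2)).
  move=> a0 ad; apply: ler_sin.
  - by rewrite (@le_trans _ _ 0) ?oppr_le0 ?mulr_ge0.
  - by rewrite ler_wpM2l.
  - by rewrite ler_wpM2l //; move: d8; clear; lra.
have sin0' a : 0 <= a -> a <= d / 2 -> 0 <= sin (pi * a).
  move=> a0 ad; apply: sin_ge0_pi; rewrite mulr_ge0 //= -[leRHS]mulr1 ler_wpM2l //.
  by move: ad d8; clear; lra.
have [h|h] := leP v (d / 2).
  by rewrite ger0_norm ?sin0' ?key //; move: h v0; clear; lra.
rewrite -normrN -sinN -mulrN opprB.
by rewrite ger0_norm ?sin0' ?key //; move: h vd; clear; lra.
Qed.

Lemma arc_bump0 (R : realType) (d t x : R) :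
  0 <= d -> 0 < t -> d / 2 + t <= 1 / 8 -> t <= x -> x <= 1 - d - t ->
  arc_bump d t x = 0.
Proof.
move=> d0 t0 dt tx xd; have gap := arc_gap d0 t0 dt.
have p0 := pi_gt0 R; have p0' := ltW p0.
apply: clamp0; rewrite pmulr_lle0 ?invr_gt0 ?(lt_le_trans t0) // subr_le0.
have key v : d / 2 + t <= v -> v <= 1 / 2 -> sin (pi * (d / 2 + t)) <= `|sin (pi * v)|.
  move=> h1 h2; apply: le_trans (ler_norm _); apply: ler_sin.
  - by rewrite (@le_trans _ _ 0) ?oppr_le0 ?mulr_ge0 //; move: d0 t0; clear; lra.
  - by rewrite ler_wpM2l.
  - by rewrite ler_wpM2l //; move: h2; clear; lra.
have [h|h] := leP (x + d / 2) (1 / 2).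
  by apply: key => //; move: tx; clear; lra.
rewrite -normrN -sinN -(norm_sin_period _ 1).
have -> : - (pi * (x + d / 2)) + pi * 1 = pi * (1 - x - d / 2) by ring.
by apply: key; move: h xd; clear; lra.
Qed.

(** Counting the points of the grid in an arc of length [d]: the slopes account for
the error [2 * t], the spacing of the grid for [2 / K]. *)
Lemma grid_mean_bounds (R : realType) (d t : R) (K : nat) : (0 < K)%N ->
  0 <= d -> 0 < t -> d / 2 + t <= 1 / 8 ->
  `|grid_mean K (arc_bump d t) - d| <= 2 * t + 2 / K%:R.
Proof.
move=> K0 d0 t0 dt; have K0' : (0 : R) < K%:R by rewrite ltr0n.
have K0'' := ltW K0'.
have d1 : 0 <= 1 - d - t by move: dt t0; clear; lra.
have up : \sum_(0 <= r < K) arc_bump d t (r%:R / K%:R) <= K%:R * (d + 2 * t) + 2.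
  pose a := (Num.truncn (K%:R * t)).+1; pose b := Num.truncn (K%:R * (1 - d - t)).
  apply: (@le_trans _ _ (\sum_(0 <= r < K) ((0 <= r < a)%N%:R + (b <= r < K)%N%:R))).
    rewrite big_nat [leRHS]big_nat; apply: ler_sum => r /= rK.
    have := arc_bump_bounds d t (r%:R / K%:R) => /andP[f0 f1].
    have [h1|h1] := leqP a r; last first.
      by rewrite (le_trans f1) // lerDl.
    have [h2|h2] := leqP b r; first by rewrite rK (le_trans f1) // lerDr.
    rewrite arc_bump0 ?addr_ge0 //.
      rewrite ler_pdivlMr // mulrC (le_trans _ (_ : a%:R <= _)) ?ler_nat //.
      by rewrite ltW // truncnS_gt.
    rewrite ler_pdivrMr // mulrC (le_trans (_ : _ <= b%:R)) //.
      by rewrite ler_nat ltnW.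
    by rewrite truncn_le // mulr_ge0.
  rewrite big_split /=.
  have h1 := sum_interval_le R 0 a K; have h2 := sum_interval_le R b K K.
  have a1 : (a - 0)%:R <= K%:R * t + 1 :> R.
    by rewrite subn0 /a -natr1 lerD2r truncn_le // mulr_ge0 // ltW.
  have b1 : (K - b)%:R <= K%:R * (d + t) + 1 :> R.
    have bK : (b <= K)%N.
      rewrite -(ler_nat R); apply: (@le_trans _ _ (K%:R * (1 - d - t))).
        by rewrite truncn_le // mulr_ge0.
      by rewrite -[leRHS]mulr1 ler_wpM2l //; move: d0 t0; clear; lra.
    rewrite natrB // lerBlDr.
    have : K%:R * (1 - d - t) < b.+1%:R by exact: truncnS_gt.
    by rewrite -natr1; move: (K%:R) => k; nra.
  by move: h1 h2 a1 b1; lra.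
have lo : K%:R * d - 1 <= \sum_(0 <= r < K) arc_bump d t (r%:R / K%:R).
  have d1' : 0 <= 1 - d by move: d1 t0; clear; lra.
  pose a := (Num.truncn (K%:R * (1 - d))).+1.
  apply: (@le_trans _ _ (\sum_(0 <= r < K) (a <= r < K)%N%:R * 1)).
    rewrite sum_indicator minnn sumr_const_nat.
    have : a%:R <= K%:R * (1 - d) + 1.
      by rewrite /a -natr1 lerD2r truncn_le // mulr_ge0.
    have : (K - a)%:R >= K%:R - a%:R :> R.
      by rewrite lerBlDr -natrD ler_nat addnC -leq_subLR.
    move: (K - a)%:R a%:R => p q; move: (K%:R) => k; lra.
  rewrite big_nat [leRHS]big_nat; apply: ler_sum => r /= rK.
  have := arc_bump_bounds d t (r%:R / K%:R) => /andP[f0 f1].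
  rewrite rK andbT mulr1; have [h1|h1] := leqP a r => //.
  rewrite (@arc_bump1 _ _ _ _ 1) //; apply/andP; split.
    by rewrite ler_pdivrMr // mul1r ler_nat ltnW.
  rewrite -lerBlDr ler_pdivlMr // mulrC (le_trans _ (_ : a%:R <= _)) ?ler_nat //.
  by rewrite ltW // truncnS_gt.
rewrite /grid_mean; set S := \sum_(0 <= r < K) _ in up lo *.
have -> : K%:R^-1 * S - d = (S - K%:R * d) / K%:R by field; rewrite gt_eqF.
rewrite normrM [`|_^-1|]ger0_norm ?invr_ge0 // ler_pdivrMr // mulrDl mulfVK ?gt_eqF //.
rewrite ler_norml; move: up lo; move: S (K%:R) K0'' => S k k0; nra.
Qed.

(** * Piatetski-Shapiro numbers in a short block *)

Definition ps_indicator (R : realType) (g : R) (n : nat) : R :=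
  \1_(piatetski_shapiro (1 / g)) n.

Lemma ps_indicator_bounds (R : realType) (g : R) n : 0 <= ps_indicator g n <= 1.
Proof. by rewrite /ps_indicator indicE; case: (_ \in _); rewrite ?lexx ?ler01. Qed.

Lemma ps_indicator_witness (R : realType) (g : R) n : 0 < g < 1 -> ps_indicator g n != 0 ->
  exists m : nat, n%:R `^ g <= m%:R < n.+1%:R `^ g.
Proof.
move=> /andP[g0 g1]; rewrite /ps_indicator indicE; case: (boolP (_ \in _)); last by rewrite eqxx.
rewrite inE => -[m /= m0 mn] _; exists m.
have x0 : 0 <= m%:R `^ (1 / g) :> R by exact: powR_ge0.
have := truncn_itv x0; rewrite mn => /andP[h1 h2].
have E : m%:R = (m%:R `^ (1 / g)) `^ g :> R.
  by rewrite -powRrM div1r mulVf ?gt_eqF // powRr1.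
rewrite E; apply/andP; split; first by rewrite ge0_ler_powR ?nnegrE // ltW.
by rewrite gt0_ltr_powR // nnegrE.
Qed.

Lemma ps_indicator_eq1 (R : realType) (g : R) (n m : nat) : 0 < g < 1 -> (0 < n)%N ->
  n%:R `^ g <= m%:R < n.+1%:R `^ g -> ps_indicator g n = 1.
Proof.
move=> /andP[g0 g1] n0 /andP[h1 h2]; rewrite /ps_indicator indicE mem_set //.
have m0 : (0 < m)%N.
  by rewrite -(ltr_nat R); apply: lt_le_trans h1; rewrite powR_gt0 // ltr0n.
exists m => //=.
have E (k : nat) : k%:R = (k%:R `^ g) `^ (1 / g) :> R.
  by rewrite -powRrM mulrC div1r mulVf ?gt_eqF // powRr1.
have gi : 0 < 1 / g by rewrite divr_gt0.
have k1 : n%:R <= m%:R `^ (1 / g) :> R.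
  by rewrite (E n) ge0_ler_powR ?nnegrE ?powR_ge0 // ltW.
have k2 : m%:R `^ (1 / g) < n.+1%:R :> R.
  by rewrite [X in _ < X](E n.+1) gt0_ltr_powR // nnegrE ?powR_ge0.
apply/eqP; rewrite eqn_leq -ltnS -!(ltr_nat R) -(ler_nat R).
rewrite (le_lt_trans _ k2) ?truncn_le ?powR_ge0 //=.
have : m%:R `^ (1 / g) < (Num.truncn (m%:R `^ (1 / g) : R)).+1%:R by exact: truncnS_gt.
move=> /(le_lt_trans k1); rewrite ltr_nat ltnS => h.
by rewrite ler_nat.
Qed.

(** The difference of the ceilings counts the integers in
[[n `^ g, n.+1 `^ g)], of which there is at most one.  This lower bound
telescopes. *)
Lemma ps_indicator_ge_ceil (R : realType) (g : R) (n : nat) : 0 < g < 1 -> (0 < n)%N ->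
  n.+1%:R `^ g - n%:R `^ g <= 1 ->
  (Num.ceil (n.+1%:R `^ g))%:~R - (Num.ceil (n%:R `^ g))%:~R <= ps_indicator g n.
Proof.
move=> g01 n0 gap; have /andP[i0 i1] := ps_indicator_bounds g n.
set x := n%:R `^ g in gap *; set y := n.+1%:R `^ g in gap *.
have x0 : 0 <= x by exact: powR_ge0.
have [h|h] := leP y (Num.ceil x)%:~R.
  rewrite (@le_trans _ _ 0) // subr_le0 ler_int.
  by rewrite ceil_le_int.
rewrite (@ps_indicator_eq1 R g n `|Num.ceil x|%N) //.
  rewrite lerBlDr -[1]/(1%:~R) -intrD ler_int ceil_le_int intrD.
  by rewrite -lerBlDl; move: gap (ceil_ge x); lra.
have -> : `|Num.ceil x|%N%:R = (Num.ceil x)%:~R :> R.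
  by rewrite natr_absz ger0_norm // ceil_ge0 // (lt_le_trans _ x0) // oppr_lt0.
by rewrite ceil_ge h.
Qed.

Lemma powR_step (R : realType) (r : R) (n h : nat) : (0 < n)%N ->
  exists2 xi : R, n%:R <= xi <= (n + h)%:R &
    (n + h)%:R `^ r - n%:R `^ r = r * h%:R * xi `^ (r - 1).
Proof.
move=> n0; have n0' : (0 : R) < n%:R by rewrite ltr0n.
have hh : all (fun p : nat * nat => (p.1%:R <= h%:R :> R) && (p.2%:R <= h%:R :> R)) [:: (h, 0)%N].
  by rewrite /= lexx ler0n.
have [xi xiI] := rcube_mvt r n0' hh.
rewrite /= big_ord1 big_seq1 /= !subr0 addr0 -natrD => E.
by exists xi => //; move: xiI; rewrite /= mul1r -natrD.
Qed.

(** On a block of length [Lb] that starts at [J], the gaps [n.+1 `^ g - n `^ g]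
decrease and differ by at most [Lb / J] from the first one and from the
derivative [g * n `^ (g - 1)]. *)
Lemma powR_gap_bounds (R : realType) (g : R) (J Lb n : nat) : 0 < g < 1 -> (0 < J)%N ->
  (J <= n < J + Lb)%N ->
  [/\ n.+1%:R `^ g - n%:R `^ g <= J.+1%:R `^ g - J%:R `^ g,
      J.+1%:R `^ g - J%:R `^ g - Lb%:R / J%:R <= n.+1%:R `^ g - n%:R `^ g,
      `|g * n%:R `^ (g - 1) - (J.+1%:R `^ g - J%:R `^ g)| <= Lb%:R / J%:R &
      0 <= J.+1%:R `^ g - J%:R `^ g <= J%:R `^ (g - 1) ].
Proof.
move=> /andP[g0 g1] J0 /andP[Jn nL]; have g0' := ltW g0.
have n0 : (0 < n)%N by exact: leq_trans Jn.
have g1' : g - 1 <= 0 by move: g1; clear; lra.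
have Jr0 : (0 : R) < J%:R by rewrite ltr0n.
have [x /andP[x1 x2]] := powR_step g 1 n0; rewrite addn1 mulr1 => Ex.
have [y /andP[y1 y2]] := powR_step g 1 J0; rewrite addn1 mulr1 => Ey.
have y0 : 0 < y by exact: lt_le_trans y1.
have x0 : 0 < x by apply: lt_le_trans x1; rewrite ltr0n.
have [w /andP[w1 w2] Ew] := powR_step (g - 1) Lb J0.
have w0 : 0 < w by exact: lt_le_trans w1.
pose a := g * J%:R `^ (g - 1); pose b := g * (J + Lb)%:R `^ (g - 1).
have in1 (v : R) : J%:R <= v -> v <= (J + Lb)%:R -> b <= g * v `^ (g - 1) <= a.
  move=> v1 v2; have v0 : 0 < v by exact: lt_le_trans v1.
  by rewrite /a /b !ler_wpM2l // ler_powRn.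
have ab : a - b <= Lb%:R / J%:R.
  have -> : a - b = g * ((1 - g) * Lb%:R * w `^ (g - 1 - 1)).
    by rewrite /a /b -mulrBr -opprB Ew; ring.
  have h1 : w `^ (g - 1 - 1) <= J%:R^-1.
    apply: (@le_trans _ _ (J%:R `^ (g - 1 - 1))).
      by rewrite ler_powRn //; move: g1; clear; lra.
    rewrite -(powR_inv1 (ltW Jr0)); apply: ler_powR; first by rewrite ler1n.
    by move: g1; clear; lra.
  have -> : g * ((1 - g) * Lb%:R * w `^ (g - 1 - 1)) =
    (g * (1 - g)) * (Lb%:R * w `^ (g - 1 - 1)) by ring.
  have gg : 0 <= g * (1 - g) <= 1 by move: g0 g1; clear; nra.
  have /andP[gg0 gg1] := gg.
  rewrite -[leRHS]mul1r; apply: ler_pM => //; first by rewrite mulr_ge0 ?powR_ge0.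
  by rewrite ler_wpM2l.
have /andP[xa xb] : b <= g * x `^ (g - 1) <= a.
  apply: in1; first by rewrite (le_trans _ x1) ?ler_nat.
  by rewrite (le_trans x2) // ler_nat; move: nL; clear; lia.
have /andP[ya yb] : b <= g * y `^ (g - 1) <= a.
  apply: in1 => //.
  by rewrite (le_trans y2) // ler_nat; move: Jn nL; clear; lia.
have /andP[na nb] : b <= g * n%:R `^ (g - 1) <= a.
  by apply: in1; rewrite ler_nat // ltnW.
rewrite Ex Ey; split.
- have [/eqP h|h] := boolP (n == J).
    by rewrite -Ex -Ey h.
  rewrite ler_wpM2l // ler_powRn // (le_trans y2) // (le_trans _ x1) // ler_nat.
  by move: Jn h; clear; lia.
- by move: xa yb ab; clear; lra.
- by rewrite ler_norml; move: na nb ya yb ab; clear; lra.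
- rewrite mulr_ge0 ?powR_ge0 //= (le_trans yb) // /a ler_piMl ?powR_ge0 // ltW //.
Qed.

(** With [d] the largest gap of the block, [arc_bump d t (n `^ g)] is at least
[ps_indicator g n].  The sum of their difference, hence of its absolute value, is
small: telescoping ceilings bound the sum of the indicator from below, and the
cosine sums [b1] bound that of the trapezoid from above, both by about [d] times
the length.  The trapezoid may then be replaced by its Fejer mean, whose
constant term is close to [d] and so to [g * n `^ (g - 1)], the inverse of the
weight; the other frequencies give the cosine sums [b2], after partial
summation in the increasing weight [n `^ (1 - g)]. *)
Lemma block_sum (R : realType) (g t C Y b1 b2 : R) (J1 J2 Lb K : nat) (c : nat -> R) :
  let d := J1.+1%:R `^ g - J1%:R `^ g in
  let E := 4 * t + 4 / K%:R + 2 * (Lb%:R / J1%:R) + 2 * (t^-1 / Num.sqrt K%:R) in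
  0 < g < 1 -> (0 < J1)%N -> (J1 <= J2)%N -> (J2 <= J1 + Lb)%N -> (0 < K)%N ->
  0 < t -> d / 2 + t <= 1 / 8 -> 0 <= C -> 0 <= Y -> 0 <= b1 -> 0 <= b2 ->
  (forall n, (J1 <= n < J2)%N -> `|c n| <= C /\ n%:R `^ (1 - g) <= Y) ->
  (forall y th : R, 1 <= y <= 2 * pi * K%:R ->
    `|\sum_(J1 <= n < J2) 1 * cos (y * n%:R `^ g + th)| <= b1) ->
  (forall j (y th : R), (J1 <= j < J2)%N -> 1 <= y <= 2 * pi * K%:R ->
    `|\sum_(j <= n < J2) c n * cos (y * n%:R `^ g + th)| <= b2) ->
  `|\sum_(J1 <= n < J2) c n * (n%:R `^ (1 - g) / g * ps_indicator g n - 1)| <=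
    C * Y / g * ((J2 - J1)%:R * E + K%:R * b1 + 1) + Y / g * (K%:R * b2).
Proof.
move=> d E g01 J10 J12 J2L K0 t0 dt C0 Y0 b10 b20 cC H1 H2.
have [g0 g1] := andP g01.
have [J12'|J12'] := ltnP J1 J2; last first.
  by rewrite big_geq // normr0 addr_ge0 // !mulr_ge0 ?invr_ge0 ?(ltW g0) //
    !addr_ge0 ?mulr_ge0 // !addr_ge0 ?mulr_ge0 ?invr_ge0 ?(ltW t0) // sqrtr_ge0.
have Jn n : (J1 <= n < J2)%N -> (J1 <= n < J1 + Lb)%N.
  by move=> /andP[-> h]; rewrite (leq_trans h).
have JJ : (J1 <= J1 < J2)%N by rewrite leqnn.
have [_ _ _ /andP[d0 d1]] := powR_gap_bounds g01 J10 (Jn _ JJ).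
rewrite -/d in d0 d1.
pose f := arc_bump d t.
pose P := fejer_mean K f; pose c0 := grid_mean K f.
pose err := t^-1 / Num.sqrt (K%:R : R).
pose rho : R := Lb%:R / J1%:R.
have f01 x : 0 <= f x <= 1 by exact: arc_bump_bounds.
have f1 x : `|f x| <= 1 by have /andP[h1 h2] := f01 x; rewrite ger0_norm.
have fP x : `|f x - P x| <= err.
  apply: fejer_approx => //; first by rewrite invr_ge0 ltW.
  by move=> u v; exact: arc_bump_lipschitz.
have c0d : `|c0 - d| <= 2 * t + 2 / K%:R by exact: grid_mean_bounds.
pose X n : R := n%:R `^ g.
have psf n : (J1 <= n < J2)%N -> ps_indicator g n <= f (X n).
  move=> nJ; have /andP[p0 p1] := ps_indicator_bounds g n.
  have /andP[f0 _] := f01 (X n).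
  have [->//|nz] := eqVneq (ps_indicator g n) 0.
  have [m /andP[m1 m2]] := ps_indicator_witness g01 nz.
  rewrite /f (@arc_bump1 _ _ _ _ m) // m1 /= -lerBlDl.
  have [h _ _ _] := powR_gap_bounds g01 J10 (Jn _ nJ).
  by apply: le_trans h; rewrite lerB // ltW.
have d_le1 : d <= 1 by move: dt t0; clear; lra.
have psum : (J2 - J1)%:R * (d - rho) - 1 <= \sum_(J1 <= n < J2) ps_indicator g n.
  have h1 : X J2 - X J1 - 1 <= \sum_(J1 <= n < J2) ps_indicator g n.
    apply: (@le_trans _ _ (\sum_(J1 <= n < J2)
      ((Num.ceil (X n.+1))%:~R - (Num.ceil (X n))%:~R))).
      rewrite (telescope_sumr (fun n => (Num.ceil (X n))%:~R : R)) //.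
      have := ceil_ge (X J2); have := ceil_itv (X J1) => /andP[+ _].
      by rewrite intrB; move: (X J1) (X J2) => x1 x2; lra.
    rewrite big_nat [leRHS]big_nat; apply: ler_sum => n nJ.
    apply: ps_indicator_ge_ceil => //; first by rewrite (leq_trans J10) //; case/andP: nJ.
    by have [h _ _ _] := powR_gap_bounds g01 J10 (Jn _ nJ); apply: le_trans h d_le1.
  apply: le_trans h1; rewrite lerD2r -(telescope_sumr X J12).
  rewrite mulr_natl -sumr_const_nat big_nat [leRHS]big_nat; apply: ler_sum => n nJ.
  by have [_ h _ _] := powR_gap_bounds g01 J10 (Jn _ nJ).
have Psum : `|\sum_(J1 <= n < J2) 1 * (P (X n) - c0)| <= K%:R * b1.
  exact: fejer_sum.
have E1 : \sum_(J1 <= n < J2) `|ps_indicator g n - f (X n)| <=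
    (J2 - J1)%:R * (2 * t + 2 / K%:R + rho + err) + K%:R * b1 + 1.
  have -> : \sum_(J1 <= n < J2) `|ps_indicator g n - f (X n)| =
      \sum_(J1 <= n < J2) (f (X n) - P (X n)) + \sum_(J1 <= n < J2) 1 * (P (X n) - c0)
      + (J2 - J1)%:R * c0 - \sum_(J1 <= n < J2) ps_indicator g n.
    rewrite mulr_natl -sumr_const_nat -!big_split /= -sumrB.
    rewrite big_nat [RHS]big_nat; apply: eq_bigr => n /psf h.
    by rewrite ler0_norm ?subr_le0 //; ring.
  have e1 : \sum_(J1 <= n < J2) (f (X n) - P (X n)) <= (J2 - J1)%:R * err.
    rewrite mulr_natl -sumr_const_nat; apply: ler_sum => n _.
    exact: le_trans (ler_norm _) (fP _).
  have e2 := le_trans (ler_norm _) Psum.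
  have e3 : (J2 - J1)%:R * c0 <= (J2 - J1)%:R * (d + 2 * t + 2 / K%:R) :> R.
    rewrite ler_wpM2l //; move: (le_trans (ler_norm _) c0d); lra.
  move: e1 e2 e3 psum.
  set u := \sum_(J1 <= n < J2) (f _ - _); set v := \sum_(J1 <= n < J2) 1 * _.
  set w := \sum_(J1 <= n < J2) ps_indicator g n.
  move: (J2 - J1)%:R => l; clear; nra.
pose w n : R := n%:R `^ (1 - g).
have n0 n : (J1 <= n < J2)%N -> (0 < n)%N.
  by move=> /andP[h _]; exact: leq_trans h.
have split_sum : \sum_(J1 <= n < J2) c n * (w n / g * ps_indicator g n - 1) =
    \sum_(J1 <= n < J2) c n * w n / g * ((ps_indicator g n - f (X n)) + (f (X n) - P (X n))
      + (c0 - g * n%:R `^ (g - 1))) +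
    g^-1 * \sum_(J1 <= n < J2) w n * (c n * (P (X n) - c0)).
  rewrite mulr_sumr -big_split /= big_nat [RHS]big_nat; apply: eq_bigr => n /n0 nn0.
  have ww : w n * n%:R `^ (g - 1) = 1.
    rewrite /w -powRD; last by rewrite pnatr_eq0 -lt0n nn0 implybT.
    by rewrite (_ : 1 - g + (g - 1) = 0) ?powRr0 //; ring.
  transitivity (c n * (w n / g * ps_indicator g n - w n * n%:R `^ (g - 1))); first by rewrite ww.
  by field; rewrite gt_eqF.
rewrite split_sum; apply: (le_trans (ler_normD _ _)); apply: lerD; last first.
  rewrite normrM ger0_norm ?invr_ge0 ?(ltW g0) // mulrAC mulrC.
  rewrite ler_wpM2r ?invr_ge0 ?(ltW g0) //; apply: abel_sum_le => //.
  - by rewrite mulr_ge0.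
  - by move=> n /cC [_ h]; rewrite powR_ge0.
  - move=> n J1n nJ2; rewrite /w ge0_ler_powR ?nnegrE ?ler_nat // subr_ge0 ltW //.
  - move=> j jJ; apply: fejer_sum => // y th yK; exact: H2.
pose B := C * Y / g; have B0 : 0 <= B by rewrite divr_ge0 ?mulr_ge0 ?(ltW g0).
apply: (@le_trans _ _ (\sum_(J1 <= n < J2)
   B * (`|ps_indicator g n - f (X n)| + (err + (2 * t + 2 / K%:R + rho))))).
  apply: (le_trans (ler_norm_sum _ _ _)).
  rewrite big_nat [leRHS]big_nat; apply: ler_sum => n nJ.
  have [cn wn] := cC n nJ.
  rewrite normrM; apply: ler_pM => //.
    rewrite !normrM [`|g^-1|]ger0_norm ?invr_ge0 ?(ltW g0) // /B.
    rewrite ler_wpM2r ?invr_ge0 ?(ltW g0) //; apply: ler_pM => //.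
    by rewrite ger0_norm // /w powR_ge0.
  apply: (le_trans (ler_normD _ _)); apply: (le_trans (lerD (ler_normD _ _) (lexx _))).
  rewrite -addrA; apply: lerD => //; apply: lerD => //.
  have [_ _ h _] := powR_gap_bounds g01 J10 (Jn _ nJ).
  rewrite -/d -/rho distrC in h.
  rewrite (_ : c0 - _ = (c0 - d) + (d - g * n%:R `^ (g - 1))); last by ring.
  by apply: (le_trans (ler_normD _ _)); apply: lerD.
rewrite -mulr_sumr ler_wpM2l // big_split /= sumr_const_nat -[X in _ + X]mulr_natl.
move: E1; rewrite /E -/rho -/err; move: (J2 - J1)%:R => l.
set S := \sum_(J1 <= n < J2) `|_|; move: S => S.
by clear; nra.
Qed.

(** * Correlation of the weights with dual functions *)

Lemma sum_blocks (R : realType) (F : nat -> R) (m : nat -> nat) (a b : nat) :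
  {homo m : i j / (i <= j)%N} -> (a <= b)%N ->
  \sum_(m a <= n < m b) F n = \sum_(a <= r < b) \sum_(m r <= n < m r.+1) F n.
Proof.
move=> mm ab; elim: b ab => [|b IH].
  by rewrite leqn0 => /eqP ->; rewrite !big_geq.
rewrite leq_eqVlt => /orP[/eqP <-|ab]; first by rewrite !big_geq.
by rewrite big_nat_recr //= -IH // -big_cat_nat //; apply: mm.
Qed.

(** The case of [type_one_sum] with [d = 1] and constant functions on the trivial
group. *)
Lemma plain_cos_sum (R : realType) (h q e : nat) :
  exists D : nat, forall g : R, 0 < g < 1 -> exists z0 : nat,
  forall (z N J1 J2 : nat) (y0 th : R),
  (z0 <= z)%N -> (z ^ D <= N)%N -> N%:R `^ (1 - g) <= 2 * z%:R ->
  (0 < N)%N -> (N <= J1 * z ^ h)%N -> (J2 <= N.+1)%N -> 1 <= y0 <= z%:R ^+ q ->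
  `|\sum_(J1 <= n < J2) 1 * cos (y0 * n%:R `^ g + th)| * z%:R ^+ e <= N%:R.
Proof.
have [D DP] := @type_one_sum R 1 1 q h 0 e isT isT.
exists D => g g01; have [z0 zP] := DP g g01; exists z0.
move=> z N J1 J2 y0 th zz zN Nz N0 NJ J2N y01.
pose W (c n : nat) (m : 'I_1) : R := 1.
have sysW : shift_system 1 (fun=> 1%N) (fun=> 0) W.
  by split => // c n m; rewrite normr1.
have := zP z N 1%N J1 J2 y0 th 'I_1 _ _ W zz zN Nz _ _ _ y01 sysW.
rewrite card_ord mulr1 expn0 !mul1n => H.
apply: le_trans (H _ _ _) => //; last by move: J2N N0; clear; lia.
rewrite ler_wpM2r ?exprn_ge0 //; rewrite le_eqVlt; apply/orP; left; apply/eqP; congr `|_|.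
apply: eq_bigr => n _; rewrite mul1n mul1r /dual_function big_ord_recl big_ord0.
by rewrite /W big_ord1 addr0 mulr1.
Qed.

(** The weights being at most [z ^+ 3] and the dual function at most [#|V|], the
integers below [N / z ^ (e + 4)] contribute little.  The others are covered by
blocks so short that [block_sum] applies with an error of relative size
[z ^- a] on each. *)
Lemma ps_prime_sum (R : realType) (s k e : nat) : (1 < s)%N -> (0 < k)%N ->
  exists D0 : nat, forall D : nat, (D0 <= D)%N -> forall g : R, 0 < g < 1 ->
  exists z0 : nat, forall (z N : nat) (V : finZmodType) uu ww (W : nat -> nat -> V -> R),
  (z0 <= z)%N -> (z ^ D <= N)%N -> (N < z.+1 ^ D)%N ->
  N%:R `^ (1 - g) <= 2 * z%:R -> ln N%:R <= z%:R :> R -> shift_system k uu ww W ->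
  `|\sum_(1 <= n < N.+1) (mangoldt_ps g n - mangoldt R n) * dual_function s W n|
     * z%:R ^+ e <= N%:R * #|V|%:R.
Proof.
move=> s1 k0; pose a := (e + 6)%N; pose f := (a + (e + 4))%N; pose h := (e + 5)%N.
pose kk := (2 * (a + a))%N; pose e' := (f + kk + e + 8)%N.
have [D1 coreP] := @mangoldt_cos_sum R s k kk.+1 h e' s1 k0.
have [D2 plainP] := @plain_cos_sum R h kk.+1 e'.
exists (D1 + D2 + 2 * f + e + 6)%N => D DD g g01.
have D1D : (D1 <= D)%N by move: DD; clear; lia.
have [za {}coreP] := coreP D D1D g g01; have [zb {}plainP] := plainP g g01.
have [g0 g1] := andP g01; have g0' := ltW g0.
have [n1 n1P] := exists_nat_ge (2 / g + 1).
have [n2 n2P] := exists_nat_ge (8 `^ (1 / (1 - g))).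
(* n1 bounds 2 / g + 1; n2 makes z `^ (g - 1) <= 1 / 8, so that the
   arcs are short. *)
exists (16 + za + zb + n1 + n2)%N.
move=> z N V uu ww W zz0 zN Npow Nz lnN sysW.
have z16 : (16 <= z)%N by apply: leq_trans zz0; rewrite -!addnA leq_addr.
have zza : (za <= z)%N by move: zz0; clear; lia.
have zzb : (zb <= z)%N by move: zz0; clear; lia.
have zn1 : (n1 <= z)%N by move: zz0; clear; lia.
have zn2 : (n2 <= z)%N by move: zz0; clear; lia.
have z0 : (0 < z)%N by exact: leq_trans z16.
have zr16 : (16 : R) <= z%:R by rewrite ler_nat.
have zr0 : (0 : R) < z%:R by rewrite ltr0n.
have zr0' := ltW zr0.
have zr1 : (1 : R) <= z%:R by rewrite ler1n.
have zg : 2 / g + 1 <= z%:R by rewrite (le_trans n1P) // ler_nat.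
have N0 : (0 < N)%N by apply: leq_trans zN; rewrite expn_gt0 z0.
have Nr0 : (0 : R) < N%:R by rewrite ltr0n.
pose L := (N %/ z ^ f)%N.
have zf0 : (0 < z ^ f)%N by rewrite expn_gt0 z0.
have zpN m : (m <= D)%N -> (z ^ m <= N)%N.
  by move=> mD; apply: leq_trans zN; rewrite leq_pexp2l.
have Lf : (z ^ f <= L)%N.
  by rewrite leq_divRL // -expnD addnn -mul2n; apply: zpN; move: DD; clear; lia.
have L0 : (0 < L)%N by exact: leq_trans Lf.
have LN : (L * z ^ f <= N)%N by exact: leq_divM.
pose m r := minn (r * L) N.+1.
have mm : {homo m : i j / (i <= j)%N}.
  by move=> i j ij; rewrite /m leq_min geq_minr andbT (leq_trans (geq_minl _ _)) // leq_mul2r ij orbT.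
(* The r-th block starts at r * L; those before r0 are estimated trivially. *)
pose r0 := (z ^ a)%N; pose r1 := (z ^ f).+1.
have r01 : (r0 <= r1)%N by rewrite /r0 /r1 leqW // leq_pexp2l // leq_addr.
have mr1 : m r1 = N.+1.
  rewrite /m /r1; apply/minn_idPr; rewrite mulSn.
  have := ltn_ceil N zf0; rewrite -/L mulSn mulnC => h1.
  by apply: (leq_trans h1); rewrite leq_add2r.
have mr0 : m r0 = (r0 * L)%N.
  rewrite /m; apply/minn_idPl; apply: leqW; apply: leq_trans LN.
  by rewrite mulnC leq_mul2l leq_pexp2l ?orbT // leq_addr.
pose Q : R := #|V|%:R.
have Q0 : 0 <= Q by exact: ler0n.
pose F n := (mangoldt_ps g n - mangoldt R n) * dual_function s W n.
pose c n := mangoldt R n * dual_function s W n.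
have FE n : F n = c n * (n%:R `^ (1 - g) / g * ps_indicator g n - 1).
  by rewrite /F /c /mangoldt_ps -/(ps_indicator g n); ring.
have cb n : (0 < n <= N)%N -> `|c n| <= z%:R * Q /\ n%:R `^ (1 - g) <= 2 * z%:R.
  move=> /andP[n0 nN]; split.
    rewrite normrM; apply: ler_pM => //; last exact: dual_function_le sysW.
    rewrite ger0_norm ?mangoldt_ge0 // (le_trans (mangoldt_le_ln R n0)) //.
    by rewrite (le_trans _ lnN) // ler_ln ?posrE ?ltr0n // ler_nat.
  apply: le_trans Nz; rewrite ge0_ler_powR ?nnegrE ?ler_nat //.
  by move: g1; clear; lra.
have -> : \sum_(1 <= n < N.+1) (mangoldt_ps g n - mangoldt R n) * dual_function s W n =
    \sum_(1 <= n < m r0) F n + \sum_(r0 <= r < r1) \sum_(m r <= n < m r.+1) F n.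
  rewrite -sum_blocks // mr1 -big_cat_nat //=.
    by rewrite mr0 muln_gt0 expn_gt0 z0 L0.
  by rewrite -mr1; exact: mm.
have small : `|\sum_(1 <= n < m r0) F n| <= N%:R * Q / z%:R ^+ e.+1.
  have Fb n : (1 <= n < m r0)%N -> `|F n| <= z%:R ^+ 3 * Q.
    move=> /andP[n0 nm]; have nN : (0 < n <= N)%N.
      by rewrite n0 /= -ltnS (leq_trans nm) // /m geq_minr.
    have [c1 c2] := cb n nN; have /andP[p0 p1] := ps_indicator_bounds g n.
    rewrite FE normrM (_ : z%:R ^+ 3 * Q = (z%:R * Q) * (z%:R ^+ 2)); last by ring.
    apply: ler_pM => //; apply: (le_trans (ler_normB _ _)); rewrite normr1.
    rewrite ger0_norm ?mulr_ge0 ?invr_ge0 ?powR_ge0 //.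
    apply: (@le_trans _ _ (2 * z%:R / g * 1 + 1)).
      by rewrite lerD2r ler_pM ?mulr_ge0 ?invr_ge0 ?powR_ge0 // ler_wpM2r // invr_ge0.
    have -> : 2 * z%:R / g * 1 + 1 = z%:R * (2 / g + 1) - (z%:R - 1) by ring.
    rewrite expr2; apply: (@le_trans _ _ (z%:R * (2 / g + 1))); last by rewrite ler_wpM2l.
    by rewrite lerBlDr lerDl subr_ge0.
  apply: (le_trans (ler_norm_sum_range Fb)).
  apply: (@le_trans _ _ ((r0 * L)%:R * (z%:R ^+ 3 * Q))).
    by rewrite ler_wpM2r ?mulr_ge0 ?exprn_ge0 // ler_nat mr0 leq_subr.
  rewrite mulrA [N%:R * Q / _]mulrAC ler_wpM2r // ler_pdivlMr ?exprn_gt0 //.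
  rewrite -mulrA -exprD -natrX -natrM ler_nat; apply: leq_trans LN.
  have -> : (3 + e.+1 = e + 4)%N by clear; lia.
  have -> : (z ^ f = z ^ a * z ^ (e + 4))%N by rewrite /f expnD.
  by rewrite /r0; apply/eq_leq; ring.
have blocks : `|\sum_(r0 <= r < r1) \sum_(m r <= n < m r.+1) F n| <= 4 * (N%:R * Q / z%:R ^+ e.+1).
  (* kk = 4 a balances the Fejer error t^-1 / Num.sqrt K against t. *)
  pose K := (z ^ kk)%N; pose t : R := (z%:R ^+ a)^-1.
  pose b1 : R := N%:R / z%:R ^+ e'; pose b2 : R := N%:R * Q / z%:R ^+ e'.
  pose G : R := z%:R ^+ kk * b1.
  have b10 : 0 <= b1 by rewrite divr_ge0 ?exprn_ge0.
  have b20 : 0 <= b2 by rewrite divr_ge0 ?mulr_ge0 ?exprn_ge0.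
  have G0 : 0 <= G by rewrite mulr_ge0 ?exprn_ge0.
  have za0 : 0 < z%:R ^+ a :> R by rewrite exprn_gt0.
  have t0 : 0 < t by rewrite invr_gt0.
  have zza' : (z <= z ^ a)%N by rewrite -{1}[z]expn1 leq_pexp2l // /a; clear; lia.
  have t16 : t <= 1 / 16.
    rewrite /t div1r lef_pV2 ?posrE // (le_trans zr16) // -natrX ler_nat //.
  have zg8 : z%:R `^ (g - 1) <= 1 / 8 :> R.
    rewrite -[g - 1]opprB powRN div1r lef_pV2 ?posrE ?powR_gt0 //.
    have g1' : 0 < 1 - g by move: g1; clear; lra.
    have -> : (8 : R) = (8 `^ (1 / (1 - g))) `^ (1 - g).
      by rewrite -powRrM div1r mulVf ?gt_eqF // powRr1.
    rewrite ge0_ler_powR ?nnegrE ?powR_ge0 // ?(ltW g1') //.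
    by rewrite (le_trans n2P) // ler_nat.
  have K0 : (0 < K)%N by rewrite expn_gt0 z0.
  have sqK : Num.sqrt (K%:R : R) = z%:R ^+ (a + a).
    by rewrite /K natrX /kk mulnC exprM sqrtr_sqr ger0_norm ?exprn_ge0.
  have piK : 2 * pi * K%:R <= z%:R ^+ kk.+1 :> R.
    rewrite /K natrX exprS ler_wpM2r ?exprn_ge0 //; have := pihalf_lt2 R.
    by move: zr16; clear; lra.
  have gz : 2 / g <= z%:R by move: zg; clear; lra.
  pose l r : R := (m r.+1 - m r)%:R.
  have block r : (r0 <= r < r1)%N -> `|\sum_(m r <= n < m r.+1) F n| <=
      z%:R ^+ 3 * Q * (l r * (12 / z%:R ^+ a) + 2 * G + 1).
    move=> /andP[r0r rr1].
    have mrL : (r0 * L <= m r)%N by rewrite -mr0; exact: mm.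
    have zm : (z <= m r)%N.
      by apply: leq_trans mrL; rewrite (leq_trans zza') // leq_pmulr.
    have m0 : (0 < m r)%N by exact: leq_trans zm.
    have mN r' : (m r' <= N.+1)%N by rewrite /m geq_minr.
    have NJ j : (m r <= j)%N -> (N <= j * z ^ h)%N.
      move=> mj; apply: (@leq_trans (r0 * L * z ^ h)); last first.
        by rewrite leq_mul2r (leq_trans mrL) ?orbT.
      have zhE : (z ^ h = z ^ (e + 4) * z)%N by rewrite -expnSr /h -addnS.
      have zfE : (z ^ f = z ^ a * z ^ (e + 4))%N by rewrite /f expnD.
      have -> : (r0 * L * z ^ h = L * z ^ f * z)%N by rewrite /r0 zhE zfE; ring.
      have := ltn_ceil N zf0; rewrite -/L mulSn => h1; apply: (leq_trans (ltnW h1)).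
      apply: (@leq_trans (L * z ^ f * 2)); last by rewrite leq_mul2l (leq_trans _ z16) ?orbT.
      by rewrite muln2 -addnn leq_add2r leq_pmull.
    under eq_bigr do rewrite FE.
    have d8 : ((m r).+1%:R `^ g - (m r)%:R `^ g) / 2 + t <= 1 / 8.
      have mm1 : (m r <= m r < m r + 1)%N by rewrite leqnn addn1 ltnS leqnn.
      have [_ _ _ /andP[_ h1]] := powR_gap_bounds g01 m0 mm1.
      have h2 : (m r)%:R `^ (g - 1) <= z%:R `^ (g - 1) :> R.
        by rewrite ler_powRn ?ler_nat //; move: g1; clear; lra.
      by move: h1 h2 zg8 t16; clear; lra.
    have zQ0 : 0 <= z%:R * Q by rewrite mulr_ge0.
    have zz2 : 0 <= 2 * z%:R :> R by rewrite mulr_ge0.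
    have := @block_sum R g t (z%:R * Q) (2 * z%:R) b1 b2 (m r) (m r.+1) L K c.
    move=> B; apply: (le_trans (B _ _ _ _ _ _ _ _ _ _ _ _ _ _)) => //.
    - exact: mm.
    - by rewrite /m mulSn; move: (r * L)%N => x; clear; lia.
    - move=> n /andP[n1' n2']; apply: cb; rewrite (leq_trans m0) //=.
      by rewrite -ltnS (leq_trans n2').
    - move=> y th /andP[y1 yK]; rewrite /b1 ler_pdivlMr ?exprn_gt0 //.
      apply: plainP => //; [|exact: NJ|by rewrite y1 (le_trans yK)].
      by apply: zpN; move: DD; clear; lia.
    - move=> j y th /andP[mj jm] /andP[y1 yK]; rewrite /b2 ler_pdivlMr ?exprn_gt0 //.
      rewrite (eq_bigr (fun n => mangoldt R n * (cos (y * n%:R `^ g + th) * dual_function s W n))); last first.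
        by move=> n _; rewrite /c; ring.
      apply: (coreP z N j (m r.+1) y th V uu ww W) => //; first exact: NJ.
      by rewrite y1 (le_trans yK).
    have Eb : 4 * t + 4 / K%:R + 2 * (L%:R / (m r)%:R) + 2 * (t^-1 / Num.sqrt K%:R)
        <= 12 / z%:R ^+ a.
      have e1 : 4 / K%:R <= 4 / z%:R ^+ a :> R.
        rewrite ler_wpM2l // lef_pV2 ?posrE ?ltr0n // /K natrX ler_weXn2l //.
        by rewrite /kk; clear; lia.
      have e2 : L%:R / (m r)%:R <= 1 / z%:R ^+ a :> R.
        rewrite ler_pdivrMr ?ltr0n // mulrAC mul1r ler_pdivlMr // -natrX -natrM ler_nat.
        by rewrite mulnC.
      have e3 : t^-1 / Num.sqrt K%:R = 1 / z%:R ^+ a.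
        by rewrite sqK /t invrK exprD; field; rewrite gt_eqF.
      rewrite e3; move: e1 e2; rewrite /t; move: (z%:R ^+ a)^-1 => v; lra.
    rewrite -/(l r).
    have Y1 : z%:R * Q * (2 * z%:R) / g <= z%:R ^+ 3 * Q.
      have -> : z%:R * Q * (2 * z%:R) / g = z%:R ^+ 2 * Q * (2 / g) by ring.
      have -> : z%:R ^+ 3 * Q = z%:R ^+ 2 * Q * z%:R by ring.
      by rewrite ler_wpM2l ?mulr_ge0 ?exprn_ge0.
    have Y2 : 2 * z%:R / g * (K%:R * b2) <= z%:R ^+ 3 * Q * G.
      have -> : 2 * z%:R / g * (K%:R * b2) = z%:R * Q * G * (2 / g).
        by rewrite /K natrX /b2 /G /b1; ring.
      have -> : z%:R ^+ 3 * Q * G = z%:R * Q * G * (z%:R ^+ 2) by ring.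
      rewrite ler_wpM2l ?mulr_ge0 // (le_trans gz) // expr2 ler_peMl //.
    have KG : K%:R * b1 = G by rewrite /K natrX.
    apply: (@le_trans _ _ (z%:R ^+ 3 * Q * (l r * (12 / z%:R ^+ a) + G + 1) +
      z%:R ^+ 3 * Q * G)); last first.
      by rewrite le_eqVlt; apply/orP; left; apply/eqP; ring.
    apply: lerD => //; rewrite KG; apply: ler_pM => //.
    - by rewrite !mulr_ge0 ?invr_ge0.
    - by rewrite !addr_ge0 ?mulr_ge0 // !addr_ge0 ?mulr_ge0 ?invr_ge0 ?(ltW t0) // sqrtr_ge0.
    - by rewrite !lerD2r ler_wpM2l.
  apply: (le_trans (ler_norm_sum _ _ _)).
  apply: (@le_trans _ _ (\sum_(r0 <= r < r1)
      z%:R ^+ 3 * Q * (l r * (12 / z%:R ^+ a) + 2 * G + 1))).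
    by rewrite big_nat [leRHS]big_nat; apply: ler_sum => r; exact: block.
  rewrite -mulr_sumr.
  have -> : \sum_(r0 <= r < r1) (l r * (12 / z%:R ^+ a) + 2 * G + 1) =
      (N.+1 - r0 * L)%:R * (12 / z%:R ^+ a) + (r1 - r0)%:R * (2 * G + 1).
    under eq_bigr do rewrite -addrA.
    rewrite big_split /= sumr_const_nat -[X in _ + X = _]mulr_natl; congr (_ + _).
    rewrite -mulr_suml; congr (_ * _); rewrite /l -natr_sum -mr0 -mr1.
    by rewrite telescope_sumn.
  have lN : (N.+1 - r0 * L)%:R <= N%:R :> R.
    rewrite ler_nat leq_subLR -addn1 addnC leq_add2r muln_gt0 L0 andbT.
    by rewrite expn_gt0 z0.
  have rr : (r1 - r0)%:R <= 2 * z%:R ^+ f :> R.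
    rewrite -natrX -[2]/(2%:R) -natrM ler_nat (leq_trans (leq_subr _ _)) // /r1.
    by move: zf0; clear; lia.
  have zz16 : z%:R ^+ 2 >= 12 :> R by move: zr16; clear; nra.
  have ze1 : 0 < z%:R ^+ e.+1 :> R by rewrite exprn_gt0.
  have i1 : z%:R ^+ 3 * (N%:R * (12 / z%:R ^+ a)) <= N%:R / z%:R ^+ e.+1 :> R.
    have -> : z%:R ^+ 3 * (N%:R * (12 / z%:R ^+ a)) =
        N%:R / z%:R ^+ e.+1 * (12 / z%:R ^+ 2) :> R.
      rewrite /a (_ : e + 6 = e.+1 + 5)%N; last by clear; lia.
      by rewrite exprD; field; rewrite !expf_neq0 ?gt_eqF.
    by rewrite ler_piMr ?divr_ge0 ?exprn_ge0 // ler_pdivrMr ?exprn_gt0 // mul1r.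
  have i2 : z%:R ^+ 3 * (2 * z%:R ^+ f * (2 * G)) <= N%:R / z%:R ^+ e.+1.
    have -> : z%:R ^+ 3 * (2 * z%:R ^+ f * (2 * G)) =
        N%:R / z%:R ^+ e.+1 * (4 / z%:R ^+ 4).
      rewrite /G /b1 /e' (_ : f + kk + e + 8 = f + kk + e.+1 + 7)%N; last by clear; lia.
      by rewrite !exprD; field; rewrite !expf_neq0 ?gt_eqF.
    rewrite ler_piMr ?divr_ge0 ?exprn_ge0 // ler_pdivrMr ?exprn_gt0 // mul1r.
    by move: zz16; move: (z%:R : R) => v; clear; nra.
  have i3 : z%:R ^+ 3 * (2 * z%:R ^+ f) <= N%:R / z%:R ^+ e.+1 :> R.
    rewrite ler_pdivlMr //; apply: (@le_trans _ _ (z%:R ^+ (f + e + 5))).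
      have -> : z%:R ^+ 3 * (2 * z%:R ^+ f) * z%:R ^+ e.+1 = z%:R ^+ (f + e + 4) * 2 :> R.
        by rewrite !exprD (exprS _ e); ring.
      rewrite [leRHS](_ : _ = z%:R ^+ (f + e + 4) * z%:R); last first.
        by rewrite -exprSr -addnS.
      by rewrite ler_wpM2l ?exprn_ge0 //; move: zr16; clear; lra.
    by rewrite -natrX ler_nat; apply: zpN; move: DD; clear; lia.
  apply: (@le_trans _ _ (z%:R ^+ 3 * Q * (N%:R * (12 / z%:R ^+ a) +
      2 * z%:R ^+ f * (2 * G + 1)))).
    rewrite ler_wpM2l ?mulr_ge0 ?exprn_ge0 //; apply: lerD.
      by rewrite ler_wpM2r // divr_ge0 ?exprn_ge0.
    by rewrite ler_wpM2r // addr_ge0 // mulr_ge0.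
  have -> : z%:R ^+ 3 * Q * (N%:R * (12 / z%:R ^+ a) + 2 * z%:R ^+ f * (2 * G + 1)) =
     Q * (z%:R ^+ 3 * (N%:R * (12 / z%:R ^+ a)) + z%:R ^+ 3 * (2 * z%:R ^+ f * (2 * G)) +
       z%:R ^+ 3 * (2 * z%:R ^+ f)) by ring.
  have -> : 4 * (N%:R * Q / z%:R ^+ e.+1) = Q * (4 * (N%:R / z%:R ^+ e.+1)) by ring.
  rewrite ler_wpM2l //.
  have i0 : 0 <= N%:R / z%:R ^+ e.+1 :> R by rewrite divr_ge0 ?exprn_ge0.
  by move: i0 i1 i2 i3; clear; lra.
have ze0 : 0 < z%:R ^+ e :> R by rewrite exprn_gt0.
rewrite -ler_pdivlMr //. apply: (le_trans (ler_normD _ _)).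
apply: (le_trans (lerD small blocks)).
have -> : N%:R * Q / z%:R ^+ e.+1 + 4 * (N%:R * Q / z%:R ^+ e.+1) =
  N%:R * Q / z%:R ^+ e * (5 / z%:R) by rewrite exprS; field; rewrite !gt_eqF.
rewrite ler_piMr ?divr_ge0 ?mulr_ge0 ?exprn_ge0 // ler_pdivrMr // mul1r.
by move: zr16; clear; lra.
Qed.

(** * Progressions in a cyclic group *)

Definition cyc_lift (R : realType) (M N : nat) (f : nat -> R) (x : 'I_M.+1) : R :=
  (0 < x <= N)%N%:R * f x.

(** Progressions of common difference [1 <= m <= N] in the cyclic group of order
[M.+1], the [i]-th term weighted by [G i]. *)
Definition cyc_sum (R : realType) (M N k : nat) (G : nat -> 'I_M.+1 -> R) : R :=
  \sum_x \sum_(m : 'I_M.+1) (0 < m <= N)%N%:R * \prod_(i < k) G i (x + m *+ i).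

Lemma inZpD (p a b : nat) : inZp (a + b) = inZp a + inZp b :> 'I_p.+1.
Proof. by apply: val_inj; rewrite /= modnDm. Qed.

Lemma inZpMn (p a n : nat) : inZp (a * n) = inZp a *+ n :> 'I_p.+1.
Proof.
elim: n => [|n IH]; first by rewrite muln0 mulr0n; apply: val_inj; rewrite /= mod0n.
by rewrite mulnS inZpD IH mulrS.
Qed.

Lemma sum_ord_interval (R : realType) (M N : nat) (F : nat -> R) : (N <= M)%N ->
  \sum_(x : 'I_M.+1) (0 < x <= N)%N%:R * F x = \sum_(1 <= n < N.+1) F n.
Proof.
move=> NM; rewrite -(big_mkord predT (fun x => (0 < x <= N)%N%:R * F x)).
rewrite (eq_bigr (fun x => (1 <= x < N.+1)%N%:R * F x)) // sum_indicator.
by rewrite (minn_idPl _) // ltnS.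
Qed.

(** The terms of a progression with [n, m <= N] are at most [k * N], so reduction
modulo [(k * N).+1] does not change them; if the last one exceeds [N], the
product vanishes because the lift of [f] is 0 there. *)
Lemma ap_sum_cyclic (R : realType) (k : nat) (f : nat -> R) (X : R) :
  (0 < k)%N -> 0 <= X -> let N := Num.truncn X in
  ap_sum k f X = @cyc_sum R (k * N) N k (fun _ => cyc_lift N f).
Proof.
move=> k0 X0 N; rewrite /ap_sum -/N /cyc_sum.
have NM : (N <= k * N)%N by rewrite leq_pmull.
pose P (n m : nat) := \prod_(i < k)
  cyc_lift N f (inZp n + inZp m *+ i : 'I_(k * N).+1).
transitivity (\sum_(x : 'I_(k * N).+1) (0 < x <= N)%N%:R *
  \sum_(m : 'I_(k * N).+1) (0 < m <= N)%N%:R * P x m); last first.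
  apply: eq_bigr => x _; rewrite mulr_sumr; apply: eq_bigr => m _.
  rewrite /P !valZpK; case: (boolP (0 < x <= N)%N) => xN; first by rewrite mul1r.
  rewrite mul0r (bigD1 (Ordinal k0)) //= mulr0n addr0 /cyc_lift (negbTE xN).
  by rewrite !mul0r mulr0.
rewrite (sum_ord_interval (fun x => \sum_(m : 'I_(k * N).+1) (0 < m <= N)%N%:R * P x m)) //.
rewrite !big_nat; apply: eq_bigr => n /andP[n0 nN].
rewrite (sum_ord_interval (P n)) // big_mkcond /= !big_nat; apply: eq_bigr => m /andP[m0 mN].
have val_nm i : (i < k)%N -> val (inZp n + inZp m *+ i : 'I_(k * N).+1) = (n + i * m)%N.
  move=> ik; rewrite -inZpMn -inZpD /= modn_small 1?mulnC // ltnS.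
  have : (i * m <= (k - 1) * N)%N by rewrite leq_mul //; move: ik; clear; lia.
  rewrite mulnBl mul1n; move: nN NM; clear; lia.
rewrite -truncn_ge_nat // -/N; case: ifP => h.
  rewrite big_mkord; apply: eq_bigr => i _.
  rewrite /cyc_lift val_nm // addn_gt0 n0 /= (leq_trans _ h) ?mul1r //.
  by rewrite leq_add2l leq_mul2r; apply/orP; right; move: (ltn_ord i); clear; lia.
rewrite /P; have k1 : (k - 1 < k)%N by move: k0; clear; lia.
(* Here N < n + (k - 1) * m, so the last factor vanishes. *)
rewrite (bigD1 (Ordinal k1)) //= {1}/cyc_lift val_nm //= h andbF.
by rewrite !mul0r.
Qed.

Lemma telescope_prod (R : comPzRingType) (k : nat) (A B : nat -> R) :
  \prod_(i < k) A i - \prod_(i < k) B i = \sum_(j < k) \prod_(i < k)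
    (if (i < j)%N then A i else if i == j :> nat then A i - B i else B i).
Proof.
elim: k => [|k IH]; first by rewrite !big_ord0 subrr.
rewrite !big_ord_recr /=.
have -> : \prod_(i < k) A i * A k - \prod_(i < k) B i * B k =
  (\prod_(i < k) A i - \prod_(i < k) B i) * B k + \prod_(i < k) A i * (A k - B k).
  by ring.
rewrite IH mulr_suml; congr (_ + _).
  apply: eq_bigr => j _; rewrite big_ord_recr /=; congr (_ * _).
  by rewrite ltnNge (ltnW (ltn_ord j)) /= gtn_eqF.
rewrite ltnn eqxx; congr (_ * _); apply: eq_bigr => i _.
by rewrite ltn_ord.
Qed.

Lemma shift_lt_cancel (V : zmodType) (t a m : V) (c j : nat) : (c < j)%N ->
  t + a *+ (j - c) - (m + a) *+ j + (m + a) *+ c = t - m *+ j + m *+ c.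
Proof.
move=> cj; rewrite !mulrnDl -{3}(subnK (ltnW cj)) [a *+ (_ + _)]mulrnDr.
move: (a *+ (j - c)) (a *+ c) (m *+ j) (m *+ c) => D C P Q.
by rewrite !opprD !addrA [t + D - P]addrAC addrK [_ + Q + C]addrAC subrK.
Qed.

Lemma shift_gt_cancel (V : zmodType) (t a m : V) (c j : nat) : (j < c)%N ->
  t + a *+ (c - j) - (m - a) *+ j + (m - a) *+ c = t - m *+ j + m *+ c.
Proof.
move=> jc; rewrite !mulrnBl -{3}(subnK (ltnW jc)) [a *+ (_ + _)]mulrnDr.
move: (a *+ (c - j)) (a *+ j) (m *+ j) (m *+ c) => D C P Q.
rewrite opprB opprD !addrA.
by rewrite [_ + C - P]addrAC [_ + C + Q]addrAC [_ + C - D]addrAC addrK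
  [t + D - P]addrAC [_ + D + Q]addrAC addrK.
Qed.

(** Translating [x] by [- m *+ j] puts the [j]-th term at [n] and the [c]-th one at
[n + (c - j) m], which does not change when [n] moves by [`|c - j|] and [m] by 1
with the opposite sign to [c - j].  The vacant slot [c = j] receives the cut-off
[1 <= m <= N], invariant under moves of [n] alone. *)
Lemma cyc_sum_dual (R : realType) (M N k j : nat) (h : nat -> nat -> R) (B : R) :
  (j < k)%N -> (N <= M)%N -> 0 < B ->
  (forall i n, i != j -> (0 < n <= N)%N -> `|h i n| <= B) ->
  exists u w (W : nat -> nat -> 'I_M.+1 -> R), shift_system k u w W /\
    cyc_sum N k (fun i => @cyc_lift R M N (h i)) =
    B ^+ (k - 1) * \sum_(1 <= n < N.+1) h j n * dual_function k W n.
Proof.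
move=> jk NM B0 hB.
pose one : 'I_M.+1 := inZp 1.
have inZpE n : inZp n = one *+ n :> 'I_M.+1 by rewrite -inZpMn mul1n.
pose T c (n : nat) (m : 'I_M.+1) : 'I_M.+1 := inZp n - m *+ j + m *+ c.
pose free c := (c == j) || (k <= c)%N.
(* In truncated subtraction, (c - j) + (j - c) is the distance of c and j. *)
pose u c := if free c then 1%N else ((c - j) + (j - c))%N.
pose w c := if free c then 0 else if (c < j)%N then one else - one.
pose W c n (m : 'I_M.+1) : R := if free c then (0 < m <= N)%N%:R else
  B^-1 * cyc_lift N (h c) (T c n m).
have ind1 (b : bool) : `|b%:R : R| <= 1 by rewrite normr_nat -[1]/(1%:R) ler_nat leq_b1.
have liftB i x : i != j -> `|@cyc_lift R M N (h i) x| <= B.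
  move=> ij; rewrite /cyc_lift; case: (boolP (0 < x <= N)%N) => xN.
    by rewrite mul1r hB.
  by rewrite mul0r normr0 ltW.
have sysW : shift_system k u w W.
  split.
  - move=> c; rewrite /u; case: ifP => [_|/negbT]; first by rewrite /= (leq_ltn_trans _ jk).
    by rewrite negb_or -ltnNge => /andP[cj ck]; move: cj ck jk; clear; lia.
  - move=> c n m; rewrite /W; case: ifP => [_|/negbT]; first exact: ind1.
    rewrite negb_or => /andP[cj _]; rewrite normrM ger0_norm ?invr_ge0 ?(ltW B0) //.
    by rewrite ler_pdivrMl // mulr1 liftB.
  - move=> c n m; rewrite /W /u /w; case: (boolP (free c)) => [_|]; first by rewrite addr0.
    rewrite negb_or => /andP[cj _]; congr (_ * cyc_lift _ _ _).
    rewrite /T inZpD (inZpE (c - j + (j - c))%N).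
    case: (ltngtP c j) cj => // [cj|jc] _.
      by rewrite (_ : c - j + (j - c) = j - c)%N ?shift_lt_cancel //; move: cj; clear; lia.
    by rewrite (_ : c - j + (j - c) = c - j)%N ?shift_gt_cancel //; move: jc; clear; lia.
exists u, w, W; split => //.
rewrite /cyc_sum exchange_big /=.
transitivity (\sum_(x : 'I_M.+1) cyc_lift N (h j) x * (B ^+ (k - 1) * dual_function k W x)).
  rewrite (eq_bigr (fun m : 'I_M.+1 => \sum_(x : 'I_M.+1) (0 < m <= N)%N%:R *
      \prod_(i < k) cyc_lift N (h i) (x - m *+ j + m *+ i))); last first.
    by move=> m _; rewrite (reindex_inj (addIr (- (m *+ j)))).
  rewrite exchange_big /=; apply: eq_bigr => x _.
  rewrite /dual_function !mulr_sumr; apply: eq_bigr => m _.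
  rewrite (bigD1 (Ordinal jk)) //= subrK [in RHS](bigD1 (Ordinal jk)) //=.
  have -> : W j x m = (0 < m <= N)%N%:R by rewrite /W /free eqxx.
  have -> : \prod_(i < k | i != Ordinal jk) cyc_lift N (h i) (x - m *+ j + m *+ i) =
     B ^+ (k - 1) * \prod_(i < k | i != Ordinal jk) W i x m.
    have -> : B ^+ (k - 1) = \prod_(i < k | i != Ordinal jk) B.
      by rewrite prodr_const cardC1 card_ord subn1.
    rewrite -big_split /=; apply: eq_bigr => i ij.
    rewrite /W /free (negbTE (_ : i != j :> nat)) // leqNgt ltn_ord /= /T valZpK.
    by rewrite mulrA divff ?mul1r // gt_eqF.
  by ring.
rewrite mulr_sumr -(sum_ord_interval _ NM); apply: eq_bigr => x _.
by rewrite /cyc_lift; ring.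
Qed.

(** * Comparison of the two sums *)

Lemma ln_le_sqrt (R : realType) (x : R) : 0 < x -> ln x <= 2 * Num.sqrt x.
Proof.
move=> x0; have s0 : 0 < Num.sqrt x by rewrite sqrtr_gt0.
have {1}-> : x = Num.sqrt x * Num.sqrt x by rewrite -expr2 sqr_sqrtr // ltW.
rewrite lnM ?posrE //.
have := @le_ln1Dx R (Num.sqrt x - 1); rewrite addrCA subrr addr0 => h.
have : ln (Num.sqrt x) <= Num.sqrt x - 1 by apply: h; move: s0; clear; lra.
by clear; lra.
Qed.

Lemma root_scale (D N : nat) : (0 < D)%N -> exists z : nat,
  (z ^ D <= N)%N && (N < z.+1 ^ D)%N.
Proof.
move=> D0; have ex : exists z, (z ^ D <= N)%N by exists 0%N; rewrite exp0n.
have bd z : (z ^ D <= N)%N -> (z <= N)%N.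
  have [->//|z0] := posnP z.
  by apply: leq_trans; rewrite -{1}[z]expn1 leq_pexp2l.
have [z zN zmax] := ex_maxnP ex bd.
exists z; rewrite zN /= ltnNge; apply/negP => /zmax.
by rewrite ltnn.
Qed.

(** Of the [k] terms of the telescoped difference each has one factor
[Lambda_gamma - Lambda] and [k - 1] factors of size at most [z ^+ 3].  The
saving [z ^+ e] of [ps_prime_sum] with [e = (3 * (k - 1)).+1] exceeds the loss
[z ^+ (3 * (k - 1))] by [z]. *)
Lemma ap_sum_diff_le (R : realType) (k : nat) : (2 < k)%N ->
  exists2 D : nat, (0 < D)%N & forall g : R, 0 < g < 1 -> 1 - g < D%:R^-1 ->
  exists z0 : nat, forall (z : nat) (X : R), 0 <= X -> (z0 <= z)%N ->
   (z ^ D <= Num.truncn X)%N -> (Num.truncn X < z.+1 ^ D)%N ->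
  `|ap_sum k (mangoldt_ps g) X - ap_sum k (mangoldt R) X| * z%:R
     <= 2 * k%:R ^+ 2 * X ^+ 2.
Proof.
move=> k2; have k1 : (1 < k)%N by exact: ltnW.
have k0 : (0 < k)%N by exact: ltnW.
pose e := (3 * (k - 1)).+1.
have [D0 DP] := @ps_prime_sum R k k e k1 k0.
exists D0.+1 => // g g01 gD; have [g0 g1] := andP g01.
have [zz {}DP] := DP D0.+1 (leqnSn _) g g01.
have [n1 n1P] := exists_nat_ge (2 / g).
set D := D0.+1 in gD DP *.
exists (zz + n1 + 8 * D ^ 2 + 2)%N => z X X0 z0 zN Npow.
set N := Num.truncn X in zN Npow *.
have zzz : (zz <= z)%N by move: z0; clear; lia.
have zn1 : (n1 <= z)%N by move: z0; clear; lia.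
have zD : (8 * D ^ 2 <= z)%N by move: z0; clear; lia.
have z2 : (2 <= z)%N by move: z0; clear; lia.
have zp : (0 < z)%N by exact: leq_trans z2.
have zr1 : (1 : R) <= z%:R by rewrite ler1n.
have zr0 : (0 : R) < z%:R by rewrite ltr0n.
have Dr0 : (0 : R) < D%:R by rewrite ltr0n.
have N0 : (0 < N)%N by apply: leq_trans zN; rewrite expn_gt0 zp.
have Nr0 : (0 : R) < N%:R by rewrite ltr0n.
have N2z : N%:R <= (2 * z%:R) ^+ D :> R.
  rewrite -[2]/(2%:R) -natrM -natrX ler_nat (leq_trans (ltnW Npow)) //.
  by rewrite leq_exp2r //; move: zp; clear; lia.
have tz0 : 0 < 2 * z%:R :> R by rewrite mulr_gt0.
have Nz : N%:R `^ (1 - g) <= 2 * z%:R :> R.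
  have g1' : 0 <= 1 - g by move: g1; clear; lra.
  apply: (@le_trans _ _ (((2 * z%:R) ^+ D) `^ (1 - g))).
    by rewrite ge0_ler_powR ?nnegrE ?exprn_ge0 // ltW.
  rewrite -powR_mulrn ?(ltW tz0) // -powRrM.
  rewrite -[leRHS](powRr1 (ltW tz0)); apply: ler_powR.
    by move: zr1; clear; lra.
  by rewrite mulrC -ler_pdivlMr // mul1r ltW.
have lnN : ln N%:R <= z%:R :> R.
  apply: (@le_trans _ _ (D%:R * ln (2 * z%:R))).
    rewrite mulr_natl -lnXn // ler_ln ?posrE ?exprn_gt0 //.
  apply: (@le_trans _ _ (D%:R * (2 * Num.sqrt (2 * z%:R)))).
    by rewrite ler_wpM2l ?(ltW Dr0) // ln_le_sqrt.
  rewrite -(@ler_pXn2r _ 2) ?nnegrE ?mulr_ge0 ?sqrtr_ge0 ?(ltW Dr0) ?(ltW zr0) //.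
  rewrite !exprMn sqr_sqrtr ?(ltW tz0) //.
  have -> : D%:R ^+ 2 * (2 ^+ 2 * (2 * z%:R)) = (8 * D ^ 2)%:R * z%:R :> R.
    by rewrite natrM natrX; ring.
  by rewrite [leRHS]expr2 ler_wpM2r ?(ltW zr0) // ler_nat.
have NM : (N <= k * N)%N by rewrite leq_pmull.
rewrite !ap_sum_cyclic // -/N.
pose A (i : nat) (x : 'I_(k * N).+1) := cyc_lift N (mangoldt_ps g) x.
pose h j i n := if (i < j)%N then mangoldt_ps g n else
  if i == j then mangoldt_ps g n - mangoldt R n else mangoldt R n.
have tel : cyc_sum N k (fun=> @cyc_lift R (k * N) N (mangoldt_ps g)) -
    cyc_sum N k (fun=> @cyc_lift R (k * N) N (mangoldt R)) =
    \sum_(j < k) cyc_sum N k (fun i => @cyc_lift R (k * N) N (h j i)).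
  rewrite /cyc_sum [RHS]exchange_big /= -sumrB; apply: eq_bigr => x _.
  rewrite [RHS]exchange_big /= -sumrB; apply: eq_bigr => m _.
  rewrite -mulr_sumr -mulrBr; congr (_ * _).
  rewrite (telescope_prod k (fun i => cyc_lift N (mangoldt_ps g) (x + m *+ i))
    (fun i => cyc_lift N (mangoldt R) (x + m *+ i))).
  apply: eq_bigr => j _; apply: eq_bigr => i _.
  by rewrite /h /cyc_lift; case: ifP => // _; case: ifP => // _; rewrite -mulrBr.
rewrite tel.
pose B : R := z%:R ^+ 3.
have B0 : 0 < B by rewrite exprn_gt0.
have lam n : (0 < n <= N)%N -> 0 <= mangoldt R n <= z%:R.
  move=> /andP[n0 nN]; rewrite mangoldt_ge0 (le_trans (mangoldt_le_ln R n0)) //.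
  by rewrite (le_trans _ lnN) // ler_ln ?posrE ?ltr0n // ler_nat.
have hB j i n : i != j -> (0 < n <= N)%N -> `|h j i n| <= B.
  move=> ij nN; have /andP[l0 l1] := lam n nN.
  rewrite /h (negbTE ij); case: ifP => _; last first.
    rewrite ger0_norm // (le_trans l1) // /B -{1}[z%:R]expr1 ler_weXn2l //.
  have /andP[p0 p1] := ps_indicator_bounds g n.
  rewrite /mangoldt_ps -/(ps_indicator g n) ger0_norm ?mulr_ge0 ?powR_ge0 ?invr_ge0 ?(ltW g0) //.
  apply: (@le_trans _ _ (2 * z%:R / g * z%:R * 1)).
    have w1 : n%:R `^ (1 - g) <= 2 * z%:R :> R.
      apply: le_trans Nz; rewrite ge0_ler_powR ?nnegrE ?ler_nat //.
        by move: g1; clear; lra.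
      by case/andP: nN.
    apply: ler_pM => //; first by rewrite !mulr_ge0 ?powR_ge0 ?invr_ge0 ?(ltW g0).
    apply: ler_pM => //; first by rewrite mulr_ge0 ?powR_ge0 ?invr_ge0 ?(ltW g0).
    by rewrite ler_wpM2r ?invr_ge0 ?(ltW g0).
  have gz : 2 / g <= z%:R by rewrite (le_trans n1P) // ler_nat.
  rewrite /B mulr1; have -> : 2 * z%:R / g * z%:R = z%:R ^+ 2 * (2 / g) :> R by ring.
  by rewrite [leRHS]exprSr ler_wpM2l ?exprn_ge0 ?(ltW zr0).
have each (j : 'I_k) : `|cyc_sum N k (fun i => @cyc_lift R (k * N) N (h j i))| * z%:R
    <= 2 * k%:R * X ^+ 2.
  have [u [w [W [sysW ->]]]] := cyc_sum_dual (ltn_ord j) NM B0 (hB j).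
  have := DP z N _ u w W zzz zN Npow Nz lnN sysW.
  have -> : \sum_(1 <= n < N.+1) h j j n * dual_function k W n =
      \sum_(1 <= n < N.+1) (mangoldt_ps g n - mangoldt R n) * dual_function k W n.
    by apply: eq_bigr => n _; rewrite /h ltnn eqxx.
  rewrite card_ord normrM ger0_norm ?exprn_ge0 ?(ltW B0) //.
  move: (`|_|) => S hS.
  have -> : B ^+ (k - 1) * S * z%:R = S * z%:R ^+ e.
    by rewrite /B -exprM /e exprS; ring.
  apply: (le_trans hS); apply: (@le_trans _ _ (2 * k%:R * N%:R ^+ 2)).
    have -> : 2 * k%:R * N%:R ^+ 2 = N%:R * (2 * k * N)%:R :> R.
      by rewrite !natrM; ring.
    rewrite ler_wpM2l // ler_nat -mulnA mul2n -addnn -addn1 leq_add2l.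
    by rewrite muln_gt0 k0.
  rewrite ler_wpM2l ?mulr_ge0 //; apply: lerXn2r; rewrite ?nnegrE //.
  by rewrite truncn_le.
rewrite -ler_pdivlMr //; apply: (le_trans (ler_norm_sum _ _ _)).
rewrite ler_pdivlMr // mulr_suml.
apply: (@le_trans _ _ (\sum_(j < k) 2 * k%:R * X ^+ 2)); first by apply: ler_sum => j _.
by rewrite sumr_const card_ord -mulr_natr le_eqVlt; apply/orP; left; apply/eqP; ring.
Qed.

Theorem mainTheorem2 (R : realType) (k : nat) (hk : (3 <= k)%N) :
  exists2 eta0 : R, 0 < eta0 &
    forall gamma : R, 0 < gamma -> gamma < 1 -> 1 - gamma < eta0 ->
      exists2 E : R -> R^o,
        E =o_ +oo (fun X : R => X ^+ 2 : R^o) &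
        forall X : R, 3 <= X ->
          ap_sum k (mangoldt_ps gamma) X = ap_sum k (mangoldt R) X + E X.
Proof.
have [D D0 DP] := @ap_sum_diff_le R k hk.
exists D%:R^-1; first by rewrite invr_gt0 ltr0n.
move=> g g0 g1 gD.
have g01 : 0 < g < 1 by rewrite g0.
have [z0 zP] := DP g g01 gD.
pose E X : R^o := ap_sum k (mangoldt_ps g) X - ap_sum k (mangoldt R) X.
exists E; last by move=> X _; rewrite addrC subrK.
apply/eqoP => eps eps0.
have [n1 n1P] := exists_nat_ge (2 * k%:R ^+ 2 / eps : R).
pose z1 := (z0 + n1 + 1)%N.
near=> X.
have X1 : (z1 ^ D)%:R <= X by near: X; apply: nbhs_pinfty_ge; rewrite num_real.
have X0 : 0 <= X by apply: le_trans X1.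
have [z /andP[zN Nz]] := root_scale (Num.truncn X) D0.
have z1z : (z1 <= z)%N.
  have : (z1 ^ D <= Num.truncn X)%N by rewrite truncn_ge_nat.
  by move=> /leq_ltn_trans /(_ Nz); rewrite ltn_exp2r // ltnS.
have zz0 : (z0 <= z)%N by move: z1z; rewrite /z1; clear; lia.
have zr0 : (0 : R) < z%:R by rewrite ltr0n; move: z1z; rewrite /z1; clear; lia.
have H := zP z X X0 zz0 zN Nz.
have epsz : 2 * k%:R ^+ 2 <= eps * z%:R.
  rewrite -ler_pdivrMl // mulrC (le_trans n1P) // ler_nat.
  by move: z1z; rewrite /z1; clear; lia.
rewrite [`|X ^+ 2|]ger0_norm ?exprn_ge0 // -(ler_pM2r zr0) (le_trans H) //.
by rewrite [leRHS]mulrAC ler_wpM2r ?exprn_ge0.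
Unshelve. all: by end_near.
Qed.
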